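(* Let $(C_t=e^{-tA})_{t>0}$ be a strongly continuous hermitian contraction semigroup on a Hilbert space $\mathcal{H}$ with $\ker A=\{0\}$. For the corresponding reflection positive one-parameter group $(U_tf)(x):=e^{-itx}f(x)$ on $\mathcal{E}:=L^2(\mathbb{R},Q;\mathcal{H})$ (with subspace $\mathcal{E}_+$ as in the context), an outgoing realization is obtained by composing the inverse Fourier transform $\mathcal{F}^{-1}:L^2(\mathbb{R},\mathcal{H})\to L^2(\mathbb{R},\mathcal{H})$ with the unitary isomorphism $$T:\mathcal{E}\to L^2(\mathbb{R},\mathcal{H}),\qquad (Tf)(x):=\frac{1}{\sqrt\pi}\sqrt{A}\,(A+ix)^{-1}f(x).$$ That is, $T$ is a unitary isomorphism, and $S:=\mathcal{F}^{-1}\circ T$ satisfies $S(\mathcal{E}_+)=L^2([0,\infty[,\mathcal{H})$ and $(SU_tf)(y)=(Sf)(y-t)$ for $t\in\mathbb{R}$, $f\in\mathcal{E}$.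
   Context: $A\ge0$ is the self-adjoint generator of the hermitian (self-adjoint) contraction semigroup, $C_t=e^{-tA}$. Put $Q(x):=\frac1\pi A(A^2+x^2)^{-1}$ for $x\in\mathbb{R}$. $\mathcal{E}=L^2(\mathbb{R},Q;\mathcal{H})$ is the $\mathcal{H}$-valued $L^2$-space with scalar product $\langle f,g\rangle_{\mathcal{E}}=\int_{\mathbb{R}}\langle Q(x)f(x),g(x)\rangle\,dx$ (Hilbert space completion of the measurable functions $f:\mathbb{R}\to\mathcal{H}$ of finite norm, modulo null functions; $T$ is extended to the completion by continuity). $\mathcal{H}$ embeds isometrically in $\mathcal{E}$ as the constant functions. $\mathcal{E}_+$ is the closed subspace generated by $U_t\mathcal{H}$, $t>0$, and $(\theta f)(x)=f(-x)$; with these, $U$ is a reflection positive one-parameter group on $(\mathcal{E},\mathcal{E}_+,\theta)$, i.e. $\langle\theta f,f\rangle\ge0$ for $f\in\mathcal{E}_+$, $U_t\mathcal{E}_+\subseteq\mathcal{E}_+$ for $t>0$, and $\theta U_t\theta=U_{-t}$. An outgoing realization of $(U,\mathcal{E})$ is a unitary map of $\mathcal{E}$ onto some $L^2(\mathbb{R},\mathcal{M})$, $\mathcal{M}$ a Hilbert space, mapping $\mathcal{E}_+$ onto $L^2([0,\infty[,\mathcal{M})$ and turning $U_t$ into the translation $(L_tf)(x)=f(x-t)$. The Fourier transform is $(\mathcal{F}f)(\xi)=(2\pi)^{-1/2}\int_{\mathbb{R}}f(x)e^{-i\xi x}\,dx$, extended to a unitary operator on $L^2(\mathbb{R},\mathcal{H})$.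 *)

(* Defs.v *)
From HB Require Import structures.
From mathcomp Require Import all_boot all_order all_algebra.
From mathcomp Require Import sesquilinear complex.
From mathcomp Require Import all_classical all_reals all_analysis.

Set Implicit Arguments.
Unset Strict Implicit.
Unset Printing Implicit Defensive.

Import Order.TTheory GRing.Theory Num.Theory.
Import numFieldNormedType.Exports.

Local Open Scope classical_set_scope.
Local Open Scope complex_scope.
Local Open Scope ring_scope.

(* Complex Hilbert spaces. The inner product [hdot u v] is linear in [u] and
   conjugate-linear in [v]; no separability is assumed. *)
HB.mixin Record isHilbert (R : realType) H & CompleteNormedModule R[i] H := {
  hdot : {dot H for Num.conj};
  hdot_norm : forall u : H, `|u| ^+ 2 = hdot u u
}.

#[short(type="hilbertType")]
HB.structure Definition Hilbert (R : realType) :=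
  {H of CompleteNormedModule R[i] H & isHilbert R H}.

Section UnboundedOperators.
Context {R : realType} {H : hilbertType R}.

(* A partially defined operator is identified with its graph: [A u v] means
   that [u] lies in the domain of [A] and that [A] maps [u] to [v]. *)
Definition operator := H -> H -> Prop.
Implicit Types A B : operator.

Definition op_comp A B : operator := fun u w => exists2 v, B u v & A v w.

Definition op_inv A : operator := fun u v => A v u.

Definition op_shift A (z : R[i]) : operator :=
  fun u w => exists2 v, A u v & w = v + z *: u.

(* The value of a single-valued operator, and 0 outside its domain. *)
Definition op_val A (u : H) : H := xget 0 [set v | A u v].

Definition op_adjoint A : operator :=
  fun x y => forall u v, A u v -> hdot v x = hdot u y.

Definition selfadjoint A :=
  closure [set u | exists v, A u v] = setT /\
  forall x y, A x y <-> op_adjoint A x y.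

Definition nonneg_op A := forall u v, A u v -> 0 <= hdot v u.

Definition is_op_sqrt A B :=
  [/\ selfadjoint B, nonneg_op B & forall u w, op_comp B B u w <-> A u w].

(* The nonnegative self-adjoint square root is unique, so that this is its
   graph. *)
Definition op_sqrt A : operator := fun u v => exists2 B, is_op_sqrt A B & B u v.

Record hermitian_contraction_semigroup (C : R -> H -> H) : Prop := {
  hcs_linear : forall t, 0 < t -> linear (C t) ;
  hcs_add : forall s t u, 0 < s -> 0 < t -> C (s + t) u = C s (C t u) ;
  hcs_contract : forall t u, 0 < t -> `|C t u| <= `|u| ;
  hcs_herm : forall t u v, 0 < t -> hdot (C t u) v = hdot u (C t v) ;
  hcs_continuous : forall u, C t u @[t --> 0^'+] --> u }.

(* Sign convention: C_t = exp (- t A). *)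
Definition generator (C : R -> H -> H) : operator :=
  fun u v => (t^-1)%:C *: (u - C t u) @[t --> 0^'+] --> v.

(* Q(x) = pi^-1 A (A^2 + x^2)^-1, a bounded everywhere defined operator for
   x != 0; the value at the single point x = 0 is immaterial. *)
Definition Qweight A (x : R) (v : H) : H :=
  (pi^-1)%:C *: op_val (op_comp A (op_inv (op_shift (op_comp A A) (x ^+ 2)%:C))) v.

(* f |-> pi^(-1/2) A^(1/2) (A + i x)^-1 f(x) *)
Definition Tfun A (f : R -> H) (x : R) : H :=
  ((Num.sqrt pi)^-1)%:C *:
    op_val (op_comp (op_sqrt A) (op_inv (op_shift A (0 +i* x)))) (f x).

End UnboundedOperators.

Definition cis {R : realType} (x : R) : R[i] := cos x +i* sin x.

Definition modulation {R : realType} {H : hilbertType R} (t : R) (f : R -> H) :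
  R -> H := fun x => cis (- (t * x)) *: f x.

Section VectorValuedFunctions.
Context {R : realType}.
Local Notation mu := (@lebesgue_measure R).

Definition cintegral (g : R -> R[i]) : R[i] :=
  (\int[mu]_x complex.Re (g x)) +i* (\int[mu]_x complex.Im (g x)).

Context {H : hilbertType R}.
Implicit Types f g : R -> H.

Definition simple_fun f :=
  finite_set (range f) /\ forall v, measurable (f @^-1` [set v]).

Definition strongly_measurable f := exists s : nat -> R -> H,
  (forall n, simple_fun (s n)) /\ (forall x, s n x @[n --> \oo] --> f x).

(* [W : R -> H -> H] is an operator-valued weight; [fun _ => id] gives the
   ordinary space of square-integrable functions. *)
Definition L2fun (W : R -> H -> H) : set (R -> H) := [set f |
  strongly_measurable f /\
  (\int[mu]_x (complex.Re (hdot (W x (f x)) (f x)))%:E < +oo)%E].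

Definition L2dot (W : R -> H -> H) f g : R[i] :=
  cintegral (fun x => hdot (W x (f x)) (g x)).

Definition L1fun : set (R -> H) := [set f |
  strongly_measurable f /\ (\int[mu]_x (complex.Re `|f x|)%:E < +oo)%E].

(* [j] sends a function to its class. Only the values of [j] on [L2fun W] are
   meaningful. *)
Record L2map (W : R -> H -> H) (E : hilbertType R) (j : (R -> H) -> E) : Prop := {
  L2map_linear : forall (a : R[i]) f g, L2fun W f -> L2fun W g ->
    j (fun x => a *: f x + g x) = a *: j f + j g ;
  L2map_dot : forall f g, L2fun W f -> L2fun W g ->
    hdot (j f) (j g) = L2dot W f g }.

(* [E] is a Hilbert space completion of the functions of finite norm. *)
Definition L2completion W (E : hilbertType R) (j : (R -> H) -> E) :=
  L2map W j /\ closure (j @` L2fun W) = setT.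

(* [L] is L^2(R, H): every element is the class of a function. *)
Definition L2space (L : hilbertType R) (j : (R -> H) -> L) :=
  L2map (fun _ => id) j /\ j @` L2fun (fun _ => id) = setT.

(* The vector integral is taken in the weak sense. *)
Definition fourier_fun f (xi : R) : H := xget 0 [set h | forall v,
  hdot h v = ((Num.sqrt (2 * pi))^-1)%:C *
             cintegral (fun x => cis (- (xi * x)) * hdot (f x) v)].

End VectorValuedFunctions.

(* [T] is the extension by continuity of the map induced on classes by
   [phi : D1 -> D2]. *)
Definition extends {R : realType} {H K E F : hilbertType R}
    (D1 : set (R -> H)) (D2 : set (R -> K))
    (j1 : (R -> H) -> E) (j2 : (R -> K) -> F)
    (phi : (R -> H) -> (R -> K)) (T : E -> F) :=
  continuous T /\ forall f, D1 f -> D2 (phi f) /\ T (j1 f) = j2 (phi f).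

Definition unitary {R : realType} {E F : hilbertType R} (T : E -> F) :=
  [/\ linear T, forall u v, hdot (T u) (T v) = hdot u v
    & forall w, exists u, T u = w].

Definition fourier_transform {R : realType} {H L : hilbertType R}
    (j : (R -> H) -> L) (F : L -> L) :=
  unitary F /\
  extends (L1fun `&` L2fun (fun _ => id)) (L2fun (fun _ => id)) j j fourier_fun F.

Definition closed_subspace {R : realType} {E : hilbertType R} (V : set E) :=
  [/\ closed V, V 0
    & forall (a : R[i]) u v, V u -> V v -> V (a *: u + v)].

(* H sits in E as the (classes of) constant functions. *)
Definition Eplus {R : realType} {H E : hilbertType R} (j : (R -> H) -> E)
    (U : R -> E -> E) : set E :=
  smallest closed_subspace
    [set w | exists t v, 0 < t /\ w = U t (j (cst v))].

Definition L2halfline {R : realType} {M L : hilbertType R}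
    (j : (R -> M) -> L) : set L :=
  j @` [set f | L2fun (fun _ => id) f /\ forall y, y < 0 -> f y = 0].

(* Here [L], with class map [j], is L^2(R, M). *)
Definition outgoing_realization {R : realType} {E : hilbertType R}
    (Ep : set E) (U : R -> E -> E)
    {M L : hilbertType R} (j : (R -> M) -> L) (S : E -> L) :=
  [/\ unitary S, S @` Ep = L2halfline j
    & forall t u h, L2fun (fun _ => id) h -> S u = j h ->
        S (U t u) = j (fun y => h (y - t))].

(* Main.v *)
Require Import Defs.
From HB Require Import structures.
From mathcomp Require Import all_boot all_order all_algebra.
From mathcomp Require Import sesquilinear complex.
From mathcomp Require Import all_classical all_reals all_analysis.
From mathcomp Require Import measurable_realfun.
From mathcomp Require Import ring lra.

(** Everything is expressed through bounded operators. Let [J = (1 + A)^-1] and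
    [K = 1 - J = A J], and let [rJ], [rK] be their positive square roots. Then
    [rJ rK = A^(1/2) J] (called [sqA]) and [K + i x J = (A + i x) J] (called
    [nres x]), so that for [x != 0]
<<
      A^(1/2) (A + i x)^-1 = sqA (nres x)^-1,
      A (A^2 + x^2)^-1     = sqA^2 (nres x)^-1 (nres (- x))^-1.
>>
    As [nres (- x)] is the adjoint of [nres x], this gives
    [<Q(x) v, v> = |pi^(-1/2) A^(1/2) (A + i x)^-1 v|^2] ([Q_T0]): the map [T]
    is isometric already under the integral sign. It extends to the completion
    by [isometric_extension]. It is onto because, up to a constant factor, it
    sends [1_]a,b] (A + i x) J w] to the step [1_]a,b] sqA w]; the range of
    [sqA] is dense as [A] is injective, and the steps with values in a dense
    set span a dense subspace of [L^2] ([full_density]). Two facts on [A] are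
    needed here: the existence of [(1 + A)^-1], obtained from the semigroup as
    the limit of the resolvents of [2^n (1 - C_(2^-n))] ([resolvent_ex]), and
    the uniqueness of the nonnegative self-adjoint square root ([op_sqrtE]).

    [T] commutes with phases, and the Fourier transform turns translations into
    phases ([F_shift]); therefore [S U_t] is [S] followed by the translation by
    [t].

    For [E_+], the point is that the Laplace transform of the semigroup on the
    imaginary axis is the resolvent of [A] ([orbit_laplace]). Hence the
    constant [v] is mapped by [T] to [sqrt 2] times the Fourier transform of
    the orbit [y |-> 1_(y > 0) C_y A^(1/2) v], and by [S U_t] to [sqrt 2] times
    this orbit translated by [t]. This is computed for [v = J K^2 z]
    ([S_nice]), where [|C_y K^2 z| = O(1 / (1 + y^2))] makes all integrals
    converge ([orbit_bound]); these vectors are dense, and the norm of a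
    constant in [E] is bounded by its norm in [H], first for these vectors by
    the energy identity for the semigroup ([orbit_energy]), then in general by
    Fatou's lemma ([cst_L2Q]). As translated orbits vanish on the negative
    half-line, [S] maps [E_+] into [L^2([0, oo[)] ([S_Eplus_sub]). Conversely
    ([S_Eplus_sup]), the orbit of [w] started at [t] and the orbit of
    [C_(s - t) w] started at [s] agree after [s], so that their difference is
    [1_]t,s] C_(y - t) w]. On short intervals this is close to the step
    [1_]t,s] w], by strong continuity and relative to the norm of the step, so
    that adding up the pieces of a fine subdivision approximates the steps on
    long intervals. Thus the closed subspace [S(E_+)] contains enough steps on
    the half-line to be all of [L^2([0, oo[)] ([step_density]). *)

Import Order.TTheory GRing.Theory Num.Theory.
Import numFieldNormedType.Exports.
Local Open Scope classical_set_scope.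
Local Open Scope complex_scope.
Local Open Scope ring_scope.
Set Implicit Arguments.
Unset Strict Implicit.
Unset Printing Implicit Defensive.

(** * The underlying real Hilbert space *)

Section HilbertBasics.
Context {R : realType} {H : hilbertType R}.
Implicit Types (u v w : H) (a b : R) (z : R[i]).

(** Real parts of scalar products and real norms keep the estimates inside the
    ordered field [R]; [hdotE] recovers the complex scalar product. *)
Definition rdot u v : R := complex.Re (hdot u v).
Definition hn u : R := complex.Re `|u|.

Lemma hnE u : `|u| = (hn u)%:C.
Proof. by rewrite /hn; have /ger0_Im := normr_ge0 u; case: (`|u|) => x y /= ->. Qed.

Lemma hn_ge0 u : 0 <= hn u.
Proof. by have := normr_ge0 u; rewrite hnE lecR. Qed.

Lemma hn0 : hn 0 = 0.
Proof. by rewrite /hn normr0. Qed.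

Lemma hn_eq0 u : hn u = 0 -> u = 0.
Proof. by move=> h; apply: normr0_eq0; rewrite hnE h. Qed.

Lemma hnN u : hn (- u) = hn u.
Proof. by rewrite /hn normrN. Qed.

Lemma hnD u v : hn (u + v) <= hn u + hn v.
Proof. by have := ler_normD u v; rewrite !hnE -rmorphD /= lecR. Qed.

Lemma hnB u v : hn (u - v) <= hn u + hn v.
Proof. by rewrite -(hnN v) hnD. Qed.

Lemma hn_distC u v : hn (u - v) = hn (v - u).
Proof. by rewrite -hnN opprB. Qed.

Lemma hn_triangle w u v : hn (u - v) <= hn (u - w) + hn (w - v).
Proof. by apply: le_trans (hnD _ _); rewrite addrA subrK. Qed.

Lemma hn_lip u v : `|hn u - hn v| <= hn (u - v).
Proof.
have h1 : hn u <= hn (u - v) + hn v by rewrite -{1}(subrK v u) hnD.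
have h2 : hn v <= hn (u - v) + hn u by rewrite hn_distC -{1}(subrK u v) hnD.
by rewrite ler_norml; apply/andP; split; lra.
Qed.

Lemma hnZ z u : hn (z *: u) = complex.Re `|z| * hn u.
Proof.
rewrite /hn normrZ; have /ger0_Im := normr_ge0 z; have /ger0_Im := normr_ge0 u.
by case: `|u| => a b /= ->; case: `|z| => c d /= ->; rewrite mulr0 subr0.
Qed.

Lemma hnZr a u : hn (a%:C *: u) = `|a| * hn u.
Proof. by rewrite hnZ normc_def /= expr0n addr0 sqrtr_sqr. Qed.

Lemma hnZp a u : 0 <= a -> hn (a%:C *: u) = a * hn u.
Proof. by move=> a0; rewrite hnZr ger0_norm. Qed.

Lemma rdotE u : rdot u u = hn u ^+ 2.
Proof. by rewrite /rdot -hdot_norm hnE -rmorphXn. Qed.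

Lemma hdotC u v : hdot u v = (hdot v u)^*%C.
Proof. by have := hermC (@hdot R H) u v; rewrite expr0 mul1r => h; exact: h. Qed.

Lemma rdotC u v : rdot u v = rdot v u.
Proof. by rewrite /rdot hdotC; case: (hdot v u). Qed.

Lemma rdotDl u v w : rdot (u + v) w = rdot u w + rdot v w.
Proof. by rewrite /rdot linearDl raddfD. Qed.

Lemma rdotNl u w : rdot (- u) w = - rdot u w.
Proof. by rewrite /rdot linearNl raddfN. Qed.

Lemma rdotBl u v w : rdot (u - v) w = rdot u w - rdot v w.
Proof. by rewrite rdotDl rdotNl. Qed.

Lemma rdotDr u v w : rdot w (u + v) = rdot w u + rdot w v.
Proof. by rewrite !(rdotC w) rdotDl. Qed.

Lemma rdotNr u w : rdot w (- u) = - rdot w u.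
Proof. by rewrite !(rdotC w) rdotNl. Qed.

Lemma rdotBr u v w : rdot w (u - v) = rdot w u - rdot w v.
Proof. by rewrite !(rdotC w) rdotBl. Qed.

Lemma hdotZl z u v : hdot (z *: u) v = z * hdot u v.
Proof. by rewrite linearZl_LR. Qed.

Lemma hdotZr z u v : hdot u (z *: v) = z^*%C * hdot u v.
Proof. by rewrite hdotC hdotZl rmorphM /= -hdotC. Qed.

Lemma rdotZl a u v : rdot (a%:C *: u) v = a * rdot u v.
Proof. by rewrite /rdot hdotZl; case: (hdot u v) => x y /=; rewrite mul0r subr0. Qed.

Lemma rdotZr a u v : rdot u (a%:C *: v) = a * rdot u v.
Proof. by rewrite rdotC rdotZl rdotC. Qed.

(** The imaginary part of the scalar product is again a real scalar product,
    so that estimates on [rdot] control [hdot] entirely. *)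
Lemma hdotE u v : hdot u v = rdot u v +i* rdot u ('i%C *: v).
Proof.
rewrite /rdot hdotZr; case: (hdot u v) => x y /=.
by congr (_ +i* _); ring.
Qed.

Lemma rdotiC u v : rdot ('i%C *: u) v = - rdot u ('i%C *: v).
Proof.
rewrite /rdot hdotZr hdotZl; case: (hdot u v) => x y /=; ring.
Qed.

Lemma hni u : hn ('i%C *: u) = hn u.
Proof. by rewrite hnZ normc_def /= expr0n /= add0r expr1n sqrtr1 mul1r. Qed.

Lemma rdot0l u : rdot 0 u = 0.
Proof. by rewrite -(subrr (0:H)) rdotBl subrr. Qed.

Lemma rdot0r u : rdot u 0 = 0.
Proof. by rewrite rdotC rdot0l. Qed.

Lemma sqr_hnD u v : hn (u + v) ^+ 2 = hn u ^+ 2 + 2 * rdot u v + hn v ^+ 2.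
Proof. by rewrite -!rdotE rdotDl !rdotDr (rdotC v u); ring. Qed.

Lemma sqr_hnB u v : hn (u - v) ^+ 2 = hn u ^+ 2 - 2 * rdot u v + hn v ^+ 2.
Proof. by rewrite sqr_hnD rdotNr hnN; ring. Qed.

Lemma rdot_le u v : rdot u v <= hn u * hn v.
Proof.
have h1 : hn (u + v) ^+ 2 <= (hn u + hn v) ^+ 2.
  by rewrite ler_sqr ?nnegrE ?hn_ge0 ?addr_ge0 ?hn_ge0 // hnD.
by move: h1; rewrite sqr_hnD; lra.
Qed.

Lemma abs_rdot_le u v : `|rdot u v| <= hn u * hn v.
Proof.
rewrite ler_norml rdot_le andbT -lerNl -rdotNl.
by rewrite -(hnN u) rdot_le.
Qed.

Lemma rdot_inj u v : (forall w, rdot u w = rdot v w) -> u = v.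
Proof.
move=> h; apply/eqP; rewrite -subr_eq0; apply/eqP/hn_eq0/eqP.
by rewrite -sqrf_eq0 -rdotE rdotBl h subrr.
Qed.

Lemma hdot_inj u v : (forall w, hdot u w = hdot v w) -> u = v.
Proof. by move=> h; apply: rdot_inj => w; rewrite /rdot h. Qed.

Lemma realZ a b u : a%:C *: (b%:C *: u) = (a * b)%:C *: u.
Proof. by rewrite scalerA -rmorphM. Qed.

Section Convergence.
Context {T : Type} {F : set_system T} {FF : Filter F}.
Implicit Types (f g : T -> H) (l m : H).

Lemma cvg_hnP f l :
  f @ F --> l <-> (hn (f x - l) @[x --> F] --> (0 : R)).
Proof.
split.
  move=> /cvgrPdist_lt h; apply/cvgrPdist_lt => e e0.
  have := h e%:C; rewrite ltcR => /(_ e0); apply: filterS => x.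
  rewrite hnE ltcR => hx.
  by rewrite sub0r normrN ger0_norm ?hn_ge0 // hn_distC.
move=> /cvgrPdist_lt h; apply/cvgrPdist_lt => -[e e'].
rewrite ltcE /= => /andP[/eqP -> e0].
have := h _ e0; apply: filterS => x.
by rewrite sub0r normrN ger0_norm ?hn_ge0 // hn_distC hnE ltcR.
Qed.

Lemma cvg_hn_le f l (b : T -> R) :
  (\forall x \near F, hn (f x - l) <= b x) -> b x @[x --> F] --> (0:R) ->
  f @ F --> l.
Proof.
move=> hb b0; apply/cvg_hnP.
apply: (@squeeze_cvgr _ _ _ _ (fun=> 0) b) => //; last exact: cvg_cst.
by apply: filterS hb => x ->; rewrite hn_ge0.
Qed.

Lemma cvg_hn f l : f @ F --> l -> hn (f x) @[x --> F] --> hn l.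
Proof.
move=> /cvg_hnP h; apply/cvgrPdist_lt => e e0.
move/cvgrPdist_lt : h => /(_ _ e0); apply: filterS => x.
rewrite sub0r normrN ger0_norm ?hn_ge0 // => hx.
by apply: le_lt_trans hx; rewrite hn_distC hn_lip.
Qed.

Lemma cvg_rdot f g l m : f @ F --> l -> g @ F --> m ->
  rdot (f x) (g x) @[x --> F] --> rdot l m.
Proof.
move=> fl gm.
have E u v : rdot u v = 2^-1 * (hn (u + v) ^+ 2 - hn u ^+ 2 - hn v ^+ 2).
  by rewrite sqr_hnD; field.
have -> : (fun x => rdot (f x) (g x)) = (fun x => 2^-1 *
   (hn (f x + g x) ^+ 2 - hn (f x) ^+ 2 - hn (g x) ^+ 2)).
  by apply/funext => x; rewrite E.
rewrite E; apply: cvgMr; apply: cvgB; [apply: cvgB|].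
- by rewrite expr2; under eq_fun do rewrite expr2; apply: cvgM; apply: cvg_hn; apply: cvgD.
- by rewrite expr2; under eq_fun do rewrite expr2; apply: cvgM; apply: cvg_hn.
- by rewrite expr2; under eq_fun do rewrite expr2; apply: cvgM; apply: cvg_hn.
Qed.

End Convergence.

End HilbertBasics.

(** * Bounded operators: coercivity, mean ergodicity, square roots *)

Section LinearMaps.
Context {R : realType} {H K : hilbertType R}.
Variables (X : H -> K) (lX : linear X).

Lemma lin0 : X 0 = 0.
Proof.
have := lX 1 0 0; rewrite scale1r addr0 scale1r => h.
by apply: (addrI (X 0)); rewrite addr0 -h.
Qed.

Lemma linD u v : X (u + v) = X u + X v.
Proof. by have := lX 1 u v; rewrite !scale1r. Qed.

Lemma linZ a u : X (a *: u) = a *: X u.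
Proof. by have := lX a u 0; rewrite lin0 !addr0. Qed.

Lemma linN u : X (- u) = - X u.
Proof. by rewrite -scaleN1r linZ scaleN1r. Qed.

Lemma linB u v : X (u - v) = X u - X v.
Proof. by rewrite linD linN. Qed.

Lemma lin_cvg (b : R) {T : Type} {F : set_system T} {FF : Filter F}
    (f : T -> H) (l : H) : (forall u, hn (X u) <= b * hn u) ->
  f @ F --> l -> X (f x) @[x --> F] --> X l.
Proof.
move=> hb /cvg_hnP fl.
apply: (@cvg_hn_le _ _ _ _ _ _ _ (fun x => b * hn (f x - l))).
  by near=> x; rewrite -linB.
by rewrite -(mulr0 b); apply: cvgMr.
Unshelve. all: by end_near. Qed.

End LinearMaps.

Section Sequences.
Context {R : realType} {H : hilbertType R}.
Implicit Types (a : nat -> H) (b : nat -> R).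

Lemma hcvg_unique {T : Type} {F : set_system T} {FF : ProperFilter F}
  (f : T -> H) (l m : H) : f @ F --> l -> f @ F --> m -> l = m.
Proof. by move=> fl fm; apply: (cvg_unique _ fl fm); exact: norm_hausdorff. Qed.

Lemma hcauchy_cvg a :
  (forall e : R, 0 < e -> exists N, forall n, (N <= n)%N -> hn (a N - a n) < e) ->
  exists l : H, a @ \oo --> l.
Proof.
move=> h; suff /cauchy_cvg hc : cauchy (a @ \oo) by exists (lim (a @ \oo)).
apply: cauchy_exP => -[e e']; rewrite ltcE /= => /andP[/eqP -> e0].
have [N hN] := h _ e0; exists (a N); exists N => // n /= Nn.
by rewrite -ball_normE /= hnE ltcR; exact: hN.
Qed.

Lemma nonincr_cauchy b (e : R) : (forall m n, (m <= n)%N -> b n <= b m) ->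
  (forall n, 0 <= b n) -> 0 < e ->
  exists N, forall n, (N <= n)%N -> b N - b n < e.
Proof.
move=> bdec b0 e0.
have : cvgn b.
  apply: nonincreasing_is_cvgn => //; exists 0 => _ [n _ <-]; exact: b0.
move=> /cvgrPdist_lt /(_ (e / 2)); rewrite divr_gt0 // => /(_ isT) [N _ hN].
exists N => n Nn; have /= := hN _ (leqnn N); have /= := hN _ Nn.
by rewrite !ltr_norml => /andP[? ?] /andP[? ?]; lra.
Qed.

(** Monotone quantities of a Hilbert space control the squares of distances, so
    that the increments cannot be summed as in [hcvg_step]. *)
Lemma hcvg_sq a b :
  (forall m n, (m <= n)%N -> hn (a m - a n) ^+ 2 <= b m - b n) ->
  (forall n, 0 <= b n) -> exists l : H, a @ \oo --> l.
Proof.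
move=> h b0; apply: hcauchy_cvg => e e0.
have bdec m n : (m <= n)%N -> b n <= b m.
  by move=> /h hmn; have := sqr_ge0 (hn (a m - a n)); lra.
have [|N hN] := @nonincr_cauchy b (e ^+ 2) bdec b0; first exact: exprn_gt0.
exists N => n Nn; rewrite -(@ltr_pXn2r _ 2) ?nnegrE ?hn_ge0 // ?ltW //.
exact: le_lt_trans (h _ _ Nn) (hN _ Nn).
Qed.

Lemma hcvg_step a b : (forall n, hn (a n - a n.+1) <= b n - b n.+1) ->
  (forall n, 0 <= b n) -> exists l : H, a @ \oo --> l.
Proof.
move=> h b0; apply: hcauchy_cvg => e e0.
have hh m k : hn (a m - a (m + k)%N) <= b m - b (m + k)%N.
  elim: k => [|k IH]; first by rewrite addn0 !subrr hn0.
  apply: le_trans (hn_triangle (a (m + k)%N) _ _) _.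
  by rewrite addnS; move: IH (h (m + k)%N); lra.
have bdec m n : (m <= n)%N -> b n <= b m.
  move=> mn; have := hh m (n - m)%N; rewrite subnKC //.
  by have := hn_ge0 (a m - a n); lra.
have [N hN] := nonincr_cauchy bdec b0 e0.
exists N => n Nn; have := hh N (n - N)%N; rewrite subnKC // => {}hh.
exact: le_lt_trans hh (hN _ Nn).
Qed.

End Sequences.

Section BoundedOperators.
Context {R : realType} {H : hilbertType R}.
Implicit Types (X Y Z S P : H -> H) (u v w : H).

Definition symop X := forall u v, rdot (X u) v = rdot u (X v).
Definition posop X := forall u, 0 <= rdot (X u) u.
Definition dense_range (K : hilbertType R) (X : K -> H) :=
  forall u (e : R), 0 < e -> exists w : K, hn (u - X w) < e.

(** The iteration [a <- a + t (v - X a)] with small [t] contracts the residual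
    [v - X a]. *)
Lemma lax_milgram_real X (b c : R) : linear X ->
  (forall u, hn (X u) <= b * hn u) -> 0 < c ->
  (forall u, c * hn u ^+ 2 <= rdot (X u) u) ->
  forall v, exists u, X u = v.
Proof.
move=> lX hb c0 hc v.
pose B := `|b| + c.
have B0 : 0 < B by rewrite ltr_wpDl.
have hB u : hn (X u) <= B * hn u.
  apply: le_trans (hb u) _; apply: ler_wpM2r; first exact: hn_ge0.
  by apply: le_trans (ler_norm b) _; rewrite lerDl ltW.
have cB : c <= B by rewrite lerDr.
(* [t] minimizes the bound [1 - 2 t c + t^2 B^2] of the squared contraction
   factor, which is then [1 - t c <= (1 - t c / 2)^2]. *)
pose t := c / B ^+ 2.
have t0 : 0 < t by rewrite divr_gt0 // exprn_gt0.
pose a := fix a n := if n is m.+1 then a m + t%:C *: (v - X (a m)) else 0.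
have aS n : a n.+1 = a n + t%:C *: (v - X (a n)) by [].
pose r n := v - X (a n).
have rS n : r n.+1 = r n - t%:C *: X (r n).
  by rewrite /r aS (linD lX (a n)) (linZ lX) opprD addrA.
pose d := t * c / 2.
have tB : t * B ^+ 2 = c by rewrite /t mulfVK // expf_neq0 // gt_eqF.
have d0 : 0 < d by rewrite divr_gt0 // mulr_gt0.
have d1 : d <= 1.
  have : t * c <= 1.
    by rewrite /t mulrAC ler_pdivrMr ?exprn_gt0 // mul1r -expr2 ler_sqr // nnegrE ltW.
  by rewrite /d; have := mulr_gt0 t0 c0; lra.
have rle n : hn (r n.+1) <= (1 - d) * hn (r n).
  have d1' : 0 <= (1 - d) * hn (r n) by rewrite mulr_ge0 ?hn_ge0 // subr_ge0.
  rewrite -(@ler_pXn2r _ 2) ?nnegrE ?hn_ge0 //.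
  rewrite rS sqr_hnB rdotZr (hnZp _ (ltW t0)).
  have h1 := hc (r n); rewrite (rdotC (r n)).
  have h2 : (t * hn (X (r n))) ^+ 2 <= (t * c) * hn (r n) ^+ 2.
    have -> : (t * hn (X (r n))) ^+ 2 = t * t * hn (X (r n)) ^+ 2 by ring.
    have -> : t * c * hn (r n) ^+ 2 = t * t * (B * hn (r n)) ^+ 2.
      by rewrite -tB; ring.
    apply: ler_wpM2l; first by rewrite mulr_ge0 // ltW.
    by rewrite ler_sqr ?nnegrE ?hn_ge0 // mulr_ge0 ?hn_ge0 // ltW.
  have h3 : t * (c * hn (r n) ^+ 2) <= t * rdot (X (r n)) (r n).
    by apply: ler_wpM2l => //; exact: ltW.
  have h4 : 0 <= d ^+ 2 * hn (r n) ^+ 2 by rewrite -exprMn sqr_ge0.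
  have -> : ((1 - d) * hn (r n)) ^+ 2 =
    hn (r n) ^+ 2 - t * c * hn (r n) ^+ 2 + d ^+ 2 * hn (r n) ^+ 2.
    by rewrite /d; field.
  by move: h1 h2 h3 h4; lra.
have [|n|l al] := @hcvg_step _ _ a (fun n => t / d * hn (r n)).
- move=> n; rewrite aS opprD addrA subrr sub0r hnN (hnZp _ (ltW t0)).
  have -> : t * hn (v - X (a n)) = t / d * (d * hn (r n)).
    by rewrite /r; field; rewrite gt_eqF.
  rewrite -mulrBr; apply: ler_wpM2l; first by rewrite ltW // divr_gt0.
  by have := rle n; rewrite /r; lra.
- by rewrite mulr_ge0 ?hn_ge0 // ltW // divr_gt0.
exists l.
have h1 : r n @[n --> \oo] --> v - X l.
  by apply: cvgB; [exact: cvg_cst|exact: lin_cvg hB al].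
have h2 : r n @[n --> \oo] --> (0 : H).
  have -> : r = fun n => (t^-1)%:C *: (a n.+1 - a n).
    apply/funext => n; rewrite aS addrAC subrr add0r scalerA -rmorphM /=.
    by rewrite mulVf ?gt_eqF // scale1r.
  rewrite -(scaler0 _ (t^-1)%:C) -(subrr l); apply: cvgZr; apply: cvgB => //.
  by move: al; rewrite -(@cvg_shiftS _ a).
by apply/eqP; rewrite eq_sym -subr_eq0; apply/eqP; exact: hcvg_unique h1 h2.
Qed.

(** A complex factor can make [X] coercive and leaves its range unchanged. *)
Lemma lax_milgram X (z : R[i]) (b c : R) : linear X -> z != 0 ->
  (forall u, hn (X u) <= b * hn u) -> 0 < c ->
  (forall u, c * hn u ^+ 2 <= rdot (z *: X u) u) ->
  forall v, exists u, X u = v.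
Proof.
move=> lX z0 hb c0 hc v.
have [|u|u hu] := @lax_milgram_real (fun u => z *: X u) (complex.Re `|z| * b) c
  _ _ c0 hc (z *: v).
- by move=> a u w; rewrite lX scalerDr !scalerA mulrC.
- rewrite hnZ -mulrA ler_wpM2l //; have := normr_ge0 z.
  by case: `|z| => x y; rewrite lecE /= => /andP[].
by exists u; apply: (scalerI z0).
Qed.

(** Mean ergodic theorem: the vectors [(1 - X)^n u] converge to a vector killed
    by [X], hence to [0], while [u - (1 - X)^n u] lies in the range of [X]. The
    convergence comes from the monotonicity of [q n = <(1 - X)^n u, u>], as
    [|(1 - X)^m u - (1 - X)^n u|^2 = q (2 m) - 2 q (m + n) + q (2 n)]. *)
Lemma pos_inj_dense_range X : linear X -> symop X -> posop X ->
  (forall u, hn (X u) ^+ 2 <= rdot (X u) u) ->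
  (forall u, X u = 0 -> u = 0) -> dense_range X.
Proof.
move=> lX sX pX X1 iX u e e0.
have Xle w : hn (X w) <= hn w.
  have := le_trans (X1 w) (rdot_le _ _); rewrite expr2.
  have := hn_ge0 (X w); rewrite le_eqVlt => /predU1P[<- _|h]; first exact: hn_ge0.
  by rewrite ler_pM2l.
pose Y w := w - X w.
have sY w1 w2 : rdot (Y w1) w2 = rdot w1 (Y w2).
  by rewrite /Y rdotBl rdotBr sX.
have Y0 w : 0 <= rdot (Y w) w.
  rewrite /Y rdotBl rdotE subr_ge0; apply: le_trans (rdot_le _ _) _.
  by rewrite expr2 ler_wpM2r ?hn_ge0.
have Y1 w : rdot (Y w) w <= hn w ^+ 2.
  by rewrite /Y rdotBl rdotE gerBl.
have Y2 w : rdot (Y (Y w)) w <= rdot (Y w) w.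
  have := X1 w; rewrite sY rdotE /Y sqr_hnB rdotBl rdotE (rdotC w); lra.
pose a n := iter n Y u.
have aS n : a n.+1 = Y (a n) by [].
pose q n := rdot (a n) u.
have aa m n : rdot (a m) (a n) = q (m + n)%N.
  elim: n m => [|n IH] m; first by rewrite addn0.
  by rewrite aS -sY -aS addnS -addSn; exact: IH.
have qe k : q (k + k)%N = hn (a k) ^+ 2 by rewrite -aa rdotE.
have qo k : q (k + k).+1 = rdot (Y (a k)) (a k) by rewrite -addSn -aa aS.
have q0 n : 0 <= q n.
  rewrite -(odd_double_half n) -addnn; case: (odd n); rewrite ?add0n ?add1n.
    by rewrite qo Y0.
  by rewrite qe sqr_ge0.
have qS n : q n.+1 <= q n.
  rewrite -(odd_double_half n) -addnn; case: (odd n); rewrite ?add0n ?add1n.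
    by rewrite -addSn -addnS qe -rdotE qo !aS -sY; exact: Y2.
  by rewrite qo qe; exact: Y1.
have qdec m n : (m <= n)%N -> q n <= q m.
  move=> mn; rewrite -(subnK mn); elim: (n - m)%N => // k IH.
  exact: le_trans (qS _) IH.
have [||l al] := @hcvg_sq _ _ a (fun n => q (n + n)%N).
- move=> m n mn; rewrite sqr_hnB -!rdotE !aa.
  by have := qdec (m + n)%N (n + n)%N; rewrite leq_add2r mn => /(_ isT); lra.
- by move=> n; exact: q0.
have Xl : X l = 0.
  have h1 : X (a n) @[n --> \oo] --> X l.
    by apply: (@lin_cvg _ _ _ _ lX 1) al => w; rewrite mul1r.
  have h2 : X (a n) @[n --> \oo] --> (0 : H).
    rewrite -(subrr l).
    have -> : (fun n => X (a n)) = (fun n => a n - a n.+1).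
      by apply/funext => n; rewrite aS /Y opprB addrC subrK.
    by apply: cvgB => //; move: al; rewrite -(@cvg_shiftS _ a).
  exact: hcvg_unique h1 h2.
move: al; rewrite (iX _ Xl) => /cvg_hnP /cvgrPdist_lt /(_ _ e0) [N _ /(_ _ (leqnn N)) /=].
rewrite subr0 sub0r normrN ger0_norm ?hn_ge0 // => hN.
suff [w hw] : exists w, u - X w = a N by exists w; rewrite hw.
elim: N {hN} => [|n [w hw]]; first by exists 0; rewrite lin0 // subr0.
by exists (w + a n); rewrite (linD lX) opprD addrA hw.
Qed.

Lemma dense_range_comp X Y (b : R) : linear X -> (forall u, hn (X u) <= b * hn u) ->
  dense_range X -> dense_range Y -> dense_range (fun u => X (Y u)).
Proof.
move=> lX hb dX dY u e e0.
have e2 : 0 < e / 2 by rewrite divr_gt0.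
have [w hw] := dX u _ e2.
have B0 : 0 < `|b| + 1 by rewrite ltr_wpDl.
have [w' hw'] := dY w _ (divr_gt0 e2 B0).
exists w'; apply: le_lt_trans (hn_triangle (X w) _ _) _.
have : hn (X w - X (Y w')) <= e / 2.
  rewrite -(linB lX); apply: le_trans (hb _) _.
  apply: (@le_trans _ _ ((`|b| + 1) * hn (w - Y w'))).
    apply: ler_wpM2r; first exact: hn_ge0.
    by apply: le_trans (ler_norm _) _; rewrite lerDl.
  by move: hw'; rewrite ltr_pdivlMr // mulrC => /ltW.
by move: hw; lra.
Qed.

Lemma dense_range_sub (K K' : hilbertType R) (X : K -> H) (Y : K' -> H)
  (f : K' -> K) : (forall k, Y k = X (f k)) -> dense_range Y -> dense_range X.
Proof. by move=> h dY u e /(dY u)[w hw]; exists (f w); rewrite -h. Qed.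

(** Cauchy-Schwarz for the form of [X], obtained from its nonnegativity at
    [u - t X u]. *)
Lemma posop_eq0 X u : linear X -> symop X -> posop X ->
  rdot (X u) u = 0 -> X u = 0.
Proof.
move=> lX sX pX hu; apply: hn_eq0; apply/eqP; rewrite -sqrf_eq0; apply/eqP.
set p := hn (X u) ^+ 2; set c := rdot (X (X u)) (X u).
have p0 : 0 <= p by exact: sqr_ge0.
have c0 : 0 <= c by exact: pX.
have key (t : R) : 0 <= t -> 2 * t * p <= t ^+ 2 * c.
  move=> t0; have := pX (u - t%:C *: X u).
  rewrite (linB lX) (linZ lX) rdotBl !rdotBr !rdotZl !rdotZr -/c.
  by rewrite hu (sX (X u) u) (rdotE (X u)) -/p; lra.
have c1 : 0 < c + 1 by lra.
(* Any small [t] of the order of [p] contradicts [p > 0]. *)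
have := key (p / (c + 1)) (divr_ge0 p0 (ltW c1)).
rewrite -(@ler_pM2r _ ((c + 1) ^+ 2)) ?exprn_gt0 //.
have -> : 2 * (p / (c + 1)) * p * (c + 1) ^+ 2 = 2 * p ^+ 2 * (c + 1).
  by field; lra.
have -> : (p / (c + 1)) ^+ 2 * c * (c + 1) ^+ 2 = p ^+ 2 * c by field; lra.
move=> h; apply/eqP; rewrite -sqrf_eq0 eq_le sqr_ge0 andbT.
have : 0 <= p ^+ 2 * c by rewrite mulr_ge0 ?sqr_ge0.
by have := sqr_ge0 p; lra.
Qed.

(** On [y = (S - P) x] both quadratic forms vanish, since they are nonnegative
    with sum [<(S^2 - P^2) x, y> = 0]. *)
Lemma pos_sqrt_unique S P : linear S -> linear P -> symop S -> symop P ->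
  posop S -> posop P -> (forall u, S (P u) = P (S u)) ->
  (forall u, S (S u) = P (P u)) -> S =1 P.
Proof.
move=> lS lP sS sP pS pP SP SS x; set y := S x - P x.
have h : rdot (S y) y + rdot (P y) y = 0.
  by rewrite -rdotDl /y (linB lS) (linB lP) SS SP addrA subrK subrr rdot0l.
have hS : S y = 0.
  by apply: posop_eq0 => //; apply/eqP; rewrite eq_le pS andbT; have := pP y; lra.
have hP : P y = 0.
  by apply: posop_eq0 => //; apply/eqP; rewrite eq_le pP andbT; have := pS y; lra.
apply/eqP; rewrite -subr_eq0 -/y; apply/eqP/hn_eq0/eqP.
by rewrite -sqrf_eq0 -rdotE {1}/y rdotBl sS sP hS hP rdot0r subrr.
Qed.

End BoundedOperators.

Section SquareRoots.
Context {R : realType} {H : hilbertType R}.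
Implicit Types (X Y Z S P : H -> H) (u v w : H).

Lemma hcvg_le (f : nat -> H) (l : H) (c : R) (b : nat -> R) :
  f @ \oo --> l -> b n @[n --> \oo] --> c -> (forall n, hn (f n) <= b n) ->
  hn l <= c.
Proof. by move=> fl bc h; apply: (ler_cvg_to (cvg_hn fl) bc); near=> n; exact: h.
Unshelve. all: by end_near. Qed.

(** The iteration [Y <- (X + Y^2) / 2] converges to [1 - sqrt (1 - X)]; its
    increments are majorized by those of the scalar iteration for [X = 1],
    which increases and stays below [1]. All iterates are polynomials in [X],
    which gives the commutation statement. *)
Lemma bounded_sqrt X : linear X -> symop X -> (forall u, hn (X u) <= hn u) ->
  exists S, [/\ linear S, symop S, (forall u, hn (u - S u) <= hn u),
    (forall u, S (S u) = u - X u) &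
    forall Z (b : R), linear Z -> (forall u, hn (Z u) <= b * hn u) ->
      (forall u, Z (X u) = X (Z u)) -> forall u, Z (S u) = S (Z u)].
Proof.
move=> lX sX X1.
pose Y := fix Y n u := if n is m.+1 then (2^-1)%:C *: (X u + Y m (Y m u)) else 0.
pose y := fix y n : R := if n is m.+1 then 2^-1 * (1 + y m * y m) else 0.
have YS n u : Y n.+1 u = (2^-1)%:C *: (X u + Y n (Y n u)) by [].
have yS n : y n.+1 = 2^-1 * (1 + y n * y n) by [].
have y01 n : 0 <= y n <= 1.
  elim: n => [|n /andP[h1 h2]]; first by rewrite lexx ler01.
  have h3 : y n * y n <= 1 by rewrite mulr_ile1.
  have h4 : 0 <= y n * y n by rewrite mulr_ge0.
  by rewrite yS; apply/andP; split; lra.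
have y0 n : 0 <= y n by case/andP: (y01 n).
have yinc n : y n <= y n.+1.
  elim: n => [|n IH]; first by rewrite /= mulr0 addr0 mulr1 invr_ge0.
  rewrite !yS ler_pM2l ?invr_gt0 // lerD2l ler_pM //.
have lY n : linear (Y n).
  elim: n => [|n IH] a u v; first by rewrite /= scaler0 addr0.
  rewrite !YS lX !IH scalerDr; rewrite !scalerDr !scalerA [_ * a]mulrC.
  by rewrite -!addrA; congr (_ + _); rewrite addrCA.
have sY n : symop (Y n).
  elim: n => [|n IH] u v; first by rewrite rdot0l rdot0r.
  by rewrite !YS rdotZl rdotZr rdotDl rdotDr sX !IH.
have Yle n u : hn (Y n u) <= y n * hn u.
  elim: n u => [|n IH] u; first by rewrite mul0r /= hn0.
  rewrite YS yS hnZp ?invr_ge0 // -mulrA ler_wpM2l ?invr_ge0 //.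
  apply: le_trans (hnD _ _) _; rewrite mulrDl mul1r lerD //.
  by apply: le_trans (IH _) _; rewrite -mulrA ler_wpM2l.
have Y1 n u : hn (Y n u) <= hn u.
  apply: le_trans (Yle n u) _; rewrite ler_piMl ?hn_ge0 //.
  by case/andP: (y01 n).
have step n u : hn (Y n u - Y n.+1 u) <= (y n.+1 - y n) * hn u.
  elim: n u => [|n IH] u.
    by rewrite sub0r hnN; apply: le_trans (Yle _ _) _; rewrite subr0.
  have -> : Y n.+1 u - Y n.+2 u = (2^-1)%:C *:
     (Y n (Y n u - Y n.+1 u) + (Y n (Y n.+1 u) - Y n.+1 (Y n.+1 u))).
    rewrite (linB (lY n)) addrA subrK [Y n.+2 u]YS [Y n.+1 u in LHS]YS -scalerBr.
    by congr (_ *: _); rewrite opprD addrACA subrr add0r.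
  have -> : y n.+2 - y n.+1 = 2^-1 * (y n * (y n.+1 - y n) + (y n.+1 - y n) * y n.+1).
    have -> : y n.+2 - y n.+1 = 2^-1 * (1 + y n.+1 * y n.+1) - 2^-1 * (1 + y n * y n).
      by rewrite -!yS.
    by ring.
  rewrite hnZp ?invr_ge0 // -mulrA ler_wpM2l ?invr_ge0 //.
  apply: le_trans (hnD _ _) _; rewrite mulrDl lerD //.
    by apply: le_trans (Yle _ _) _; rewrite -mulrA ler_wpM2l.
  apply: le_trans (IH _) _; rewrite -mulrA ler_wpM2l ?subr_ge0 //.
have hcv u : exists l : H, Y n u @[n --> \oo] --> l.
  apply: (@hcvg_step _ _ (Y ^~ u) (fun n => (1 - y n) * hn u)) => n.
    by apply: le_trans (step n u) _; rewrite -mulrBl; apply: ler_wpM2r;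
      [exact: hn_ge0|lra].
  by rewrite mulr_ge0 ?hn_ge0 // subr_ge0; case/andP: (y01 n).
have [L hL] := choice hcv.
have lL : linear L.
  move=> a u v; apply: hcvg_unique (hL _) _.
  under eq_fun do rewrite lY.
  by apply: cvgD; [apply: cvgZr; exact: hL | exact: hL].
have sL : symop L.
  move=> u v.
  have h1 : rdot (Y n u) v @[n --> \oo] --> rdot (L u) v.
    by apply: cvg_rdot; [exact: hL|exact: cvg_cst].
  have h2 : rdot (Y n u) v @[n --> \oo] --> rdot u (L v).
    under eq_fun do rewrite sY.
    by apply: cvg_rdot; [exact: cvg_cst|exact: hL].
  by apply: (cvg_unique _ h1 h2); exact: norm_hausdorff.
have L1 u : hn (L u) <= hn u.
  by apply: (hcvg_le (hL u) (cvg_cst _)) => n; exact: Y1.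
have YY u : Y n (Y n u) @[n --> \oo] --> L (L u).
  apply: (@cvg_hn_le _ _ _ _ _ _ _ (fun n => hn (Y n u - L u) + hn (Y n (L u) - L (L u)))).
    near=> n; apply: le_trans (hn_triangle (Y n (L u)) _ _) _.
    by rewrite -(linB (lY n)) lerD2r.
  rewrite -(addr0 (0 : R)); apply: cvgD; exact/cvg_hnP/hL.
have LE u : L u = (2^-1)%:C *: (X u + L (L u)).
  apply: hcvg_unique (_ : Y n.+1 u @[n --> \oo] --> L u) _.
    by have := hL u; rewrite -(@cvg_shiftS _ (Y^~ u)).
  under eq_fun do rewrite YS.
  by apply: cvgZr; apply: cvgD; [exact: cvg_cst|exact: YY].
exists (fun u => u - L u); split.
- by move=> a u v; rewrite lL scalerBr opprD addrACA.
- by move=> u v; rewrite rdotBl rdotBr sL.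
- by move=> u; rewrite opprB addrC subrK.
- move=> u; rewrite (linB lL).
  have -> : X u = L u + L u - L (L u).
    have -> : L u + L u = X u + L (L u); last by rewrite addrK.
    rewrite {1 2}LE -scalerDl -rmorphD /= (_ : 2^-1 + 2^-1 = 1); last by field.
    by rewrite scale1r.
  rewrite (opprB (L u) (L (L u))) (opprB (L u + L u)) -addrA; congr (_ + _).
  by rewrite opprD addrCA.
- move=> Z b lZ Zb ZX.
  have ZY n u : Z (Y n u) = Y n (Z u).
    elim: n u => [|n IH] u; first by rewrite (lin0 lZ).
    by rewrite !YS (linZ lZ) (linD lZ) ZX !IH.
  move=> u; rewrite (linB lZ); congr (_ - _).
  have h1 : Z (Y n u) @[n --> \oo] --> Z (L u) by exact: (lin_cvg lZ Zb (hL u)).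
  have h2 : Z (Y n u) @[n --> \oo] --> L (Z u).
    by under eq_fun do rewrite ZY; exact: hL.
  exact: (hcvg_unique h1 h2).
Unshelve. all: by end_near. Qed.

Lemma half_posop S : (forall u : H, hn (u - S u) <= hn u) -> posop S.
Proof.
move=> h u; have : hn (u - S u) ^+ 2 <= hn u ^+ 2.
  by rewrite ler_sqr ?nnegrE ?hn_ge0.
by rewrite sqr_hnB rdotC; have := sqr_ge0 (hn (S u)); lra.
Qed.

End SquareRoots.

(** * The generator and its resolvent *)

Section Semigroup.
Context {R : realType} {H : hilbertType R}.
Variables (C : R -> H -> H) (hC : hermitian_contraction_semigroup C).
Implicit Types (u v w z : H) (s t : R).

(** The value at [0] lets the semigroup law include the endpoint; being the
    identity at negative times too makes orbits continuous on the whole line. *)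
Definition Cz t : H -> H := if 0 < t then C t else id.

Lemma CzE t : 0 < t -> Cz t = C t. Proof. by rewrite /Cz => ->. Qed.

Lemma Cz0 : Cz 0 = id. Proof. by rewrite /Cz ltxx. Qed.

Lemma Cz_lin t : linear (Cz t).
Proof. by rewrite /Cz; case: ifP => // /(hcs_linear hC). Qed.

Lemma Cz_le t u : hn (Cz t u) <= hn u.
Proof.
rewrite /Cz; case: ifP => // t0.
by have := hcs_contract hC u t0; rewrite !hnE lecR.
Qed.

Lemma Cz_add s t u : 0 <= s -> 0 <= t -> Cz (s + t) u = Cz s (Cz t u).
Proof.
rewrite le_eqVlt => /predU1P[<- _|s0]; first by rewrite add0r Cz0.
rewrite le_eqVlt => /predU1P[<-|t0]; first by rewrite addr0 Cz0.
by rewrite !CzE ?addr_gt0 //; apply: hcs_add.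
Qed.

Lemma CzC s t u : 0 <= s -> 0 <= t -> Cz s (Cz t u) = Cz t (Cz s u).
Proof. by move=> s0 t0; rewrite -!Cz_add // addrC. Qed.

Lemma Cz_sym t : symop (Cz t).
Proof.
rewrite /Cz; case: ifP => // t0 u v.
by rewrite /rdot (hcs_herm hC).
Qed.

Lemma Cz_half t u : Cz t u = Cz (t / 2) (Cz (t / 2) u).
Proof.
have [t0|t0] := ltP 0 t.
  by rewrite -Cz_add ?divr_ge0 ?ltW // -splitr.
by rewrite /Cz !ltNge t0 /= ler_pdivrMr // mul0r t0.
Qed.

Lemma sqr_Cz t u : hn (Cz (t / 2) u) ^+ 2 = rdot (Cz t u) u.
Proof. by rewrite (Cz_half t) Cz_sym rdotE. Qed.

Lemma Cz_pos t : posop (Cz t).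
Proof. by move=> u; rewrite -sqr_Cz sqr_ge0. Qed.

Lemma Cz_cont0 u (e : R) : 0 < e ->
  exists2 d : R, 0 < d & forall s, 0 <= s < d -> hn (Cz s u - u) < e.
Proof.
move=> e0; have /cvg_hnP /cvgrPdist_lt /(_ _ e0) := @hcs_continuous _ _ _ hC u.
move=> [d /= d0 hd].
exists d => // s /andP[]; rewrite le_eqVlt => /predU1P[<- _|s0 sd].
  by rewrite Cz0 subrr hn0.
have := hd s; rewrite /= sub0r normrN gtr0_norm // => /(_ sd s0).
by rewrite sub0r normrN ger0_norm ?hn_ge0 // CzE.
Qed.

Lemma Cz_unif s t u : 0 <= s -> s <= t -> hn (Cz t u - Cz s u) <= hn (Cz (t - s) u - u).
Proof.
move=> s0 st.
have -> : Cz t u = Cz s (Cz (t - s) u).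
  by rewrite -Cz_add ?subr_ge0 // (addrC s) subrK.
by rewrite -(linB (Cz_lin s)) Cz_le.
Qed.

(** Clearing the factor [t^-1] gives errors that add up along subdivisions. *)
Lemma generatorP u v : generator C u v <-> forall e : R, 0 < e ->
  exists2 d : R, 0 < d & forall t, 0 < t < d ->
    hn (u - Cz t u - t%:C *: v) <= t * e.
Proof.
have E t : 0 < t -> hn (u - Cz t u - t%:C *: v) =
    t * hn ((t^-1)%:C *: (u - C t u) - v).
  move=> t0; rewrite -(hnZp _ (ltW t0)) scalerBr realZ mulfV ?gt_eqF //.
  by rewrite scale1r CzE.
split.
  move=> /cvg_hnP /cvgrPdist_lt h e e0; have [d /= d0 hd] := h _ e0.
  exists d => // t /andP[t0 td]; rewrite E // ler_pM2l //.
  have := hd t; rewrite /= sub0r normrN gtr0_norm // => /(_ td t0).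
  by rewrite sub0r normrN ger0_norm ?hn_ge0 // => /ltW.
move=> h; apply/cvg_hnP/cvgrPdist_le => e e0; have [d d0 hd] := h e e0.
exists d => //= t td t0; move: td; rewrite /= sub0r normrN gtr0_norm // => td.
have := hd t; rewrite t0 td E // ler_pM2l // => /(_ isT).
by rewrite sub0r normrN ger0_norm ?hn_ge0.
Qed.

Lemma generator_cvg u v : generator C u v ->
  (t^-1)%:C *: (u - Cz t u) @[t --> 0^'+] --> v.
Proof.
apply: cvg_trans; apply: near_eq_cvg.
by near=> t; rewrite CzE.
Unshelve. all: by end_near. Qed.

Lemma generator_lin (a : R[i]) u v u' v' : generator C u v -> generator C u' v' ->
  generator C (a *: u + u') (a *: v + v').
Proof.
move=> h h'.
have : a *: ((t^-1)%:C *: (u - C t u)) + (t^-1)%:C *: (u' - C t u') @[t --> 0^'+]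
  --> a *: v + v' by apply: cvgD => //; exact: cvgZr.
apply: cvg_trans; apply: near_eq_cvg; near=> t.
rewrite (hcs_linear hC) // scalerA mulrC -scalerA -scalerDr; congr (_ *: _).
by rewrite scalerBr opprD addrACA.
Unshelve. all: by end_near. Qed.

Lemma generator_sym u v u' v' : generator C u v -> generator C u' v' ->
  rdot v u' = rdot u v'.
Proof.
move=> /generator_cvg h /generator_cvg h'.
have h1 : rdot ((t^-1)%:C *: (u - Cz t u)) u' @[t --> 0^'+] --> rdot v u'.
  by apply: cvg_rdot => //; exact: cvg_cst.
have h2 : rdot ((t^-1)%:C *: (u - Cz t u)) u' @[t --> 0^'+] --> rdot u v'.
  have -> : (fun t => rdot ((t^-1)%:C *: (u - Cz t u)) u') =
     (fun t => rdot u ((t^-1)%:C *: (u' - Cz t u'))).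
    by apply/funext => t; rewrite rdotZl rdotZr rdotBl rdotBr Cz_sym.
  by apply: cvg_rdot => //; exact: cvg_cst.
by apply: (cvg_unique _ h1 h2); exact: norm_hausdorff.
Qed.

Lemma generator_ge0 u v : generator C u v -> 0 <= rdot v u.
Proof.
move=> /generator_cvg h.
have h1 : rdot ((t^-1)%:C *: (u - Cz t u)) u @[t --> 0^'+] --> rdot v u.
  by apply: cvg_rdot => //; exact: cvg_cst.
apply: (ler_cvg_to (cvg_cst 0) h1); near=> t.
rewrite rdotZl rdotBl mulr_ge0 ?invr_ge0 // subr_ge0 rdotE -sqr_Cz.
by rewrite ler_sqr ?nnegrE ?hn_ge0 // Cz_le.
Unshelve. all: by end_near. Qed.

Lemma generator_Cz s u v : 0 <= s -> generator C u v -> generator C (Cz s u) (Cz s v).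
Proof.
move=> s0 /generatorP h; apply/generatorP => e e0.
have [d d0 hd] := h e e0; exists d => // t td.
apply: le_trans (hd t td); case/andP: td => t0 _.
rewrite CzC ?(ltW t0) // -(linZ (Cz_lin s)) -!(linB (Cz_lin s)).
exact: Cz_le.
Qed.

End Semigroup.

Section ResolventExistence.
Context {R : realType} {H : hilbertType R}.
Variables (C : R -> H -> H) (hC : hermitian_contraction_semigroup C).
Implicit Types (u v w z : H) (s t : R).
Local Notation Cz := (Cz C).

Let p n : R := 2 ^+ n.
Let A n u := (p n)%:C *: (u - Cz (p n)^-1 u).
Let D n u := u - Cz (p n)^-1 u.

Let p0 n : 0 < p n. Proof. exact: exprn_gt0. Qed.

Let pV0 n : 0 <= (p n)^-1. Proof. by rewrite invr_ge0 ltW. Qed.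

Let A_lin n : linear (A n).
Proof.
move=> a u v; rewrite /A (Cz_lin hC) scalerA mulrC -scalerA -scalerDr; congr (_ *: _).
by rewrite scalerBr opprD addrACA.
Qed.

Let A_pos n : posop (A n).
Proof.
move=> u; rewrite rdotZl mulr_ge0 ?(ltW (p0 n)) // rdotBl subr_ge0 rdotE -(sqr_Cz hC).
by rewrite ler_sqr ?nnegrE ?hn_ge0 // Cz_le.
Qed.

Let A_comm m n u : A m (A n u) = A n (A m u).
Proof.
rewrite /A; set c := Cz (p m)^-1; set d := Cz (p n)^-1.
have lc : linear c by exact: Cz_lin.
have ld : linear d by exact: Cz_lin.
rewrite (linZ lc) (linZ ld) -!scalerBr !realZ mulrC; congr (_ *: _).
have cd : c (d u) = d (c u) by apply: CzC.
rewrite (linB lc) (linB ld) cd.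
by rewrite !opprB addrACA [RHS]addrACA; congr (_ + _); rewrite addrC.
Qed.

Let AD_comm m n u : A m (D n u) = D n (A m u).
Proof.
have E v : D n v = ((p n)^-1)%:C *: A n v.
  by rewrite /A realZ mulVf ?gt_eqF // scale1r.
by rewrite !E (linZ (A_lin m)) A_comm.
Qed.

(** [1 - c^2 = 2 (1 - c) - (1 - c)^2] with [c = C_(2^-(n+1))]. *)
Let A_step n u : A n.+1 u - A n u = (p n)%:C *: D n.+1 (D n.+1 u).
Proof.
rewrite /A /D; set c := Cz (p n.+1)^-1.
have -> : Cz (p n)^-1 u = c (c u).
  have e : (p n.+1)^-1 = (p n)^-1 / 2 by rewrite /p exprS invfM mulrC.
  by rewrite /c e; exact: Cz_half.
have lc : linear c by exact: Cz_lin.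
rewrite (linB lc) {1}/p exprS (_ : 2 * 2 ^+ n = p n + p n); last by rewrite /p; ring.
rewrite rmorphD scalerDl -addrA -scalerBr -scalerDr; congr (_ *: _).
by congr (_ + _); rewrite !opprB addrC addrA subrK.
Qed.

Let A_exists n u : exists w, w + A n w = u.
Proof.
apply: (@lax_milgram_real _ _ (fun w => w + A n w) (1 + 2 * p n) 1).
- by move=> a v w; rewrite A_lin scalerDr addrACA.
- move=> v; apply: le_trans (hnD _ _) _; rewrite mulrDl mul1r lerD2l.
  rewrite hnZp ?(ltW (p0 n)) // -mulrA mulrCA ler_wpM2l ?(ltW (p0 n)) //.
  apply: le_trans (hnB _ _) _; rewrite mulr_natl mulr2n lerD2l.
  exact: Cz_le.
- exact: ltr01.
- by move=> v; rewrite mul1r rdotDl rdotE lerDl A_pos.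
Qed.

Let A_inj n u v : u + A n u = v + A n v -> u = v.
Proof.
move=> e; apply/eqP; rewrite -subr_eq0; apply/eqP/hn_eq0/eqP; rewrite -sqrf_eq0.
have : (u - v) + A n (u - v) = 0.
  by rewrite (linB (A_lin n)) addrACA e -opprD subrr.
move=> /(congr1 (rdot ^~ (u - v))); rewrite rdotDl rdotE rdot0l => h.
by rewrite eq_le sqr_ge0 andbT; have := A_pos n (u - v); lra.
Qed.

(** The approximate generators increase with [n], hence the approximate
    resolvents decrease, in the strong sense that makes their images of a
    fixed vector a Cauchy sequence. *)
Let A_mono m n y : (m <= n)%N -> 0 <= rdot (A n y - A m y) y /\
  0 <= rdot (A n y - A m y) (A m y).
Proof.
move=> mn; rewrite -(subnK mn); elim: (n - m)%N => [|k [IH1 IH2]].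
  by rewrite add0n subrr !rdot0l.
rewrite addSn; have -> : A (k + m).+1 y - A m y =
    (A (k + m).+1 y - A (k + m)%N y) + (A (k + m)%N y - A m y).
  by rewrite addrA subrK.
have Ds : symop (D (k + m).+1).
  by move=> u v; rewrite rdotBl rdotBr (Cz_sym hC).
rewrite A_step [rdot (_ + _) y]rdotDl [rdot (_ + _) (A m y)]rdotDl.
rewrite [rdot (_ *: _) y]rdotZl [rdot (_ *: _) (A m y)]rdotZl !(Ds (D (k + m).+1 y)) rdotE; split; apply: addr_ge0 => //.
  by rewrite mulr_ge0 ?sqr_ge0 // ltW.
rewrite mulr_ge0 ?(ltW (p0 _)) //.
by rewrite -AD_comm rdotC A_pos.
Qed.

(** [w m - w n = (A n - A m) (1 + A m)^-1 (w n)] has a nonnegative scalar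
    product with [w n], by monotonicity of the [A n]. *)
Let w_cvg (w : nat -> H) u : (forall n, w n + A n (w n) = u) ->
  exists l : H, w @ \oo --> l.
Proof.
move=> hw; apply: (@hcvg_sq _ _ w (fun n => hn (w n) ^+ 2)); last first.
  by move=> n; exact: sqr_ge0.
move=> m n mn.
suff h : 0 <= rdot (w m - w n) (w n).
  by rewrite sqr_hnB; move: h; rewrite rdotBl rdotE; lra.
have [y hy] := A_exists m (w n).
have -> : w m - w n = A n y - A m y.
  apply: (@A_inj m).
  rewrite (linB (A_lin m)) addrACA hw -opprD -{1}(hw n) opprD addrACA subrr add0r.
  rewrite (linB (A_lin m)) (A_comm m n) -{1 2}hy (linD (A_lin n)) (linD (A_lin m)).
  by rewrite opprD addrACA.
have [h1 h2] := A_mono y mn.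
by rewrite -hy rdotDr addr_ge0.
Qed.

(** Let [l] be the limit of [w n = (1 + A_n)^-1 u], so that [A_n (w n)]
    converges to [z = u - l]. For [t] on the grid of step [2^-n],
    [w n - C_t (w n)] is the sum of the [2^-n C_s (A_n (w n))] over the grid
    points [s < t]; in the limit, [l - C_t l] differs from [t z] by at most
    [t e] as soon as [C_s z] differs from [z] by at most [e] for all
    [s <= t]. *)
Lemma resolvent_ex u : exists g, generator C g (u - g).
Proof.
have [w hw] := choice (A_exists ^~ u).
have [l wl] := w_cvg hw.
exists l; set z := u - l.
have zn n : u - w n = A n (w n) by rewrite -(hw n) addrAC subrr add0r.
have znz : A n (w n) @[n --> \oo] --> z.
  by under eq_fun do rewrite -zn; apply: cvgB => //; exact: cvg_cst.
have key (t e : R) : 0 < t -> 0 <= e ->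
    (forall s, 0 <= s <= t -> hn (Cz s z - z) <= e) ->
    hn (l - Cz t l - t%:C *: z) <= t * e.
  move=> t0 e0 he.
  (* Number of steps of length [2^-n] that fit into [[0, t]]. *)
  pose N n := Num.truncn (t * p n).
  have Nt n : 0 <= t - (N n)%:R / p n <= (p n)^-1.
    have tp : 0 <= t * p n by rewrite mulr_ge0 ?ltW.
    have /andP[h1 h2] := Num.Theory.truncn_itv tp.
    rewrite subr_ge0 lerBlDl ler_pdivrMr // h1 /=.
    have -> : (N n)%:R / p n + (p n)^-1 = ((N n)%:R + 1) / p n.
      by rewrite mulrDl mul1r.
    by rewrite ler_pdivlMr // natr1 ltW.
  have step n k : (k%:R / p n <= t) ->
    hn (w n - Cz (k%:R / p n) (w n) - (k%:R / p n)%:C *: z) <=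
    (k%:R / p n) * (hn (A n (w n) - z) + e).
    elim: k => [|k IH] kt.
      by rewrite !mul0r (Cz0 C) subrr scale0r subr0 hn0.
    have kt' : k%:R / p n <= t.
      by apply: le_trans kt; rewrite ler_pM2r ?invr_gt0 // ler_nat.
    have k0 : 0 <= k%:R / p n by rewrite divr_ge0 ?ler0n // ltW.
    have E : k.+1%:R / p n = k%:R / p n + (p n)^-1.
      by rewrite -natr1 mulrDl mul1r.
    have -> : w n - Cz (k.+1%:R / p n) (w n) - (k.+1%:R / p n)%:C *: z =
      (w n - Cz (k%:R / p n) (w n) - (k%:R / p n)%:C *: z) +
      ((p n)^-1)%:C *: (Cz (k%:R / p n) (A n (w n)) - z).
      have F : ((p n)^-1)%:C *: Cz (k%:R / p n) (A n (w n)) =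
          Cz (k%:R / p n) (w n) - Cz (k.+1%:R / p n) (w n).
        rewrite /A (linZ (Cz_lin hC _)) realZ mulVf ?gt_eqF // scale1r.
        by rewrite E (Cz_add hC) // (linB (Cz_lin hC _)).
      rewrite [X in _ = _ + X]scalerBr F E rmorphD scalerDl opprD -E.
      rewrite [RHS]addrACA; congr (_ + _).
      by rewrite addrA subrK.
    apply: le_trans (hnD _ _) _; rewrite E mulrDl lerD ?IH //.
    rewrite hnZp // ler_wpM2l //.
    apply: le_trans (hn_triangle (Cz (k%:R / p n) z) _ _) _.
    apply: lerD; last by apply: he; rewrite k0.
    by rewrite -(linB (Cz_lin hC _)) Cz_le.
  have cp : (p n)^-1 @[n --> \oo] --> (0 : R).
    have -> : (fun n => (p n)^-1) = (fun n => (2^-1 : R) ^+ n).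
      by apply/funext => n; rewrite exprVn.
    by apply: cvg_expr; rewrite gtr0_norm ?invf_lt1 ?invr_gt0 // ltr1n.
  have cN : (N n)%:R / p n @[n --> \oo] --> t.
    have : t - (p n)^-1 @[n --> \oo] --> t.
      by rewrite -{2}(subr0 t); apply: cvgB => //; exact: cvg_cst.
    move=> h; apply: (squeeze_cvgr _ h (cvg_cst t)); near=> n.
    by have := Nt n; lra.
  have cC : Cz ((N n)%:R / p n) (w n) @[n --> \oo] --> Cz t l.
    have : forall e : R, 0 < e -> \forall n \near \oo,
       hn (Cz ((N n)%:R / p n) (w n) - Cz t l) < e.
      move=> r r0; have r2 : 0 < r / 2 by rewrite divr_gt0.
      have [d d0 hd] := Cz_cont0 hC l r2.
      have /cvg_hnP /cvgrPdist_lt /(_ _ r2) wr := wl.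
      have /cvgrPdist_lt /(_ _ d0) pr := cp.
      near=> n.
      have h1 : hn (w n - l) < r / 2.
        by rewrite -[ltLHS]ger0_norm ?hn_ge0 // -normrN -sub0r; near: n.
      have h2 : (p n)^-1 < d.
        by rewrite -[ltLHS]ger0_norm // -normrN -sub0r; near: n.
      have /andP[Nt1 Nt2] := Nt n.
      have N0 : 0 <= (N n)%:R / p n by rewrite divr_ge0 ?ler0n // ltW.
      apply: le_lt_trans (hn_triangle (Cz ((N n)%:R / p n) l) _ _) _.
      rewrite [r]splitr ltr_leD //.
        by apply: le_lt_trans h1; rewrite -(linB (Cz_lin hC _)) Cz_le.
      rewrite hn_distC; apply: le_trans (Cz_unif hC _ N0 _) _; first by lra.
      by apply/ltW/hd; rewrite Nt1 /=; lra.
    move=> h; apply/cvg_hnP/cvgrPdist_lt => r r0; have := h _ r0.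
    by apply: filterS => n; rewrite sub0r normrN ger0_norm ?hn_ge0.
  have c1 : w n - Cz ((N n)%:R / p n) (w n) - ((N n)%:R / p n)%:C *: z
      @[n --> \oo] --> l - Cz t l - t%:C *: z.
    apply: cvgB; first exact: cvgB.
    apply: (@cvg_hn_le _ _ _ _ _ _ _ (fun n => `|(N n)%:R / p n - t| * hn z)).
      by near=> n; rewrite -scalerBl -rmorphB hnZr.
    rewrite -(mul0r (hn z)); apply: cvgMl.
    rewrite -(@normr0 _ R) -(subrr t); apply: cvg_norm; apply: cvgB => //.
    exact: cvg_cst.
  have c2 : (N n)%:R / p n * (hn (A n (w n) - z) + e) @[n --> \oo] --> t * e.
    rewrite -{2}(add0r e); apply: cvgM => //; apply: cvgD; last exact: cvg_cst.
    exact/cvg_hnP.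
  by apply: (hcvg_le c1 c2) => n; apply: step; have := Nt n; lra.
apply/generatorP => e e0.
have [d d0 hd] := Cz_cont0 hC z e0.
exists d => // t /andP[t0 td]; apply: key => //; first exact: ltW.
by move=> s /andP[s0 st]; apply/ltW/hd; rewrite s0 (le_lt_trans st).
Unshelve. all: by end_near. Qed.

End ResolventExistence.

(** * Functions of the generator through its resolvent *)

Section SymmetricOperators.
Context {R : realType} {H : hilbertType R}.
Implicit Types (X : H -> H) (u v w : H).

Lemma symop_hdot X : linear X -> symop X -> forall u v, hdot (X u) v = hdot u (X v).
Proof. by move=> lX sX u v; rewrite !hdotE -(linZ lX) !sX. Qed.

Lemma symop_rdoti X u : linear X -> symop X -> rdot (X u) ('i%C *: u) = 0.
Proof.
move=> lX sX; have h := rdotiC (X u) u.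
have : rdot ('i%C *: X u) u = rdot (X u) ('i%C *: u).
  by rewrite -(linZ lX) sX rdotC.
by move: h; lra.
Qed.

Lemma posop_hdot X u : linear X -> symop X -> posop X -> 0 <= hdot (X u) u.
Proof. by move=> lX sX pX; rewrite hdotE symop_rdoti // lecE /= eqxx pX. Qed.

End SymmetricOperators.

(** [J] is the resolvent [(1 + A)^-1]; with [rJ] and [rK] the square roots of
    [J] and [1 - J = A J], all functions of [A] that occur become combinations
    of everywhere defined operators. The conditions [sc_rJ_half] and
    [sc_rK_half] say that these roots lie between [0] and [2]; in this form
    [bounded_sqrt] applies to them again. *)
Record sqrt_calculus (R : realType) (H : hilbertType R) (A : @operator R H)
    (J rJ rK : H -> H) : Prop := {
  sc_J_lin : linear J ;
  sc_J_sym : symop J ;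
  sc_J_inj : forall u, J u = 0 -> u = 0 ;
  sc_K_inj : forall u, u - J u = 0 -> u = 0 ;
  sc_graph : forall u v, A u v <-> exists w, u = J w /\ v = w - J w ;
  sc_rJ_lin : linear rJ ;
  sc_rJ_sym : symop rJ ;
  sc_rJ_half : forall u, hn (u - rJ u) <= hn u ;
  sc_rJ2 : forall u, rJ (rJ u) = J u ;
  sc_rK_lin : linear rK ;
  sc_rK_sym : symop rK ;
  sc_rK_half : forall u, hn (u - rK u) <= hn u ;
  sc_rK2 : forall u, rK (rK u) = u - J u ;
  sc_comm : forall (Z : H -> H) (b : R), linear Z ->
    (forall u, hn (Z u) <= b * hn u) -> (forall u, Z (J u) = J (Z u)) ->
    forall u, Z (rJ u) = rJ (Z u) /\ Z (rK u) = rK (Z u) }.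

Section GeneratorCalculus.
Context {R : realType} {H : hilbertType R}.
Variables (C : R -> H -> H) (hC : hermitian_contraction_semigroup C).
Implicit Types (u v w z : H) (s t : R).

Lemma resolvent_unique g v g' v' : generator C g v -> generator C g' v' ->
  v + g = v' + g' -> g = g'.
Proof.
move=> h h' e.
have hd : generator C (g' - g) (v' - v).
  by rewrite (addrC g') (addrC v') -(scaleN1r g) -(scaleN1r v); apply: generator_lin.
have {}e : v' - v = - (g' - g).
  by apply/eqP; rewrite -addr_eq0 addrACA -opprD -e subrr.
apply/eqP; rewrite eq_sym -subr_eq0; apply/eqP/hn_eq0/eqP.
have := generator_ge0 hC hd; rewrite e rdotNl rdotE => h0.
by rewrite -sqrf_eq0 eq_le sqr_ge0 andbT; lra.
Qed.

(** As [A >= 0], both [J] and [1 - J] are contractions, so that [bounded_sqrt]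
    provides their square roots. Strong continuity makes [J] injective, and
    injectivity of [A] makes [1 - J] injective. *)
Lemma generator_calculus : (forall u, generator C u 0 -> u = 0) ->
  exists J rJ rK, sqrt_calculus (generator C) J rJ rK.
Proof.
move=> kerA; have [J hJ] := choice (resolvent_ex hC).
have JU g v w : generator C g v -> v + g = w -> g = J w.
  by move=> h e; apply: (resolvent_unique h (hJ w)); rewrite subrK.
have lJ : linear J.
  move=> a u v; apply/esym; apply: (JU _ _ _ (generator_lin hC (a := a) (hJ u) (hJ v))).
  by rewrite addrACA -scalerDr !subrK.
have sJ : symop J.
  move=> u v; have := generator_sym hC (hJ u) (hJ v).
  by rewrite rdotBl rdotBr; lra.
have J1 u : hn (J u) ^+ 2 <= rdot (J u) u.
  have := generator_ge0 hC (hJ u); rewrite rdotBl rdotE (rdotC u); lra.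
have Jle u : hn (J u) <= hn u.
  have := le_trans (J1 u) (rdot_le _ _); rewrite expr2.
  have := hn_ge0 (J u); rewrite le_eqVlt => /predU1P[<- _|h]; first exact: hn_ge0.
  by rewrite ler_pM2l.
have Kle u : hn (u - J u) <= hn u.
  rewrite -(@ler_pXn2r _ 2) ?nnegrE ?hn_ge0 // sqr_hnB rdotC.
  by have := J1 u; have := sqr_ge0 (hn (J u)); lra.
pose K u := u - J u.
have lK : linear K by move=> a u v; rewrite /K lJ scalerBr opprD addrACA.
have sK : symop K by move=> u v; rewrite rdotBl rdotBr sJ.
have [rJ [lrJ srJ hrJ rJ2 cJ]] := bounded_sqrt lK sK Kle.
have [rK [lrK srK hrK rK2 cK]] := bounded_sqrt lJ sJ Jle.
exists J, rJ, rK; split=> //.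
- move=> u Ju; have := hJ u; rewrite Ju subr0 => /generator_cvg h.
  apply: (hcvg_unique h); under eq_fun do rewrite (lin0 (Cz_lin hC _)) subrr scaler0.
  exact: cvg_cst.
- by move=> u Ku; have := hJ u; rewrite Ku => /kerA h; rewrite h subr0 in Ku.
- move=> u v; split=> [h|[w [-> ->]]]; last exact: hJ.
  by exists (v + u); rewrite -(JU _ _ _ h erefl) addrK.
- by move=> u; rewrite rJ2 opprB addrC subrK.
- move=> Z b lZ Zb ZJ u; split; last exact: (cK Z b).
  by apply: (cJ Z b) => // v; rewrite /K (linB lZ) ZJ.
Qed.

End GeneratorCalculus.

Section Calculus.
Context {R : realType} {H : hilbertType R}.
Variables (A : @operator R H) (J rJ rK : H -> H).
Hypothesis hA : sqrt_calculus A J rJ rK.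
Implicit Types (u v w z : H) (x : R).

(** This is [A J]. *)
Definition cK u := u - J u.
(** This is [A^(1/2) J], since [rK = A^(1/2) rJ]. *)
Definition sqA u := rJ (rK u).

Let lJ : linear J := sc_J_lin hA.
Let lrJ : linear rJ := sc_rJ_lin hA.
Let lrK : linear rK := sc_rK_lin hA.

Lemma cK_lin : linear cK.
Proof. by move=> a u v; rewrite /cK lJ scalerBr opprD addrACA. Qed.

Lemma cK_sym : symop cK.
Proof. by move=> u v; rewrite rdotBl rdotBr (sc_J_sym hA). Qed.

Lemma cJ_K u : J u + cK u = u. Proof. by rewrite addrC subrK. Qed.

Lemma J_cK u : J (cK u) = cK (J u).
Proof. by rewrite /cK (linB lJ). Qed.

Lemma rJK_sqr u : hn (rJ u) ^+ 2 + hn (rK u) ^+ 2 = hn u ^+ 2.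
Proof.
rewrite -!rdotE (sc_rJ_sym hA) (sc_rK_sym hA) (sc_rJ2 hA) (sc_rK2 hA).
by rewrite -rdotDr addrC subrK.
Qed.

Lemma rJ_le u : hn (rJ u) <= hn u.
Proof.
rewrite -(@ler_pXn2r _ 2) ?nnegrE ?hn_ge0 // -(rJK_sqr u).
by rewrite lerDl sqr_ge0.
Qed.

Lemma rK_le u : hn (rK u) <= hn u.
Proof.
rewrite -(@ler_pXn2r _ 2) ?nnegrE ?hn_ge0 // -(rJK_sqr u).
by rewrite lerDr sqr_ge0.
Qed.

Lemma J_le u : hn (J u) <= hn u.
Proof. by rewrite -(sc_rJ2 hA); apply: le_trans (rJ_le _) (rJ_le _). Qed.

Lemma cK_le u : hn (cK u) <= hn u.
Proof. by rewrite /cK -(sc_rK2 hA); apply: le_trans (rK_le _) (rK_le _). Qed.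

Lemma sqA_le u : hn (sqA u) <= hn u.
Proof. by apply: le_trans (rJ_le _) (rK_le _). Qed.

Lemma rJ_K u : rJ (rK u) = rK (rJ u).
Proof.
have [] // := @sc_comm _ _ _ _ _ _ hA rJ 1 lrJ _ _ u => v.
  by rewrite mul1r rJ_le.
by rewrite -!(sc_rJ2 hA).
Qed.

Lemma J_rJ u : J (rJ u) = rJ (J u). Proof. by rewrite -!(sc_rJ2 hA). Qed.
Lemma cK_rJ u : cK (rJ u) = rJ (cK u). Proof. by rewrite /cK J_rJ (linB lrJ). Qed.
Lemma cK_rK u : cK (rK u) = rK (cK u). Proof. by rewrite /cK -!(sc_rK2 hA). Qed.
Lemma J_rK u : J (rK u) = rK (J u).
Proof. by rewrite -!(sc_rJ2 hA) -!rJ_K. Qed.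

Lemma sqA_lin : linear sqA.
Proof. by move=> a u v; rewrite /sqA lrK lrJ. Qed.

Lemma sqA_sym : symop sqA.
Proof.
by move=> u v; rewrite /sqA (sc_rJ_sym hA) (sc_rK_sym hA) -rJ_K.
Qed.

Lemma sqA2 u : sqA (sqA u) = cK (J u).
Proof. by rewrite /sqA -(rJ_K (rK u)) (sc_rJ2 hA) (sc_rK2 hA) -J_cK. Qed.

(** A product of commuting positive operators is positive, as one factor has a
    square root commuting with the other. *)
Lemma sqA_pos : posop sqA.
Proof.
have lX : linear (fun u => u - rJ u).
  by move=> a u v; rewrite lrJ scalerBr opprD addrACA.
have sX : symop (fun u => u - rJ u).
  by move=> u v; rewrite rdotBl rdotBr (sc_rJ_sym hA).
have [s [ls ss _ s2 sc]] := bounded_sqrt lX sX (sc_rJ_half hA).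
have {}s2 u : s (s u) = rJ u by rewrite s2 opprB addrC subrK.
have srK u : rK (s u) = s (rK u).
  apply: (sc rK 1) => // v; first by rewrite mul1r rK_le.
  by rewrite (linB lrK) rJ_K.
move=> u; rewrite /sqA -s2 ss -srK.
exact: (half_posop (sc_rK_half hA)).
Qed.

Lemma rJ_inj u : rJ u = 0 -> u = 0.
Proof.
by move=> h; apply: (sc_J_inj hA); rewrite -(sc_rJ2 hA) h (lin0 lrJ).
Qed.

Lemma J_dense : dense_range J.
Proof.
apply: pos_inj_dense_range => //; first exact: sc_J_sym hA.
- by move=> u; rewrite -(sc_rJ2 hA) (sc_rJ_sym hA) rdotE sqr_ge0.
- move=> u; rewrite -[in leRHS](sc_rJ2 hA) (sc_rJ_sym hA) rdotE.
  by rewrite ler_sqr ?nnegrE ?hn_ge0 // -(sc_rJ2 hA) rJ_le.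
- exact: sc_J_inj hA.
Qed.

Lemma cK_dense : dense_range cK.
Proof.
apply: pos_inj_dense_range; [exact: cK_lin|exact: cK_sym| | |].
- by move=> u; rewrite /cK -(sc_rK2 hA) (sc_rK_sym hA) rdotE sqr_ge0.
- move=> u; rewrite /cK -(sc_rK2 hA) (sc_rK_sym hA (rK u) u) rdotE.
  by rewrite ler_sqr ?nnegrE ?hn_ge0 // rK_le.
- exact: sc_K_inj hA.
Qed.

Lemma sqA_dense : dense_range sqA.
Proof.
apply: (@dense_range_sub _ _ _ _ _ (fun u => cK (J u)) sqA).
  by move=> u; rewrite sqA2.
apply: (@dense_range_comp _ _ _ _ 1); [exact: cK_lin| |exact: cK_dense|exact: J_dense].
by move=> u; rewrite mul1r cK_le.
Qed.

(** The operator [A^(1/2)]: its domain is the range of [rJ], and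
    [A^(1/2) rJ = rK]. *)
Definition sqrt_graph : operator := fun u v => exists w, u = rJ w /\ v = rK w.

(** The hypothesis means [rK u = rJ v]; then [w = rJ u + rK v] satisfies
    [rJ w = u] and [rK w = v] because [rJ^2 + rK^2 = 1]. *)
Lemma sqrt_graph_closed u v :
  (forall w, rdot (rK w) u = rdot (rJ w) v) -> sqrt_graph u v.
Proof.
move=> h.
have {}h : rK u = rJ v.
  apply: rdot_inj => w; rewrite (sc_rK_sym hA) (sc_rJ_sym hA).
  by rewrite rdotC h rdotC.
exists (rJ u + rK v); rewrite (linD lrJ) (linD lrK); split.
  by rewrite (sc_rJ2 hA) rJ_K -h (sc_rK2 hA) cJ_K.
by rewrite -rJ_K h (sc_rJ2 hA) (sc_rK2 hA) cJ_K.
Qed.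

Lemma sqrt_graph_sqrt : is_op_sqrt A sqrt_graph.
Proof.
split.
- split.
    rewrite -subTset => u _.
    move=> V /nbhs_ballP[[e e'] /=].
    rewrite ltcE /= => /andP[/eqP -> e0] eV.
    have d : dense_range rJ.
      apply: (@dense_range_sub _ _ _ _ rJ J rJ); last exact: J_dense.
      by move=> k; rewrite (sc_rJ2 hA).
    have [w hw] := d u _ e0; exists (rJ w); split; first by exists (rK w), w.
    by apply: eV; rewrite -ball_normE /= hnE ltcR.
  move=> u v; split.
    move=> [w [-> ->]] _ _ [w' [-> ->]].
    rewrite (symop_hdot lrK (sc_rK_sym hA)) (symop_hdot lrJ (sc_rJ_sym hA)).
    by rewrite rJ_K.
  move=> h; apply: sqrt_graph_closed => w.
  by rewrite /rdot (h (rJ w)) //; exists w.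
- move=> _ _ [w [-> ->]]; rewrite (symop_hdot lrK (sc_rK_sym hA)) -rJ_K.
  rewrite -/(sqA w) -(symop_hdot sqA_lin sqA_sym).
  by apply: posop_hdot; [exact: sqA_lin|exact: sqA_sym|exact: sqA_pos].
- move=> u v; rewrite (sc_graph hA); split.
    move=> [_ [w [-> ->]] [w' [e ->]]].
    exists (rJ w + rK w').
    have e1 : J (rJ w + rK w') = rJ w.
      rewrite -(sc_rJ2 hA); congr rJ; rewrite (linD lrJ) (sc_rJ2 hA) rJ_K -e.
      by rewrite (sc_rK2 hA) cJ_K.
    split; first by rewrite e1.
    by rewrite e1 addrC addKr.
  move=> [z [-> ->]]; exists (rK (rJ z)).
    by exists (rJ z); rewrite (sc_rJ2 hA).
  by exists (rK z); rewrite rJ_K (sc_rK2 hA).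
Qed.

Lemma resolvent_eq u v w : A u v -> u + v = w -> u = J w.
Proof. by move=> /(sc_graph hA)[z [-> ->]]; rewrite cJ_K => ->. Qed.

(** For a nonnegative square root [B] of [A], the bounded operator [B J] is a
    positive square root of [A J^2], hence is [sqA]; this determines [B] on the
    domain of [A], and then everywhere by self-adjointness. *)
Lemma sqrt_unique B u v : is_op_sqrt A B -> B u v -> sqrt_graph u v.
Proof.
move=> [[_ sB] pB BB] Buv.
have symB a b c d : B a b -> B c d -> hdot b c = hdot a d.
  by move=> h1 /sB; exact.
have linrelB (k : R[i]) a b c d : B a b -> B c d -> B (k *: a + c) (k *: b + d).
  move=> h1 h2; apply/sB => p q hpq.
  rewrite (hdotC q) (hdotC p) !linearDl !linearZl_LR /=.
  by rewrite (symB _ _ _ _ h1 hpq) (symB _ _ _ _ h2 hpq).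
have subB a b c d : B a b -> B c d -> B (a - c) (b - d).
  by move=> h1 h2; rewrite (addrC a) (addrC b) -(scaleN1r c) -(scaleN1r d); apply: linrelB.
have uniqB a c m m' : B a m -> B m c -> B a m' -> B m' c -> m = m'.
  move=> h1 h2 h3 h4; have h5 := subB _ _ _ _ h1 h3; have h6 := subB _ _ _ _ h2 h4.
  rewrite subrr in h5; rewrite subrr in h6.
  apply/eqP; rewrite -subr_eq0; apply/eqP/hn_eq0/eqP; rewrite -sqrf_eq0 -rdotE.
  by rewrite /rdot (symB _ _ _ _ h5 h6) -/(rdot 0 0) rdot0l.
have exS w : exists m, B (J w) m /\ B m (cK w).
  have [m h1 h2] : op_comp B B (J w) (cK w) by apply/BB/(sc_graph hA); exists w.
  by exists m.
have [S hS] := choice exS.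
have S1 w : B (J w) (S w) by case: (hS w).
have S2 w : B (S w) (cK w) by case: (hS w).
have lS : linear S.
  move=> a w z; apply: (uniqB _ _ _ _ (S1 _) (S2 _)).
    by rewrite lJ; apply: linrelB.
  by rewrite cK_lin; apply: linrelB.
have rsymB a b c d : B a b -> B c d -> rdot b c = rdot a d.
  by move=> h1 h2; rewrite /rdot (symB _ _ _ _ h1 h2).
have sS : symop S.
  move=> w z; rewrite -{1}(cJ_K z) rdotDr (rsymB _ _ _ _ (S1 w) (S1 z)).
  rewrite (rdotC (S w)) (rsymB _ _ _ _ (S2 z) (S2 w)) (rdotC (S z)) -rdotDl.
  by rewrite cJ_K.
have pS : posop S.
  have pBr a b : B a b -> 0 <= rdot b a.
    by move=> /pB; rewrite lecE /= => /andP[].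
  move=> w; rewrite -{2}(cJ_K w) rdotDr addr_ge0 //; first exact: pBr (S1 w).
  by rewrite rdotC; exact: pBr (S2 w).
have SJ w : S (J w) = J (S w).
  apply: resolvent_eq (S w - S (J w)) _ _ _; last by rewrite addrC subrK.
  apply/BB; exists (cK (J w)); first exact: S2.
  by have := subB _ _ _ _ (S1 w) (S1 (J w)).
have SS w : S (S w) = cK (J w).
  apply: (uniqB _ _ _ _ (S1 _) (S2 _)).
    by rewrite -SJ; exact: S2.
  have := subB _ _ _ _ (S1 w) (S1 (J w)); rewrite SJ; exact.
have Sle w : hn (S w) <= 1 * hn w.
  rewrite mul1r -(@ler_pXn2r _ 2) ?nnegrE ?hn_ge0 // -rdotE sS SS.
  rewrite -sqA2 -sqA_sym rdotE ler_sqr ?nnegrE ?hn_ge0 //; exact: sqA_le.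
have SP : S =1 sqA.
  apply: pos_sqrt_unique => //; [exact: sqA_lin|exact: sqA_sym|exact: sqA_pos| |].
    move=> w; rewrite /sqA; have [-> _] := sc_comm hA lS Sle SJ (rK w).
    by have [_ ->] := sc_comm hA lS Sle SJ w.
  by move=> w; rewrite SS sqA2.
have rKu w : rdot (sqA w) u = rdot (J w) v.
  by rewrite -SP (rsymB _ _ _ _ (S1 w) Buv).
have e : rK u = rJ v.
  apply/eqP; rewrite -subr_eq0; apply/eqP/rJ_inj/rdot_inj => w.
  rewrite rdot0l (linB lrJ) rdotBl (sc_rJ2 hA) -/(sqA u) sqA_sym (sc_J_sym hA).
  by rewrite rdotC rKu (rdotC v) subrr.
apply: sqrt_graph_closed => w.
by rewrite (sc_rK_sym hA) e -(sc_rJ_sym hA).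
Qed.

Lemma op_sqrtE u v : op_sqrt A u v <-> sqrt_graph u v.
Proof.
split=> [[B /sqrt_unique h /h]|h] //.
by exists sqrt_graph => //; exact: sqrt_graph_sqrt.
Qed.

End Calculus.

(** * Resolvents on the imaginary axis *)

Section ImaginaryResolvent.
Context {R : realType} {H : hilbertType R}.
Variables (A : @operator R H) (J rJ rK : H -> H).
Hypothesis hA : sqrt_calculus A J rJ rK.
Implicit Types (u v w z : H) (x : R).
Local Notation K := (cK J).
Local Notation P := (sqA rJ rK).

Let lJ : linear J := sc_J_lin hA.
Let lK : linear K := cK_lin hA.

(** [nres x] is [(A + i x) J], so that [(A + i x)^-1 = J (nres x)^-1]. *)
Definition nres x u := K u + (0 +i* x) *: J u.

Lemma nresE x u : nres x u = K u + x%:C *: ('i%C *: J u).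
Proof.
rewrite /nres scalerA; congr (_ + _ *: _).
by apply/eqP; rewrite eq_complex /= !(mul0r, mulr0, mulr1, subr0, addr0) !eqxx.
Qed.

Lemma nres_lin x : linear (nres x).
Proof.
move=> a u v; rewrite /nres lK lJ !scalerDr !scalerA mulrC addrACA.
by rewrite -!scalerA -scalerDr.
Qed.

Lemma nres_comm x (Z : H -> H) : linear Z -> (forall u, Z (J u) = J (Z u)) ->
  forall u, Z (nres x u) = nres x (Z u).
Proof.
by move=> lZ ZJ u; rewrite /nres (linD lZ) (linZ lZ) /cK (linB lZ) ZJ.
Qed.

Lemma nres_adj x u v : rdot (nres x u) v = rdot u (nres (- x) v).
Proof.
rewrite !nresE rdotDl rdotDr (cK_sym hA) rdotZl rdotZr rdotiC (sc_J_sym hA).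
by rewrite (linZ lJ) mulrN mulNr.
Qed.

Lemma nres_le x u : hn (nres x u) <= (1 + `|x|) * hn u.
Proof.
rewrite nresE; apply: le_trans (hnD _ _) _; rewrite mulrDl mul1r hnZr hni.
by apply: lerD; [exact: (cK_le hA)|apply: ler_wpM2l => //; exact: (J_le hA)].
Qed.

Definition nlow x : R := Num.min 1 `|x|.

Lemma nlow_gt0 x : x != 0 -> 0 < nlow x.
Proof. by move=> x0; rewrite lt_min ltr01 normr_gt0. Qed.

Let rot x : R[i] := 1 - (Num.sg x)%:C * 'i%C.

(** Multiplication by [1 - i sgn x] rotates [nres x = K + i x J] into an
    operator with real part [K + |x| J], and [K + J = 1]. *)
Lemma nres_coercive x u : x != 0 ->
  nlow x * hn u ^+ 2 <= rdot (rot x *: nres x u) u.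
Proof.
move=> x0; rewrite /rot scalerBl scale1r -scalerA rdotBl rdotZl.
rewrite nresE scalerDr (scalerA _ x%:C) (mulrC _ x%:C) -(scalerA x%:C).
rewrite (scalerA 'i%C 'i%C) -expr2 sqr_i scaleN1r !rdotDl !rdotZl !rdotiC rdotNl.
rewrite (symop_rdoti u lJ (sc_J_sym hA)) (symop_rdoti u lK (cK_sym hA)).
have -> : Num.sg x * (- 0 + x * - rdot (J u) u) = - (`|x| * rdot (J u) u).
  by rewrite normrEsg; ring.
have -> : hn u ^+ 2 = rdot (J u) u + rdot (K u) u by rewrite -rdotDl cJ_K rdotE.
have h1 : 0 <= rdot (J u) u.
  by rewrite -(sc_rJ2 hA) (sc_rJ_sym hA) rdotE sqr_ge0.
have h2 : 0 <= rdot (K u) u.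
  by rewrite /cK -(sc_rK2 hA) (sc_rK_sym hA) rdotE sqr_ge0.
have h3 : nlow x * rdot (J u) u <= `|x| * rdot (J u) u.
  by apply: ler_wpM2r => //; rewrite ge_min lexx orbT.
have h4 : nlow x * rdot (K u) u <= 1 * rdot (K u) u.
  by apply: ler_wpM2r => //; rewrite ge_min lexx.
by move: h3 h4; rewrite (rdotBl u (J u) u : rdot (K u) u = _); lra.
Qed.

Lemma nres_surj x v : x != 0 -> exists u, nres x u = v.
Proof.
move=> x0; apply: (lax_milgram (nres_lin x) _ (nres_le x) (nlow_gt0 x0)).
  2: by move=> u; exact: nres_coercive.
by rewrite eq_complex /= !mulr0 !mul0r !subr0 oner_eq0.
Qed.

Lemma nres_lower x u : x != 0 -> nlow x * hn u <= 2 * hn (nres x u).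
Proof.
move=> x0; have := nres_coercive u x0.
have h : hn (rot x *: nres x u) <= 2 * hn (nres x u).
  rewrite /rot scalerBl scale1r -scalerA; apply: le_trans (hnB _ _) _.
  by rewrite hnZr hni normr_sg x0 mul1r; lra.
have [->|u0] := eqVneq (hn u) 0.
  by rewrite mulr0 mulr_ge0 ?hn_ge0.
have {}u0 : 0 < hn u by rewrite lt0r u0 hn_ge0.
move=> /le_trans /(_ (rdot_le _ _)); rewrite expr2 mulrA ler_pM2r //.
by move=> /le_trans; exact.
Qed.

Definition ninv x v : H := xget 0 [set u | nres x u = v].

Lemma ninvK x v : x != 0 -> nres x (ninv x v) = v.
Proof. by move=> /(nres_surj v) [u hu]; apply: (xgetPex 0 (P := [set u | nres x u = v])); exists u. Qed.

Lemma nres_inj x u v : x != 0 -> nres x u = nres x v -> u = v.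
Proof.
move=> x0 e; apply/eqP; rewrite -subr_eq0; apply/eqP/hn_eq0/eqP.
have := nres_lower (u - v) x0; rewrite (linB (nres_lin x)) e subrr hn0 mulr0.
by rewrite pmulr_rle0 ?nlow_gt0 // => h; rewrite eq_le h hn_ge0.
Qed.

Lemma nresK x u : x != 0 -> ninv x (nres x u) = u.
Proof. by move=> x0; apply: (nres_inj x0); rewrite ninvK. Qed.

Lemma ninv_lin x : x != 0 -> linear (ninv x).
Proof.
by move=> x0 a u v; apply: (nres_inj x0); rewrite nres_lin !ninvK.
Qed.

Lemma ninv_le x v : x != 0 -> hn (ninv x v) <= 2 / nlow x * hn v.
Proof.
move=> x0; have := nres_lower (ninv x v) x0; rewrite ninvK // mulrC => h.
by rewrite mulrAC ler_pdivlMr ?nlow_gt0.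
Qed.

Lemma ninv_comm x (Z : H -> H) : x != 0 -> linear Z ->
  (forall u, Z (J u) = J (Z u)) -> forall u, Z (ninv x u) = ninv x (Z u).
Proof.
move=> x0 lZ ZJ u; apply: (nres_inj x0).
by rewrite -nres_comm // !ninvK.
Qed.

(** The difference [w' - w] of the values at [(x', v')] and [(x, v)] solves
    [nres x (w' - w) = v' - v - i (x' - x) J w'], where [w'] stays bounded. *)
Lemma ninv_cvg (xs : nat -> R) (vs : nat -> H) x v : x != 0 ->
  xs @ \oo --> x -> vs @ \oo --> v -> ninv (xs n) (vs n) @[n --> \oo] --> ninv x v.
Proof.
move=> x0 xx vv; set w := ninv x v.
pose b n := 2 / nlow x * (hn (vs n - v) + `|xs n - x| * (2 / nlow x * 2 * hn (vs n))).
have nx : `|xs n| @[n --> \oo] --> `|x| by exact: cvg_norm.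
apply: (@cvg_hn_le _ _ _ _ _ _ _ b); last first.
  rewrite -(mulr0 (2 / nlow x)); apply: cvgMr.
  rewrite -(addr0 (0 : R)); apply: cvgD; first exact/cvg_hnP.
  rewrite -(mul0r (2 / nlow x * 2 * hn v)); apply: cvgM.
    rewrite -(normr0 R) -(subrr x); apply: cvg_norm.
    by apply: cvgB => //; exact: cvg_cst.
  by apply: cvgMr; exact: cvg_hn.
have n0 : 0 < nlow x := nlow_gt0 x0.
have ax0 : 0 < `|x| by rewrite normr_gt0.
have l2 : `|x| / 2 < `|x| by lra.
near=> n.
have h0 : `|x| / 2 < `|xs n| by near: n; exact: (cvgr_gt `|x| nx).
have xn0 : xs n != 0 by rewrite -normr_gt0; lra.
have h1 : nlow x / 2 <= nlow (xs n).
  have : nlow x <= 1 by rewrite ge_min lexx.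
  have : nlow x <= `|x| by rewrite ge_min lexx orbT.
  by rewrite le_min => *; apply/andP; split; lra.
have e : nres x (ninv (xs n) (vs n) - w) =
    (vs n - v) - (xs n - x)%:C *: ('i%C *: J (ninv (xs n) (vs n))).
  have ev : nres (xs n) (ninv (xs n) (vs n)) = vs n by rewrite ninvK.
  rewrite -[X in _ = X - v - _]ev (linB (nres_lin x)) (ninvK v x0) !nresE.
  rewrite rmorphB scalerBl opprB [RHS]addrAC; congr (_ - v).
  move: (K _) => k; rewrite -addrA; congr (_ + _).
  by rewrite addrC subrK.
have := nres_lower (ninv (xs n) (vs n) - w) x0.
rewrite e => h.
have h2 : hn (ninv (xs n) (vs n) - w) <= 2 / nlow x *
   hn (vs n - v - (xs n - x)%:C *: ('i%C *: J (ninv (xs n) (vs n)))).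
  by rewrite mulrAC ler_pdivlMr // mulrC.
apply: le_trans h2 _; rewrite /b ler_wpM2l ?divr_ge0 ?(ltW n0) //.
apply: le_trans (hnB _ _) _; rewrite lerD2l hnZr hni ler_wpM2l //.
apply: le_trans (J_le hA _) _; apply: le_trans (ninv_le _ xn0) _.
rewrite ler_wpM2r ?hn_ge0 // ler_pdivrMr ?nlow_gt0 //.
have -> : 2 / nlow x * 2 * nlow (xs n) = 2 * (nlow (xs n) / (nlow x / 2)).
  by field; rewrite gt_eqF.
by rewrite ler_peMr // ler_pdivlMr ?divr_gt0 // mul1r.
Unshelve. all: by end_near. Qed.

Lemma A_shift_inv x u v w : x != 0 ->
  op_inv (op_shift A (0 +i* x)) v u <-> u = J (ninv x v).
Proof.
move=> x0; split.
  move=> [a /(sc_graph hA)[b [-> ->]] ->].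
  by rewrite -[_ + _]/(nres x b) nresK.
move=> ->; exists (K (ninv x v)); first by apply/(sc_graph hA); exists (ninv x v).
by rewrite -[RHS]/(nres x _) ninvK.
Qed.

Lemma T_val x v : x != 0 ->
  op_val (op_comp (op_sqrt A) (op_inv (op_shift A (0 +i* x)))) v = P (ninv x v).
Proof.
move=> x0; rewrite /op_val.
have h z : op_comp (op_sqrt A) (op_inv (op_shift A (0 +i* x))) v z <->
    z = P (ninv x v).
  split.
    move=> [u /(A_shift_inv _ _ v x0) -> /(op_sqrtE hA)[w [e ->]]].
    rewrite /sqA (rJ_K hA); congr rK.
    apply/eqP; rewrite -subr_eq0; apply/eqP/(rJ_inj hA).
    by rewrite (linB (sc_rJ_lin hA)) -e (sc_rJ2 hA) subrr.
  move=> ->; exists (J (ninv x v)); first exact/(A_shift_inv _ _ v x0).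
  apply/(op_sqrtE hA); exists (rJ (ninv x v)).
  by rewrite (sc_rJ2 hA) /sqA (rJ_K hA).
apply/h.
by apply: (xgetPex 0 (P := [set z | op_comp _ _ v z])); exists (P (ninv x v)); apply/h.
Qed.

(** [nres x (nres (- x)) = (A^2 + x^2) J^2], and [nres (- x)] is the adjoint of
    [nres x]: half of [A = A^(1/2) A^(1/2)] and half of [(A^2 + x^2)^-1] can be
    moved to the other side of the scalar product. *)
Lemma Q_val x v : x != 0 ->
  rdot (op_val (op_comp A (op_inv (op_shift (op_comp A A) (x ^+ 2)%:C))) v) v
  = hn (P (ninv x v)) ^+ 2.
Proof.
move=> x0; have mx0 : - x != 0 by rewrite oppr_eq0.
pose w := ninv x v; pose w' := ninv (- x) w.
have AJ a : A (J a) (K a) by apply/(sc_graph hA); exists a.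
have NN a : nres x (nres (- x) a) = K (K a) + (x ^+ 2)%:C *: J (J a).
  rewrite /nres (linD lK) (linZ lK) (linD lJ) (linZ lJ) (J_cK hA).
  move: (K (K a)) (K (J a)) (J (J a)) => k1 k2 k3.
  rewrite scalerDr scalerA -!addrA; congr (_ + _); rewrite addrA -scalerDl.
  have -> : (0 +i* - x) + (0 +i* x) = 0 :> R[i].
    by apply/eqP; rewrite eq_complex /= addr0 addNr !eqxx.
  rewrite scale0r add0r; congr (_ *: _); apply/eqP; rewrite eq_complex /=.
  by rewrite !mul0r mulr0 mulrN opprK add0r addr0 expr2 !eqxx.
have h z : op_comp A (op_inv (op_shift (op_comp A A) (x ^+ 2)%:C)) v z <->
    z = K (J w').
  have ev : v = K (K w') + (x ^+ 2)%:C *: J (J w').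
    by rewrite -NN ninvK // ninvK.
  have uniq u : op_shift (op_comp A A) (x ^+ 2)%:C u v -> u = J (J w').
    move=> [b [a /(sc_graph hA)[c [-> ->]] /(sc_graph hA)[d [e ->]]] ev2].
    have ec : c = J (c + d) by rewrite (linD lJ) -e addrC subrK.
    have ed : d - J d = K (K (c + d)).
      by have -> : K (c + d) = d by rewrite /cK -ec (addrC c) addrK.
    have w'E : w' = c + d.
      rewrite /w' /w ev2 ed (congr1 J ec) -NN nresK // nresK //.
    by rewrite w'E -ec.
  split.
    move=> [u /uniq -> /(sc_graph hA)[c [e ->]]].
    have -> : c = J w'; last by rewrite /cK.
    apply/eqP; rewrite -subr_eq0; apply/eqP/(sc_J_inj hA).
    by rewrite (linB lJ) -e subrr.
  move=> ->; exists (J (J w')) => //.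
  exists (K (K w')) => //; exists (K (J w')) => //.
  by rewrite -(J_cK hA).
have -> : op_val (op_comp A (op_inv (op_shift (op_comp A A) (x ^+ 2)%:C))) v = K (J w').
  apply/h; apply: (xgetPex 0 (P := [set z | op_comp _ _ v z])).
  by exists (K (J w')); apply/h.
have PJ u : P (J u) = J (P u) by rewrite /sqA -(J_rK hA) -(J_rJ hA).
have -> : rdot (K (J w')) v = rdot (nres (- x) (K (J w'))) w.
  by rewrite nres_adj opprK ninvK.
rewrite -(sqA2 hA) -!(nres_comm _ (sqA_lin hA) PJ) /w' ninvK //.
by rewrite (sqA_sym hA) rdotE.
Qed.

End ImaginaryResolvent.

(** * Decay of the semigroup *)

Section Decay.
Context {R : realType} {H : hilbertType R}.
Variables (C : R -> H -> H) (hC : hermitian_contraction_semigroup C).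
Variables (J rJ rK : H -> H).
Hypothesis hA : sqrt_calculus (generator C) J rJ rK.
Implicit Types (u v w z : H) (s t : R).
Local Notation K := (cK J).
Local Notation P := (sqA rJ rK).
Local Notation S := (Cz C).

Lemma Cz_J t u : 0 <= t -> S t (J u) = J (S t u).
Proof.
move=> t0; have : generator C (J u) (K u) by apply/(sc_graph hA); exists u.
move=> /(generator_Cz hC t0) /(resolvent_eq hA); apply.
by rewrite -(linD (Cz_lin hC t)) cJ_K.
Qed.

Let S1 t u : hn (S t u) <= 1 * hn u. Proof. by rewrite mul1r Cz_le. Qed.

Lemma Cz_rJ t u : 0 <= t -> S t (rJ u) = rJ (S t u).
Proof.
move=> t0.
by have [] := sc_comm hA (Cz_lin hC t) (S1 t) (fun v => Cz_J v t0) u.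
Qed.

Lemma Cz_rK t u : 0 <= t -> S t (rK u) = rK (S t u).
Proof.
move=> t0.
by have [] := sc_comm hA (Cz_lin hC t) (S1 t) (fun v => Cz_J v t0) u.
Qed.

Lemma Cz_K t u : 0 <= t -> S t (K u) = K (S t u).
Proof. by move=> t0; rewrite /cK (linB (Cz_lin hC t)) Cz_J. Qed.

Lemma Cz_sqA t u : 0 <= t -> S t (P u) = P (S t u).
Proof. by move=> t0; rewrite /sqA Cz_rJ // Cz_rK. Qed.

Lemma generator_J u : generator C (J u) (K u).
Proof. by apply/(sc_graph hA); exists u. Qed.

(** [y |-> <C_y u, u>] is convex, decreasing and nonnegative, so that its slope
    at [t] is at most [|u|^2 / t]; the slope is taken along a grid. *)
Lemma Cz_slope t h u n : 0 <= h -> t = n%:R * h ->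
  n%:R * rdot (S t (u - S h u)) u <= hn u ^+ 2.
Proof.
move=> h0 th; pose b k := rdot (S (k%:R * h) u) u.
have kh k : 0 <= k%:R * h by rewrite mulr_ge0.
have bS k : rdot (S (k%:R * h) (u - S h u)) u = b k - b k.+1.
  rewrite (linB (Cz_lin hC _)) rdotBl /b -natr1 mulrDl mul1r.
  by rewrite (Cz_add hC).
have conv k : b k.+1 - b k.+2 <= b k - b k.+1.
  rewrite -!bS -subr_ge0 -rdotBl; set d := u - S h u.
  have -> : S (k.+1%:R * h) d = S h (S (k%:R * h) d).
    by rewrite -natr1 mulrDl mul1r (Cz_add hC) // (CzC hC).
  by rewrite rdotBl (Cz_sym hC h) -rdotBr; exact: Cz_pos.
have sum : n%:R * (b n - b n.+1) <= b 0%N - b n.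
  elim: n {th} => [|n IH]; first by rewrite mul0r subrr.
  have : n%:R * (b n.+1 - b n.+2) <= n%:R * (b n - b n.+1).
    by apply: ler_wpM2l => //; exact: conv.
  by have := conv n; rewrite -natr1 mulrDl mul1r; lra.
have bn : 0 <= b n by exact: Cz_pos.
have b0 : b 0%N = hn u ^+ 2 by rewrite /b mul0r (Cz0 C) rdotE.
by rewrite th bS -b0; lra.
Qed.

(** Limit [h -> 0] of [Cz_slope] for [u = rJ z], where [h^-1 (1 - C_h) rJ rJ z]
    tends to [A J z = K z]. *)
Lemma Cz_K_form t z : 0 < t -> t * rdot (S t (K z)) z <= hn z ^+ 2.
Proof.
move=> t0; apply/ler_addgt0Pr => e e0.
have z1 : 0 < hn z + 1 by rewrite ltr_wpDl ?hn_ge0.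
pose r := e / (t * (hn z + 1)).
have r0 : 0 < r by rewrite divr_gt0 // mulr_gt0.
have /generatorP /(_ _ r0) [d d0 hd] := @generator_J z.
pose n := (Num.truncn (t / d)).+1.
pose h := t / n%:R.
have n0 : 0 < n%:R :> R by rewrite ltr0n.
have h0 : 0 < h by rewrite divr_gt0.
have th : t = n%:R * h by rewrite /h mulrC divfK ?gt_eqF.
have hd' : h < d.
  rewrite /h ltr_pdivrMr // mulrC -ltr_pdivrMr //.
  by have /andP[] := Num.Theory.truncn_itv (ltW (divr_gt0 t0 d0)).
have := Cz_slope (rJ z) (ltW h0) th.
have -> : rdot (S t (rJ z - S h (rJ z))) (rJ z) = rdot (S t (J z - S h (J z))) z.
  rewrite Cz_rJ ?(ltW h0) // -(linB (sc_rJ_lin hA)) Cz_rJ ?(ltW t0) //.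
  rewrite (sc_rJ_sym hA) (sc_rJ2 hA) -(sc_J_sym hA) -Cz_J ?(ltW t0) //.
  by rewrite (linB (sc_J_lin hA)) -Cz_J ?(ltW h0).
have rJz : hn (rJ z) ^+ 2 <= hn z ^+ 2 by rewrite ler_sqr ?nnegrE ?hn_ge0 // (rJ_le hA).
move=> /le_trans /(_ rJz) hs.
have hd2 := hd h; rewrite h0 hd' in hd2; have {}hd2 := hd2 isT.
have h3 : h * rdot (S t (K z)) z <= rdot (S t (J z - S h (J z))) z + h * r * hn z.
  have -> : h * rdot (S t (K z)) z = rdot (S t (J z - S h (J z))) z
     - rdot (S t (J z - S h (J z) - h%:C *: K z)) z.
    rewrite [S t (_ - h%:C *: _)](linB (Cz_lin hC _)) rdotBl (linZ (Cz_lin hC _)) rdotZl; ring.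
  rewrite lerD2l -rdotNl; apply: le_trans (rdot_le _ _) _.
  by rewrite hnN ler_wpM2r ?hn_ge0 //; apply: le_trans (Cz_le hC _ _) _.
have h4 : t * rdot (S t (K z)) z <= n%:R * (rdot (S t (J z - S h (J z))) z + h * r * hn z).
  by rewrite {1}th -mulrA ler_wpM2l // ltW.
have h5 : n%:R * (h * r * hn z) <= e.
  have -> : n%:R * (h * r * hn z) = n%:R * h * r * hn z by ring.
  rewrite -th /r.
  have -> : t * (e / (t * (hn z + 1))) * hn z = e * (hn z / (hn z + 1)).
    by field; rewrite gt_eqF //= gt_eqF.
  by rewrite ler_piMr ?(ltW e0) // ler_pdivrMr // mul1r lerDl.
by apply: le_trans h4 _; rewrite mulrDr lerD.
Qed.

(** By [Cz_K_form], [C_(t/2) rK] is bounded by [t^(-1/2)]; [C_t K] is a product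
    of two such factors. *)
Lemma Cz_K_le t z : 0 < t -> t * hn (S t (K z)) <= hn z.
Proof.
move=> t0; have t2 : 0 <= t / 2 by rewrite divr_ge0 // ltW.
have half u : t * hn (S (t / 2) (rK u)) ^+ 2 <= hn u ^+ 2.
  rewrite (sqr_Cz hC) Cz_rK ?(ltW t0) // (sc_rK_sym hA) (sc_rK2 hA).
  by rewrite (Cz_sym hC) rdotC; exact: Cz_K_form.
rewrite -(@ler_pXn2r _ 2) ?nnegrE ?hn_ge0 ?mulr_ge0 ?hn_ge0 ?(ltW t0) //.
have -> : S t (K z) = S (t / 2) (rK (S (t / 2) (rK z))).
  by rewrite (Cz_rK z t2) (sc_rK2 hA) -/(K _) -Cz_K // -(Cz_half hC).
rewrite exprMn expr2 -mulrA.
apply: le_trans (half z).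
by rewrite ler_wpM2l ?(ltW t0) // half.
Qed.

(** The second power of [K] yields the decay [1 / t^2], which is integrable at
    infinity. *)
Lemma Cz_KK_le t z : 0 < t -> t ^+ 2 * hn (S t (K (K z))) <= 4 * hn z.
Proof.
move=> t0; have t2 : 0 < t / 2 by rewrite divr_gt0.
have -> : S t (K (K z)) = S (t / 2) (K (S (t / 2) (K z))).
  by rewrite (Cz_half hC) -Cz_K // ltW.
have h1 := Cz_K_le (S (t / 2) (K z)) t2.
have h2 := Cz_K_le z t2.
have -> : t ^+ 2 * hn (S (t / 2) (K (S (t / 2) (K z)))) =
  4 * (t / 2 * (t / 2 * hn (S (t / 2) (K (S (t / 2) (K z)))))) by field.
rewrite ler_wpM2l //; apply: le_trans h2; rewrite ler_wpM2l //.
exact: ltW.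
Qed.

End Decay.

(** * Strongly measurable functions *)

Section FiniteMeasurable.
Import HBSimple.
Context {R : realType}.

(** The values are in a type without structure, so that vector values can be
    paired with booleans and scalars; for vectors this is [simple_fun]. *)
Definition fmeas (T : Type) (f : R -> T) :=
  finite_set (range f) /\ forall v, measurable (f @^-1` [set v]).

Lemma fmeas_preimage (T : Type) (f : R -> T) (A : set T) :
  fmeas f -> measurable (f @^-1` A).
Proof.
move=> [fin mf].
have -> : f @^-1` A = \bigcup_(v in range f `&` A) (f @^-1` [set v]).
  apply/seteqP; split => x /=.
    by move=> Ax; exists (f x) => //; split => //; exists x.
  by move=> [v [_ Av] /= ->].
apply: fin_bigcup_measurable => // ; exact: finite_setIl.
Qed.

Lemma fmeas_comp (T T' : Type) (phi : T -> T') (f : R -> T) :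
  fmeas f -> fmeas (phi \o f).
Proof.
move=> hf; split; last by move=> v; apply: (fmeas_preimage (phi @^-1` [set v])).
have -> : range (phi \o f) = phi @` range f by rewrite image_comp.
by apply: finite_image; case: hf.
Qed.

Lemma fmeas_pair (T T' : Type) (f : R -> T) (g : R -> T') :
  fmeas f -> fmeas g -> fmeas (fun x => (f x, g x)).
Proof.
move=> [ff mf] [fg mg]; split.
  apply: (@sub_finite_set _ _ (range f `*` range g)); last exact: finite_setX.
  by move=> _ [x _ <-]; split; exists x.
move=> [v w]; have -> : (fun x => (f x, g x)) @^-1` [set (v, w)] =
  f @^-1` [set v] `&` g @^-1` [set w].
  by apply/seteqP; split => x /= [-> ->].
exact: measurableI.
Qed.

Lemma fmeas_bool (D : set R) : measurable D -> fmeas (fun x => x \in D).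
Proof.
move=> mD; split; first exact: finite_finset.
case.
  have -> : (fun x => x \in D) @^-1` [set true] = D.
    by apply/seteqP; split => x /=; [exact: set_mem|exact: mem_set].
  by [].
have -> : (fun x => x \in D) @^-1` [set false] = ~` D.
  apply/seteqP; split => x /=; last exact: memNset.
  by move=> + /mem_set => ->.
exact: measurableC.
Qed.

Lemma fmeas_sfun (g : {sfun (measurableTypeR R) >-> R}) : fmeas (g : R -> R).
Proof. by split; [exact: (fimfunP g)|move=> v; exact: (measurable_funPTI g (measurable_set1 v))]. Qed.

Lemma fmeas_id_approx : exists q : nat -> R -> R,
  (forall n, fmeas (q n)) /\ forall x, q n x @[n --> \oo] --> x.
Proof.
have [g hg] := @approximation_sfun _ (measurableTypeR R) R _ _ measurableT
  (@EFin_measurable R setT).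
exists (fun n => g n); split; first by move=> n; exact: fmeas_sfun.
by move=> x; exact: (fine_cvg (hg x I)).
Qed.

End FiniteMeasurable.

Section StrongMeasurability.
Context {R : realType} {H : hilbertType R}.
Implicit Types (f g : R -> H).

Definition restr (D : set R) f : R -> H := fun x => if x \in D then f x else 0.

Lemma sm_cst (v : H) : strongly_measurable (fun _ : R => v).
Proof.
exists (fun _ _ => v); split; last by move=> x; exact: cvg_cst.
move=> _; have : fmeas (cst tt : R -> unit).
  split; first exact: finite_finset.
  by case; rewrite preimage_cst ifT ?inE //; exact: measurableT.
by move=> /(fmeas_comp (fun=> v)).
Qed.

Lemma sm_comp2 {K M : hilbertType R} (phi : H -> K -> M) f (g : R -> K) :
  (forall (us : nat -> H) (vs : nat -> K) u v, us @ \oo --> u -> vs @ \oo --> v ->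
     phi (us n) (vs n) @[n --> \oo] --> phi u v) ->
  strongly_measurable f -> strongly_measurable g ->
  strongly_measurable (fun x => phi (f x) (g x)).
Proof.
move=> hphi [s [ss sf]] [t [tt tg]].
exists (fun n x => phi (s n x) (t n x)); split; last by move=> x; exact: hphi.
move=> n; exact: (fmeas_comp (fun p => phi p.1 p.2) (fmeas_pair (ss n) (tt n))).
Qed.

Lemma sm_linear (a : R[i]) f g : strongly_measurable f -> strongly_measurable g ->
  strongly_measurable (fun x => a *: f x + g x).
Proof.
apply: (sm_comp2 (phi := fun u v => a *: u + v)) => us vs u v hu hv.
by apply: cvgD => //; exact: cvgZr.
Qed.

Lemma sm_restr D f : measurable D -> strongly_measurable f ->
  strongly_measurable (restr D f).
Proof.
move=> mD [s [ss sf]]; exists (fun n => restr D (s n)); split.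
  move=> n; exact: (fmeas_comp (fun p : bool * H => if p.1 then p.2 else 0)
    (fmeas_pair (fmeas_bool mD) (ss n))).
by move=> x; rewrite /restr; case: ifP => _ //; exact: cvg_cst.
Qed.

(** Applying to [f x] an operator depending on [x]: the operators are sampled
    at a simple approximation of [x], which preserves simplicity. Continuity
    may fail at the single point [0]. *)
Lemma sm_op (K : hilbertType R) (G : R -> H -> K) f :
  (forall x (xs : nat -> R) (vs : nat -> H) v, x != 0 -> xs @ \oo --> x ->
    vs @ \oo --> v -> G (xs n) (vs n) @[n --> \oo] --> G x v) ->
  strongly_measurable f -> strongly_measurable (fun x => G x (f x)).
Proof.
move=> hG [s [ss sf]]; have [q [qm qx]] := @fmeas_id_approx R.
exists (fun n x => if x \in [set 0] then G 0 (f 0) else G (q n x) (s n x)).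
split.
  move=> n; exact: (fmeas_comp (fun p : bool * (R * H) =>
    if p.1 then G 0 (f 0) else G p.2.1 p.2.2)
    (fmeas_pair (fmeas_bool (@measurable_set1 R 0)) (fmeas_pair (qm n) (ss n)))).
move=> x; have [->|x0] := eqVneq x 0.
  by rewrite mem_set //; exact: cvg_cst.
by rewrite memNset; [exact: hG|exact/eqP].
Qed.

Lemma measurable_shift (t : R) : measurable_fun setT (fun x : R => x - t).
Proof. by apply: measurable_funB => //. Qed.

Lemma sm_shift (t : R) f : strongly_measurable f -> strongly_measurable (fun x => f (x - t)).
Proof.
move=> [s [ss sf]]; exists (fun n x => s n (x - t)); split => // n.
have [fs ms] := ss n; split.
  by apply: sub_finite_set fs => _ [x _ <-]; exists (x - t).
move=> v; have := measurable_shift t measurableT (ms v).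
by rewrite setTI.
Qed.

Lemma sm_real2 {K : hilbertType R} (phi : H -> K -> R) f (g : R -> K) :
  (forall (us : nat -> H) (vs : nat -> K) u v, us @ \oo --> u -> vs @ \oo --> v ->
     phi (us n) (vs n) @[n --> \oo] --> phi u v) ->
  strongly_measurable f -> strongly_measurable g ->
  measurable_fun setT (fun x => phi (f x) (g x)).
Proof.
move=> hphi [s [ss sf]] [t [tt tg]].
apply: (@measurable_fun_cvg _ _ _ _ (fun n x => phi (s n x) (t n x))).
  move=> n _ Y mY; rewrite setTI.
  exact: (fmeas_preimage Y (fmeas_comp (fun p => phi p.1 p.2) (fmeas_pair (ss n) (tt n)))).
by move=> x _; exact: hphi.
Qed.

Lemma meas_rdot f g : strongly_measurable f -> strongly_measurable g ->
  measurable_fun setT (fun x => rdot (f x) (g x)).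
Proof. by apply: (sm_real2 (phi := fun u v => rdot u v)) => us vs u v; exact: cvg_rdot. Qed.

Lemma meas_hn f : strongly_measurable f -> measurable_fun setT (fun x => hn (f x)).
Proof.
move=> sf; apply: (sm_real2 (phi := fun u (_ : H) => hn u) _ sf sf).
by move=> us vs u v hu _; exact: cvg_hn.
Qed.

Lemma meas_hn2 f : strongly_measurable f ->
  measurable_fun setT (EFin \o (fun x => hn (f x) ^+ 2)).
Proof.
by move=> sf; apply/measurable_EFinP; apply: measurable_funX; exact: meas_hn.
Qed.

End StrongMeasurability.

(** * Square integrable functions *)

Section SquareIntegrals.
Context {R : realType} {H : hilbertType R}.
Implicit Types (f g : R -> H).
Local Notation mu := (@lebesgue_measure R).

Definition sqint f : \bar R := (\int[mu]_x (hn (f x) ^+ 2)%:E)%E.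
Definition L2 : set (R -> H) := L2fun (fun _ => id).

Lemma sqint_ge0 f : (0 <= sqint f)%E.
Proof. by apply: integral_ge0 => x _; rewrite lee_fin sqr_ge0. Qed.

Lemma sqint_eq f g : (forall x, hn (f x) = hn (g x)) -> sqint f = sqint g.
Proof. by move=> h; apply: eq_integral => x _; rewrite h. Qed.

Lemma L2P f : L2 f <-> strongly_measurable f /\ (sqint f < +oo)%E.
Proof.
have E : (\int[mu]_x (complex.Re (hdot (f x) (f x)))%:E = sqint f)%E.
  by apply: eq_integral => x _; rewrite -rdotE.
by rewrite /L2 /L2fun /= E.
Qed.

Lemma sqint_le (c : R) f g : strongly_measurable f -> strongly_measurable g ->
  (forall x, hn (f x) <= c * hn (g x)) -> (sqint f <= (c ^+ 2)%:E * sqint g)%E.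
Proof.
move=> sf sg h; rewrite /sqint -ge0_integralZl_EFin //; last 3 first.
- by move=> x _; rewrite lee_fin sqr_ge0.
- exact: (meas_hn2 sg).
- exact: sqr_ge0.
apply: ge0_le_integral => //.
- by move=> x _; rewrite lee_fin sqr_ge0.
- exact: (meas_hn2 sf).
- apply/measurable_EFinP; apply: measurable_funM => //.
  by apply: measurable_funX; exact: meas_hn.
move=> x _; rewrite -EFinM lee_fin -exprMn.
have c0 : 0 <= c * hn (g x) by apply: le_trans (h x); exact: hn_ge0.
by rewrite ler_sqr ?nnegrE ?hn_ge0.
Qed.

Lemma L2_dom (c : R) f g : strongly_measurable f -> L2 g ->
  (forall x, hn (f x) <= c * hn (g x)) -> L2 f.
Proof.
move=> sf /L2P[sg ig] h; apply/L2P; split => //.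
apply: le_lt_trans (sqint_le sf sg h) _.
by rewrite lte_mul_pinfty // lee_fin sqr_ge0.
Qed.

Lemma L2_scale_dom f g : L2 f -> L2 g ->
  (\int[mu]_x (2 * hn (f x) ^+ 2 + 2 * hn (g x) ^+ 2)%:E < +oo)%E.
Proof.
move=> /L2P[sf ig] /L2P[sg jg].
have m2 (h : R -> H) : strongly_measurable h ->
    measurable_fun setT (EFin \o (fun x => 2 * hn (h x) ^+ 2)).
  move=> sh; apply/measurable_EFinP; apply: measurable_funM => //.
  by apply: measurable_funX; exact: meas_hn.
have p2 (h : R -> H) x : (0 <= (2 * hn (h x) ^+ 2)%:E)%E.
  by rewrite lee_fin mulr_ge0 ?sqr_ge0.
have := @ge0_integralD _ _ _ mu setT measurableT _ _
  (fun x _ => p2 f x) (m2 f sf) (fun x _ => p2 g x) (m2 g sg).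
rewrite /= => ->.
have i2 (h : R -> H) : L2 h -> (\int[mu]_x (2 * hn (h x) ^+ 2)%:E < +oo)%E.
  move=> /L2P[sh ih]; under eq_integral do rewrite EFinM.
  rewrite (@ge0_integralZl_EFin _ _ _ mu setT measurableT _ _ (meas_hn2 sh)) //=.
    by rewrite lte_mul_pinfty.
  by move=> x _; rewrite lee_fin sqr_ge0.
by apply: lte_add_pinfty; apply: i2; apply/L2P.
Qed.

Lemma L2_lin (a : R[i]) f g : L2 f -> L2 g -> L2 (fun x => a *: f x + g x).
Proof.
move=> hf hg.
have haf : L2 (fun x => a *: f x).
  have [sf _] := (L2P f).1 hf.
  apply: (@L2_dom (complex.Re `|a|)) hf _; last by move=> x; rewrite hnZ.
  have := sm_linear a sf (sm_cst (0 : H)).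
  by under eq_fun do rewrite addr0.
have [saf _] := (L2P _).1 haf; have [sg _] := (L2P _).1 hg; have [sf _] := (L2P _).1 hf.
have sm : strongly_measurable (fun x => a *: f x + g x) by exact: sm_linear.
apply/L2P; split; first exact: sm.
apply: le_lt_trans (L2_scale_dom haf hg).
apply: ge0_le_integral => //.
- by move=> x _; rewrite lee_fin sqr_ge0.
- exact: (meas_hn2 sm).
- apply/measurable_EFinP; apply: measurable_funD; apply: measurable_funM => //;
    by apply: measurable_funX; exact: meas_hn.
move=> x _; rewrite lee_fin sqr_hnD.
have := sqr_ge0 (hn (a *: f x - g x)); rewrite sqr_hnB; lra.
Qed.

Lemma L2_0 : L2 (fun _ => 0).
Proof.
apply/L2P; split; first exact: sm_cst.
by rewrite /sqint; under eq_integral do rewrite hn0 expr0n /=; rewrite integral0.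
Qed.

Lemma L2_B f g : L2 f -> L2 g -> L2 (fun x => f x - g x).
Proof.
move=> hf hg; have := L2_lin (-1) hg hf.
by under eq_fun do rewrite scaleN1r addrC.
Qed.

Lemma L2_Z a f : L2 f -> L2 (fun x => a *: f x).
Proof. by move=> hf; have := L2_lin a hf L2_0; under eq_fun do rewrite addr0. Qed.

Lemma L2_restr D f : measurable D -> L2 f -> L2 (restr D f).
Proof.
move=> mD hf; have [sf _] := (L2P _).1 hf.
apply: (@L2_dom 1) hf _; first exact: sm_restr.
by move=> x; rewrite mul1r /restr; case: ifP => // _; rewrite hn0 hn_ge0.
Qed.

Lemma fatou_L2 (fs : nat -> R -> H) f (c : R) : (forall n, L2 (fs n)) ->
  strongly_measurable f -> (forall x, fs n x @[n --> \oo] --> f x) ->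
  (forall n, (sqint (fs n) <= c%:E)%E) -> (sqint f <= c%:E)%E.
Proof.
move=> hfs sf cf hc.
have -> : sqint f = (\int[mu]_x limn_einf (fun n => (hn (fs n x) ^+ 2)%:E))%E.
  apply: eq_integral => x _; apply/esym.
  apply: (fst (@cvg_limn_einf_sup _ _ _ _)); apply: cvg_EFin; first by near=> n.
  rewrite /= expr2; under eq_fun do rewrite /= expr2.
  by apply: cvgM; exact/cvg_hn.
have sfs n : strongly_measurable (fs n) by case: ((L2P _).1 (hfs n)).
apply: le_trans (@fatou _ _ _ mu setT measurableT
  (fun n x => (hn (fs n x) ^+ 2)%:E) _ _) _.
- by move=> n; exact: (meas_hn2 (sfs n)).
- by move=> n x _; rewrite lee_fin sqr_ge0.
rewrite limn_einf_lim; apply: lime_le; first exact: is_cvg_einfs.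
near=> n; apply: le_trans (hc n); apply: ereal_inf_lbound.
by exists n => //=.
Unshelve. all: by end_near. Qed.

Lemma sqint_dominated (fs : nat -> R -> H) f g (c : R) : (forall n, strongly_measurable (fs n)) ->
  strongly_measurable f -> L2 g -> (forall n x, hn (fs n x) <= c * hn (g x)) ->
  (forall x, fs n x @[n --> \oo] --> f x) ->
  fine (sqint (fun x => fs n x - f x)) @[n --> \oo] --> (0 : R).
Proof.
move=> sfs sf hg hfg cf.
have fle x : hn (f x) <= c * hn (g x).
  by apply: (ler_cvg_to (cvg_hn (cf x)) (cvg_cst _)); near=> n; exact: hfg.
have L2f : L2 f := L2_dom sf hg fle.
have L2fs n : L2 (fs n) := L2_dom (sfs n) hg (hfg n).
have [sg ig] := (L2P _).1 hg.
pose b x := (4 * c ^+ 2) * hn (g x) ^+ 2.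
have mb : measurable_fun setT b.
  by apply: measurable_funM => //; apply: measurable_funX; exact: meas_hn.
have ib : mu.-integrable setT (EFin \o b).
  apply/integrableP; split; first exact/measurable_EFinP.
  have eb x : `|(EFin \o b) x|%E = ((4 * c ^+ 2)%:E * (hn (g x) ^+ 2)%:E)%E.
    rewrite /= /b ger0_norm; first by rewrite -EFinM.
    by apply: mulr_ge0; [apply: mulr_ge0|]; rewrite ?sqr_ge0.
  under eq_integral do rewrite eb.
  rewrite ge0_integralZl_EFin //; [|by move=> x _; rewrite lee_fin sqr_ge0|exact: (meas_hn2 sg)|by rewrite mulr_ge0 ?sqr_ge0].
  by rewrite lte_mul_pinfty // lee_fin mulr_ge0 ?sqr_ge0.
have := @dominated_cvg _ _ _ mu setT measurableT
  (fun n x => (hn (fs n x - f x) ^+ 2)%:E) (fun=> 0%E) (EFin \o b).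
move=> /(_ _ _ _ ib _) h; apply/fine_cvg.
rewrite -[0%:E](@integral0 _ _ _ mu setT) ; apply: h => //.
- by move=> n; have [s _] := (L2P _).1 (L2_B (L2fs n) L2f); exact: (meas_hn2 s).
- move=> x _; apply: cvg_EFin; first by near=> n.
  rewrite /= -(mulr0 (0:R)); under eq_fun do rewrite /= expr2.
  by apply: cvgM; exact/cvg_hnP.
- move=> n x _; rewrite /= lee_fin ger0_norm ?sqr_ge0 // /b.
  have -> : 4 * c ^+ 2 * hn (g x) ^+ 2 = (c * hn (g x) + c * hn (g x)) ^+ 2 by ring.
  have c0 : 0 <= c * hn (g x) by apply: le_trans (fle x); exact: hn_ge0.
  rewrite ler_sqr ?nnegrE ?hn_ge0 ?addr_ge0 //.
  by apply: le_trans (hnB _ _) _; rewrite lerD.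
Unshelve. all: by end_near. Qed.

End SquareIntegrals.

(** * Closed subspaces and density of steps *)

Section ClosedSubspaces.
Context {R : realType} {E : hilbertType R}.
Variables (V : set E) (hV : closed_subspace V).

Lemma csub0 : V 0. Proof. by case: hV. Qed.

Lemma csubZ (a : R[i]) u : V u -> V (a *: u).
Proof. by case: hV => _ V0 Vl hu; rewrite -[_ *: _]addr0; exact: Vl. Qed.

Lemma csubD u v : V u -> V v -> V (u + v).
Proof. by case: hV => _ V0 Vl hu hv; rewrite -[u]scale1r; exact: Vl. Qed.

Lemma csubB u v : V u -> V v -> V (u - v).
Proof. by move=> hu hv; apply: csubD => //; rewrite -scaleN1r; exact: csubZ. Qed.

Lemma csub_close l : (forall e : R, 0 < e -> exists2 v, V v & hn (l - v) < e) -> V l.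
Proof.
move=> h; case: hV => cV _ _; apply: cV => B /nbhs_ballP[[e e'] /=].
rewrite ltcE /= => /andP[/eqP -> e0] eB.
have [v Vv lv] := h _ e0; exists v; split => //.
by apply: eB; rewrite -ball_normE /= hnE ltcR.
Qed.

Lemma csub_cvg (vs : nat -> E) l : (forall n, V (vs n)) -> vs @ \oo --> l -> V l.
Proof.
move=> hv /cvg_hnP /cvgrPdist_lt h; apply: csub_close => e /h [N _ /(_ N (leqnn N))].
rewrite /= sub0r normrN ger0_norm ?hn_ge0 // => hN.
by exists (vs N) => //; rewrite hn_distC.
Qed.

End ClosedSubspaces.

Section L2SpaceMaps.
Context {R : realType} {H L : hilbertType R}.
Variables (jL : (R -> H) -> L) (hL : L2map (fun _ => id) jL).
Implicit Types (f g : R -> H).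
Local Notation mu := (@lebesgue_measure R).
Local Notation L2 := (@L2 R H).

Lemma jL_lin a f g : L2 f -> L2 g -> jL (fun x => a *: f x + g x) = a *: jL f + jL g.
Proof. exact: L2map_linear. Qed.

Lemma jL_0 : jL (fun _ => 0) = 0.
Proof.
have := jL_lin 1 (@L2_0 R H) (@L2_0 R H).
under eq_fun do rewrite scaler0 addr0.
by rewrite scale1r => h; apply: (addrI (jL (fun=> 0))); rewrite addr0 -h.
Qed.

Lemma jL_Z a f : L2 f -> jL (fun x => a *: f x) = a *: jL f.
Proof.
move=> hf; have := jL_lin a hf (@L2_0 R H).
by under eq_fun do rewrite addr0; rewrite jL_0 addr0.
Qed.

Lemma jL_D f g : L2 f -> L2 g -> jL (fun x => f x + g x) = jL f + jL g.
Proof.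
move=> hf hg; have := jL_lin 1 hf hg; rewrite scale1r.
by under eq_fun do rewrite scale1r.
Qed.

Lemma jL_B f g : L2 f -> L2 g -> jL (fun x => f x - g x) = jL f - jL g.
Proof.
move=> hf hg; have := jL_lin (-1) hg hf; rewrite scaleN1r addrC => <-.
by congr jL; apply/funext => x; rewrite scaleN1r addrC.
Qed.

Lemma jL_norm f : L2 f -> hn (jL f) ^+ 2 = fine (sqint f).
Proof.
move=> hf; rewrite -rdotE /rdot (L2map_dot hL hf hf) /L2dot /cintegral /=.
rewrite /Rintegral; congr fine; apply: eq_integral => x _.
by rewrite -rdotE.
Qed.

Lemma sqint_fin f : L2 f -> (sqint f) = (hn (jL f) ^+ 2)%:E.
Proof.
move=> hf; rewrite jL_norm // fineK // ge0_fin_numE ?sqint_ge0 //.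
by case: ((L2P f).1 hf).
Qed.

Lemma jL_eq_off (c : R) f g : L2 f -> L2 g -> (forall x, x != c -> f x = g x) ->
  jL f = jL g.
Proof.
move=> hf hg fg; apply/eqP; rewrite -subr_eq0 -jL_B //; apply/eqP/hn_eq0/eqP.
have hfg := L2_B hf hg.
rewrite -sqrf_eq0 jL_norm //; apply/eqP.
have -> : sqint (fun x => f x - g x) = (\int[mu]_x (cst 0 x))%E.
  apply: ae_eq_integral => //.
    by have [s _] := (L2P _).1 hfg; exact: (meas_hn2 s).
  exists [set c]; split => //; first exact: lebesgue_measure_set1.
  move=> x /= hx; apply/eqP; apply: contraT => /fg e.
  by exfalso; apply: hx => _; rewrite e subrr hn0 expr0n.
by rewrite integral0.
Qed.

Lemma jL_dominated (fs : nat -> R -> H) f g (c : R) :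
  (forall n, strongly_measurable (fs n)) ->
  strongly_measurable f -> L2 g -> (forall n x, hn (fs n x) <= c * hn (g x)) ->
  (forall x, fs n x @[n --> \oo] --> f x) ->
  jL (fs n) @[n --> \oo] --> jL f.
Proof.
move=> sfs sf hg hfg cf.
have fle x : hn (f x) <= c * hn (g x).
  by apply: (ler_cvg_to (cvg_hn (cf x)) (cvg_cst _)); near=> n; exact: hfg.
have L2f : L2 f := L2_dom sf hg fle.
have L2fs n : L2 (fs n) := L2_dom (sfs n) hg (hfg n).
apply/cvg_hnP.
have := sqint_dominated sfs sf hg hfg cf.
move=> h; apply/cvgrPdist_lt => e e0; move/cvgrPdist_lt : h => /(_ (e ^+ 2)).
rewrite exprn_gt0 // => /(_ isT); apply: filterS => n.
rewrite !sub0r !normrN -jL_norm; last exact: L2_B.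
rewrite jL_B // !ger0_norm ?hn_ge0 ?sqr_ge0 //.
by rewrite ltr_pXn2r ?nnegrE ?hn_ge0 // ltW.
Unshelve. all: by end_near. Qed.

Lemma sqint_step (D : set R) (v : H) : measurable D ->
  sqint (restr D (cst v)) = ((hn v ^+ 2)%:E * mu D)%E.
Proof.
move=> mD; rewrite -[mu D]mul1e -(@integral_cst _ _ _ mu D mD 1).
rewrite -ge0_integralZl_EFin ?sqr_ge0 // integral_mkcond.
apply: eq_integral => x _; rewrite /restr /patch.
by case: ifP => _; rewrite ?mule1 // hn0 expr0n.
Qed.

Lemma sm_step (D : set R) (v : H) : measurable D -> strongly_measurable (restr D (cst v)).
Proof. by move=> mD; apply: sm_restr => //; exact: sm_cst. Qed.

Lemma mu_itv (a b : R) : a <= b -> mu `]a, b]%classic = (b - a)%:E.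
Proof.
move=> ab; rewrite lebesgue_measure_itv /= lte_fin; case: ltP => // ba.
have -> : a = b by apply/eqP; rewrite eq_le ab.
by rewrite subrr.
Qed.

Lemma restrT (D : set R) f x : D x -> restr D f x = f x.
Proof. by move=> Dx; rewrite /restr mem_set. Qed.

Lemma restrF (D : set R) f x : ~ D x -> restr D f x = 0.
Proof. by move=> Dx; rewrite /restr memNset. Qed.

Lemma sm_simple f : simple_fun f -> strongly_measurable f.
Proof. by move=> sf; exists (fun=> f); split => // x; exact: cvg_cst. Qed.

Lemma L2_step (a b : R) (v : H) : a <= b -> L2 (restr `]a, b]%classic (cst v)).
Proof.
move=> ab; apply/L2P; split; first exact: sm_step.
by rewrite sqint_step // mu_itv // -EFinM ltry.
Qed.

(** Intervals extend to Borel sets inside a bounded window by Dynkin's lemma,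
    Borel sets to simple functions by linearity, and these to all functions by
    dominated convergence. The windows exhaust the open half-line, and the
    point [c] is a null set. *)
Section StepDensity.
Variables (V : set L) (hV : closed_subspace V) (W : set H) (c : R).
Hypothesis dW : forall u (e : R), 0 < e -> exists2 w, W w & hn (u - w) < e.
Hypothesis VW : forall a b w, c < a -> a < b -> W w ->
  V (jL (restr `]a, b]%classic (cst w))).

Let V_itv a b v : c < a -> V (jL (restr `]a, b]%classic (cst v))).
Proof.
move=> ca; have [ab|ba] := ltP a b; last first.
  have -> : restr `]a, b]%classic (cst v) = fun=> 0.
    apply/funext => x; rewrite restrF //= in_itv /= => /andP[h1 h2].
    by have := lt_le_trans h1 h2; rewrite ltNge ba.
  by rewrite jL_0; exact: csub0.
apply: (csub_close hV) => e e0.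
have q0 : 0 < Num.sqrt (b - a) by rewrite sqrtr_gt0 subr_gt0.
have [w Ww vw] := dW v (divr_gt0 e0 q0).
exists (jL (restr `]a, b]%classic (cst w))); first exact: VW.
have Lv := L2_step v (ltW ab); have Lw := L2_step w (ltW ab).
rewrite -(@ltr_pXn2r _ 2) ?nnegrE ?hn_ge0 ?(ltW e0) // -jL_B //.
rewrite jL_norm; last exact: L2_B.
have -> : (fun x => restr `]a, b]%classic (cst v) x - restr `]a, b]%classic (cst w) x)
   = restr `]a, b]%classic (cst (v - w)).
  by apply/funext => x; rewrite /restr; case: ifP => // _; rewrite subrr.
rewrite sqint_step // mu_itv ?(ltW ab) // -EFinM /=.
rewrite -(sqr_sqrtr (_ : 0 <= b - a)) ?subr_ge0 ?(ltW ab) // -exprMn.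
rewrite ltr_pXn2r ?nnegrE ?mulr_ge0 ?hn_ge0 ?sqrtr_ge0 ?(ltW e0) //.
by rewrite -ltr_pdivlMr.
Qed.

Section Window.
Variables (a1 b1 : R) (ca1 : c < a1) (ab1 : a1 < b1).
Let I := `]a1, b1]%classic : set R.

Let mI : measurable I. Proof. exact: measurable_itv. Qed.

Let L2_borel E v : measurable E -> L2 (restr (E `&` I) (cst v)).
Proof.
move=> mE; apply: (@L2_dom _ _ 1) (L2_step v (ltW ab1)) _.
  by apply: sm_step; exact: measurableI.
move=> x; rewrite mul1r /restr; have [xE|xE] := boolP (x \in E `&` I).
  by move: xE; rewrite in_setI => /andP[_ ->].
by rewrite hn0 hn_ge0.
Qed.

Let V_borel E v : measurable E -> V (jL (restr (E `&` I) (cst v))).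
Proof.
have [_ V0 _] := hV.
move: E; apply: (@dynkin_induction _ (measurableTypeR R) (@ocitv R)
  (fun E => V (jL (restr (E `&` I) (cst v))))) => //.
- by move=> A B; exact: ocitvI.
- by rewrite setTI; exact: V_itv.
- move=> _ [[a b] _ <-] /=.
  have -> : `]a, b] `&` I = `]Num.max a a1, Num.min b b1]%classic.
    apply/seteqP; split => x; rewrite /I /= !in_itv /= gt_max le_min.
      by move=> [/andP[-> ->] /andP[-> ->]].
    by move=> /andP[/andP[-> ->] /andP[-> ->]].
  by apply: V_itv; rewrite lt_max ca1 orbT.
- move=> E mE VE.
  have -> : restr (~` E `&` I) (cst v) =
      fun x => restr I (cst v) x - restr (E `&` I) (cst v) x.
    apply/funext => x; rewrite /restr !in_setI in_setC.
    by case: (x \in I); case: (x \in E); rewrite /= ?subrr ?subr0.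
  rewrite jL_B; [|exact: L2_step (ltW _)|exact: L2_borel].
  by apply: csubB => //; exact: V_itv.
- move=> F mF tF VF.
  pose G n := [set x | exists2 k, (k < n)%N & F k x].
  have GS n : G n.+1 = G n `|` F n.
    apply/seteqP; split => x /=.
      move=> [k]; rewrite ltnS leq_eqVlt => /predU1P[->|kn] Fx; first by right.
      by left; exists k.
    move=> [[k kn Fx]|Fx]; last by exists n.
    by exists k => //; exact: ltnW.
  have mG n : measurable (G n).
    elim: n => [|n IH]; last by rewrite GS; exact: measurableU.
    by have -> : G 0%N = set0 by rewrite -subset0 => x [].
  have VG n : V (jL (restr (G n `&` I) (cst v))).
    elim: n => [|n IH].
      have -> : restr (G 0%N `&` I) (cst v) = fun=> 0.
        by apply/funext => x; rewrite restrF // => -[[]].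
      by rewrite jL_0; exact: csub0.
    have -> : restr (G n.+1 `&` I) (cst v) =
        fun x => restr (G n `&` I) (cst v) x + restr (F n `&` I) (cst v) x.
      apply/funext => x; rewrite GS setIUl.
      have [Gx|Gx] := pselect ((G n `&` I) x).
        rewrite (restrT _ Gx) restrT; last by left.
        rewrite restrF ?addr0 // => -[Fx _].
        case: Gx => -[k kn Fkx] _.
        have := tF k n Logic.I Logic.I (ex_intro _ x (conj Fkx Fx)).
        by move=> e; rewrite e ltnn in kn.
      rewrite (restrF _ Gx) add0r; have [Fx|Fx] := pselect ((F n `&` I) x).
        by rewrite (restrT _ Fx) restrT; [|right].
      by rewrite (restrF _ Fx) restrF // => -[].
    rewrite jL_D; [|exact: (L2_borel v (mG n))|exact: (L2_borel v (mF n))].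
    exact: csubD.
  apply: (csub_cvg hV VG); apply: (@jL_dominated _ _ (restr I (cst v)) 1).
  + by move=> n; apply: sm_step; exact: (measurableI _ _ (mG n) mI).
  + by apply: sm_step; apply: measurableI => //; apply: bigcup_measurable => k _; exact: mF.
  + exact: L2_step (ltW ab1).
  + move=> n x; rewrite mul1r; have [[Gx Ix]|Gx] := pselect ((G n `&` I) x).
      by rewrite !restrT.
    by rewrite (restrF _ Gx) hn0 hn_ge0.
  + move=> x; have [[[k _ Fx] Ix]|Fx] := pselect (((\bigcup_k F k) `&` I) x).
      rewrite restrT; last by split => //; exists k.
      apply: cvg_near_cst; exists k.+1 => // n /= kn.
      by rewrite restrT //; split => //; exists k.
    rewrite restrF //; apply: cvg_near_cst.
    near=> n; rewrite restrF // => -[[k _ Fkx] Ix].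
    by apply: Fx; split => //; exists k.
Unshelve. all: by end_near. Qed.

Let V_simple f : fmeas f -> L2 (restr I f) /\ V (jL (restr I f)).
Proof.
move=> hf; have [ff _] := hf; have /finite_seqP[s sE] := ff.
have : forall x, f x = 0 \/ f x \in s.
  move=> x; right; have h : range f (f x) by exists x.
  by move: h; rewrite sE.
elim: s f hf {ff sE} => [|v s IH] f hf hs.
  have -> : restr I f = fun=> 0.
    apply/funext => x; rewrite /restr; case: ifP => // _.
    by have [] := hs x.
  by split; [exact: L2_0|rewrite jL_0; exact: csub0].
pose D := f @^-1` [set v].
have mD : measurable D by exact: (fmeas_preimage [set v] hf).
have mDC : measurable (~` D) by exact: measurableC.
pose g := restr (~` D) f.
have hg : fmeas g.
  exact: (fmeas_comp (fun p : bool * H => if p.1 then p.2 else 0)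
    (fmeas_pair (fmeas_bool mDC) hf)).
have [L2g Vg] : L2 (restr I g) /\ V (jL (restr I g)).
  apply: IH => // x; rewrite /g; have [Dx|Dx] := pselect (D x).
    by left; rewrite restrF // => /(_ Dx).
  rewrite restrT //; case: (hs x) => [->|]; first by left.
  by rewrite in_cons => /predU1P[//|]; right.
have E : restr I f = fun x => restr (D `&` I) (cst v) x + restr I g x.
  apply/funext => x; have [Ix|Ix] := pselect (I x); last first.
    by rewrite !(restrF _ Ix) restrF ?addr0 // => -[].
  rewrite !(restrT _ Ix) /g; have [Dx|Dx] := pselect (D x).
    by rewrite restrT // (@restrF (~` D) f x) ?addr0 // => /(_ Dx).
  by rewrite restrF ?add0r ?restrT // => -[].
rewrite E; split.
  have := L2_lin 1 (L2_borel v mD) L2g.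
  by under eq_fun do rewrite scale1r.
by rewrite jL_D //; [apply: csubD => //; exact: V_borel|exact: L2_borel].
Qed.

Lemma window_density f : L2 f -> (forall x, ~ I x -> f x = 0) -> V (jL f).
Proof.
move=> hf f0; have [sf _] := (L2P f).1 hf.
have [s [ss cs]] := sf.
(* Truncating the simple approximations where they exceed [2 |f|] makes them
   dominated, and keeps pointwise convergence. *)
pose D n := [set x | hn (s n x) <= 2 * hn (f x)].
have sms n : strongly_measurable (s n) by exact: sm_simple.
have mD n : measurable (D n).
  have m : measurable_fun setT (fun x => 2 * hn (f x) - hn (s n x)).
    apply: measurable_funB; last exact: meas_hn.
    by apply: measurable_funM => //; exact: meas_hn.
  have := m measurableT _ (@measurable_itv R `[0, +oo[); rewrite setTI.
  congr (measurable _); apply/seteqP; split => x /=;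
    by rewrite in_itv /= andbT subr_ge0.
pose t n := restr I (restr (D n) (s n)).
have Vt n : V (jL (t n)).
  have /V_simple[] // : fmeas (restr (D n) (s n)).
  exact: (fmeas_comp (fun p : bool * H => if p.1 then p.2 else 0)
    (fmeas_pair (fmeas_bool (mD n)) (ss n))).
apply: (csub_cvg hV Vt); apply: (@jL_dominated _ _ f 2) => //.
- by move=> n; do 2 apply: sm_restr => //.
- move=> n x; rewrite /t; have h : 0 <= 2 * hn (f x) by rewrite mulr_ge0 ?hn_ge0.
  have [Ix|Ix] := pselect (I x); last by rewrite restrF // hn0.
  rewrite restrT //; have [Dx|Dx] := pselect (D n x); first by rewrite restrT.
  by rewrite restrF // hn0.
move=> x; have [Ix|Ix] := pselect (I x); last first.
  rewrite f0 //; apply: cvg_near_cst.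
  by near=> n; rewrite /t restrF.
apply: (@cvg_hn_le _ _ _ _ _ _ _ (fun n => hn (s n x - f x))); last first.
  exact/cvg_hnP/cs.
near=> n; rewrite /t restrT //.
have [Dx|Dx] := pselect (D n x); first by rewrite restrT.
rewrite restrF // sub0r hnN.
have {}Dx : 2 * hn (f x) < hn (s n x) by rewrite ltNge; apply/negP.
have := hnD (s n x - f x) (f x); rewrite subrK; lra.
Unshelve. all: by end_near. Qed.

End Window.

Lemma step_density f : L2 f -> (forall x, x < c -> f x = 0) -> V (jL f).
Proof.
move=> hf f0; have [sf _] := (L2P f).1 hf.
pose D n : set R := `]c + n.+1%:R^-1, c + n.+2%:R]%classic.
have mD n : measurable (D n) by exact: measurable_itv.
have L2D n : L2 (restr (D n) f) by exact: L2_restr.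
have VD n : V (jL (restr (D n) f)).
  apply: (@window_density (c + n.+1%:R^-1) (c + n.+2%:R)) => //.
  - by rewrite ltrDl invr_gt0.
  - rewrite ltrD2l; apply: (@le_lt_trans _ _ 1); last by rewrite ltr1n.
    by rewrite invf_le1 ?ler1n.
  - by move=> x Dx; rewrite restrF.
pose Ic := `]c, +oo[%classic : set R.
have mI : measurable Ic by exact: measurable_itv.
have -> : jL f = jL (restr Ic f).
  apply: (@jL_eq_off c) => //; first exact: L2_restr.
  move=> x xc; have [Ix|Ix] := pselect (Ic x); first by rewrite restrT.
  rewrite restrF // f0 //; move/negP : Ix; rewrite /Ic /= in_itv /= andbT -leNgt.
  by rewrite lt_neqAle xc.
apply: (csub_cvg hV VD); apply: (@jL_dominated _ _ f 1) => //.
- by move=> n; exact: sm_restr.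
- exact: sm_restr.
- move=> n x; rewrite mul1r; have [Ix|Ix] := pselect (D n x); first by rewrite restrT.
  by rewrite restrF // hn0 hn_ge0.
move=> x; have [Ix|Ix] := pselect (Ic x); last first.
  rewrite restrF //; apply: cvg_near_cst.
  near=> n; rewrite restrF //; apply: contra_not Ix.
  rewrite /D /Ic /= !in_itv /= andbT => /andP[h _]; apply: lt_trans h.
  by rewrite ltrDl invr_gt0.
rewrite restrT //; apply: cvg_near_cst.
have xc : 0 < x - c by move: Ix; rewrite /Ic /= in_itv /= andbT subr_gt0.
near=> n; rewrite restrT // /D /= in_itv /=; apply/andP; split.
  rewrite addrC -ltrBrDr; near: n; exact: (near_infty_natSinv_lt (PosNum xc)).
rewrite -lerBlDl; apply: (@le_trans _ _ n%:R); last by rewrite ler_nat -addn2 leq_addr.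
by near: n; exact: nbhs_infty_ger.
Unshelve. all: by end_near. Qed.

End StepDensity.

End L2SpaceMaps.

(** * Isometries *)

Section Isometries.
Context {R : realType} {E L : hilbertType R}.

Lemma hn_near_eq0 (u : E) : (forall e : R, 0 < e -> hn u <= e) -> u = 0.
Proof.
move=> h; apply: hn_eq0; apply/eqP; rewrite eq_le hn_ge0 andbT.
by apply/ler_addgt0Pr => e e0; rewrite add0r; exact: h.
Qed.

(** The extension by continuity of an isometry given on representatives: the
    image of [u] is the point with the prescribed distances to all [j2 f]. *)
Lemma isometric_extension (X : Type) (D : set X) (j1 : X -> E) (j2 : X -> L) :
  (forall u (e : R), 0 < e -> exists2 f, D f & hn (u - j1 f) < e) ->
  (forall (a : R[i]) f g, D f -> D g -> exists k,
    [/\ D k, j1 k = a *: j1 f + j1 g & j2 k = a *: j2 f + j2 g]) ->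
  (forall f, D f -> hn (j2 f) = hn (j1 f)) ->
  exists T : E -> L, [/\ linear T, forall u, hn (T u) = hn u &
    forall f, D f -> T (j1 f) = j2 f].
Proof.
move=> dense lin iso.
have dist f g : D f -> D g -> hn (j2 f - j2 g) = hn (j1 f - j1 g).
  move=> Df Dg; have [k [Dk k1 k2]] := lin (-1) g f Dg Df.
  by have := iso k Dk; rewrite k1 k2 !scaleN1r addrC => ->; rewrite addrC.
have ex u : exists l, forall g, D g -> hn (l - j2 g) = hn (u - j1 g).
  have /choice[f hf] (n : nat) : exists f, D f /\ hn (u - j1 f) < n.+1%:R^-1.
    have [|f Df uf] := dense u n.+1%:R^-1; first by rewrite invr_gt0.
    by exists f.
  have inv0 : n.+1%:R^-1 @[n --> \oo] --> (0 : R) by exact: cvg_harmonic.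
  have j1u : j1 (f n) @[n --> \oo] --> u.
    apply: (@cvg_hn_le _ _ _ _ _ _ _ (fun n => n.+1%:R^-1)) => //.
    by near=> n; rewrite hn_distC; apply: ltW; case: (hf n).
  have [l j2l] : exists l : L, j2 (f n) @[n --> \oo] --> l.
    apply: hcauchy_cvg => e e0; have e2 : 0 < e / 2 by rewrite divr_gt0.
    move/cvg_hnP/cvgrPdist_lt : j1u => /(_ _ e2)[N _ hN]; exists N => n Nn.
    rewrite dist; [|by case: (hf N)|by case: (hf n)].
    apply: le_lt_trans (hn_triangle u _ _) _; rewrite [e]splitr.
    have h1 := hN N (leqnn N); have h2 := hN n Nn.
    move: h1 h2; rewrite /= !sub0r !normrN !ger0_norm ?hn_ge0 // => h1 h2.
    by rewrite ltrD // hn_distC.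
  exists l => g Dg.
  have c1 : hn (j2 (f n) - j2 g) @[n --> \oo] --> hn (l - j2 g).
    by apply: cvg_hn; apply: cvgB => //; exact: cvg_cst.
  have c2 : hn (j2 (f n) - j2 g) @[n --> \oo] --> hn (u - j1 g).
    have E' : (fun n => hn (j2 (f n) - j2 g)) = (fun n => hn (j1 (f n) - j1 g)).
      by apply/funext => n; rewrite dist //; case: (hf n).
    by rewrite E'; apply: cvg_hn; apply: cvgB => //; exact: cvg_cst.
  by apply: (cvg_unique _ c1 c2); exact: norm_hausdorff.
have [T hT] := choice ex; exists T; split.
- move=> a u v; apply/eqP; rewrite -subr_eq0; apply/eqP.
  apply: hn_eq0; apply/eqP; rewrite eq_le hn_ge0 andbT.
  apply/ler_addgt0Pr => e e0; rewrite add0r.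
  pose c := complex.Re `|a|.
  have c0 : 0 <= c by have := normr_ge0 a; rewrite lecE => /andP[].
  have d0 : 0 < e / (2 * (c + 1)) by rewrite divr_gt0 // mulr_gt0 // ltr_wpDl.
  have [f Df uf] := dense u _ d0; have [g Dg vg] := dense v _ d0.
  have [k [Dk k1 k2]] := lin a f g Df Dg.
  have E1 : hn (T (a *: u + v) - j2 k) <= c * hn (u - j1 f) + hn (v - j1 g).
    rewrite hT // k1 opprD addrACA -scalerBr; apply: le_trans (hnD _ _) _.
    by rewrite hnZ.
  have E2 : hn (j2 k - (a *: T u + T v)) <= c * hn (u - j1 f) + hn (v - j1 g).
    rewrite k2 opprD addrACA -scalerBr; apply: le_trans (hnD _ _) _.
    by rewrite hnZ (hn_distC (j2 f)) (hn_distC (j2 g)) !hT.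
  apply: le_trans (hn_triangle (j2 k) _ _) _.
  have h1 : c * hn (u - j1 f) <= c * (e / (2 * (c + 1))) by rewrite ler_wpM2l // ltW.
  have h2 : (c + 1) * (e / (2 * (c + 1))) = e / 2 by field; lra.
  have h3 := ltW vg.
  by move: E1 E2 h1 h2 h3; rewrite mulrDl mul1r; lra.
- move=> u; have [f Df _] := dense 0 1 ltr01.
  have [k [Dk k1 k2]] := lin (-1) f f Df Df.
  move: k1 k2; rewrite !scaleN1r !addNr => k1 k2.
  by have := hT u k Dk; rewrite k1 k2 !subr0.
- move=> f Df; apply/eqP; rewrite -subr_eq0; apply/eqP/hn_eq0.
  by rewrite hT // subrr hn0.
Unshelve. all: by end_near. Qed.

Variables (T : E -> L) (lT : linear T) (iT : forall u, hn (T u) = hn u).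

Lemma isometry_rdot u v : rdot (T u) (T v) = rdot u v.
Proof.
have := iT (u + v); rewrite (linD lT) => /(congr1 (fun r => r ^+ 2)).
by rewrite !sqr_hnD !iT; lra.
Qed.

Lemma isometry_hdot u v : hdot (T u) (T v) = hdot u v.
Proof. by rewrite !hdotE -(linZ lT) !isometry_rdot. Qed.

Lemma isometry_cvg {X : Type} {F : set_system X} {FF : Filter F} (f : X -> E) (l : E) :
  f @ F --> l -> T (f x) @[x --> F] --> T l.
Proof. by apply: (lin_cvg lT (b := 1)) => u; rewrite iT mul1r. Qed.

Lemma isometry_continuous : continuous T.
Proof. by move=> u; exact: isometry_cvg. Qed.

End Isometries.

Section ClosedSubspaceMaps.
Context {R : realType} {E L : hilbertType R}.

Lemma closed_approx (V : set E) :
  (forall l, (forall e : R, 0 < e -> exists2 v, V v & hn (l - v) < e) -> V l) ->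
  closed V.
Proof.
move=> h l lV; apply: h => e e0.
have [|v [Vv]] := lV (ball l e%:C).
  by apply: nbhsx_ballx; rewrite ltcR.
by rewrite -ball_normE /= hnE ltcR => lv; exists v.
Qed.

Lemma dense_approx (V : set E) : closure V = setT ->
  forall u (e : R), 0 < e -> exists2 v, V v & hn (u - v) < e.
Proof.
move=> cV u e e0; have : closure V u by rewrite cV.
move=> /(_ (ball u e%:C))[|v [Vv]]; first by apply: nbhsx_ballx; rewrite ltcR.
by rewrite -ball_normE /= hnE ltcR => lv; exists v.
Qed.

Lemma csub_preimage (T : E -> L) (b : R) (V : set L) : linear T ->
  (forall u, hn (T u) <= b * hn u) ->
  closed_subspace V -> closed_subspace (T @^-1` V).
Proof.
move=> lT bT hV; split.
- apply: closed_approx => l h; apply: (csub_close hV) => e e0.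
  have B0 : 0 < `|b| + 1 by rewrite ltr_wpDl.
  have [v Vv lv] := h _ (divr_gt0 e0 B0); exists (T v) => //.
  rewrite -(linB lT); apply: le_lt_trans (bT _) _.
  move: lv; rewrite ltr_pdivlMr // mulrC; apply: le_lt_trans.
  apply: ler_wpM2r; first exact: hn_ge0.
  by apply: le_trans (ler_norm _) _; rewrite lerDl.
- by rewrite /= (lin0 lT); exact: csub0.
- by move=> a u v /= hu hv; rewrite lT; case: hV => _ _; apply.
Qed.

Lemma csub_setT : closed_subspace (setT : set E).
Proof. by split. Qed.

Lemma csub_smallest (G : set E) : closed_subspace (smallest closed_subspace G).
Proof.
split.
- apply: closed_bigI => V [hV _]; by case: hV.
- by move=> V [hV _]; exact: csub0.
- by move=> a u v hu hv V hVG; have [[_ _ Vl] _] := hVG; apply: Vl; [exact: hu|exact: hv].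
Qed.

Lemma smallest_min (G V : set E) : closed_subspace V -> G `<=` V ->
  smallest closed_subspace G `<=` V.
Proof. by move=> hV GV u; apply. Qed.

End ClosedSubspaceMaps.

(** Preimages of a convergent sequence of images form a Cauchy sequence. *)
Lemma csub_image {R : realType} {E L : hilbertType R} (T : E -> L) (V : set E) :
  linear T -> (forall u, hn (T u) = hn u) ->
  closed_subspace V -> closed_subspace (T @` V).
Proof.
move=> lT iT hV; split.
- apply: closed_approx => l h.
  have /choice[f hf] (n : nat) : exists u, V u /\ hn (l - T u) < n.+1%:R^-1.
    have [|_ [u Vu <-] lu] := h n.+1%:R^-1; first by rewrite invr_gt0.
    by exists u.
  have Tl : T (f n) @[n --> \oo] --> l.
    apply: (@cvg_hn_le _ _ _ _ _ _ _ (fun n => n.+1%:R^-1)).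
      by near=> n; rewrite hn_distC; apply: ltW; case: (hf n).
    exact: cvg_harmonic.
  have [u fu] : exists u : E, f @ \oo --> u.
    apply: hcauchy_cvg => e e0; have e2 : 0 < e / 2 by rewrite divr_gt0.
    move/cvg_hnP/cvgrPdist_lt : Tl => /(_ _ e2)[N _ hN]; exists N => n Nn.
    rewrite -iT (linB lT).
    apply: le_lt_trans (hn_triangle l _ _) _; rewrite [e]splitr.
    have h1 := hN N (leqnn N); have h2 := hN n Nn.
    move: h1 h2; rewrite /= !sub0r !normrN !ger0_norm ?hn_ge0 // => h1 h2.
    by rewrite ltrD // hn_distC.
  exists u; first by apply: (csub_cvg hV _ fu) => n; case: (hf n).
  exact: (hcvg_unique (isometry_cvg lT iT fu) Tl).
- by exists 0; [exact: csub0|rewrite (lin0 lT)].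
- move=> a _ _ [u Vu <-] [v Vv <-]; exists (a *: u + v); last exact: lT.
  by case: hV => _ _; apply.
Unshelve. all: by end_near. Qed.

(** * Differentiability of orbits *)

Section HalfLineFTC.
Context {R : realType}.
Local Notation mu := (@lebesgue_measure R).

Definition hl : set R := `]0, +oo[%classic.

Lemma mhl : measurable hl. Proof. exact: measurable_itv. Qed.

Definition rrestr (D : set R) (f : R -> R) : R -> R := fun x => if x \in D then f x else 0.

Lemma rrestrT (D : set R) f x : D x -> rrestr D f x = f x.
Proof. by move=> Dx; rewrite /rrestr mem_set. Qed.

Lemma rrestrF (D : set R) f x : ~ D x -> rrestr D f x = 0.
Proof. by move=> Dx; rewrite /rrestr memNset. Qed.

Lemma hlE x : hl x = (0 < x) :> Prop.
Proof. by rewrite /hl /= in_itv /= andbT. Qed.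

(** Dominated convergence of the integrals over [[0, n + 1]]; for the limit of
    the primitive, the integers suffice. *)
Lemma FTC_halfline (f F : R -> R) :
  continuous f -> (forall y : R, 0 < y -> is_derive y (1 : R) F (- f y)) ->
  F y @[y --> 0^'+] --> F 0 -> F n%:R @[n --> \oo] --> (0 : R) ->
  mu.-integrable setT (EFin \o rrestr hl f) ->
  (\int[mu]_x rrestr hl f x = F 0)%R.
Proof.
move=> cf dF F0 Fy intf.
have cvgF (y : R) : 0 < y -> F x @[x --> y] --> F y.
  move=> y0; have [dy _] := dF y y0.
  exact/differentiable_continuous/derivable1_diffP.
have fin n : (\int[mu]_(x in `[0%R, n.+1%:R%R]) (f x)%:E = (F 0 - F n.+1%:R)%R%:E)%E.
  have n0 : 0 < n.+1%:R :> R by rewrite ltr0n.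
  rewrite (@continuous_FTC2 _ f (fun y => - F y) 0 n.+1%:R) //.
  - by rewrite -EFinB opprK addrC.
  - by apply: continuous_subspaceT => x; exact: cf.
  - split.
    + move=> x; rewrite in_itv /= => /andP[x0 _]; apply: derivableN.
      by case: (dF x x0).
    + exact: cvgN.
    + by apply: cvgN; apply: cvg_at_left_filter; exact: cvgF.
  - move=> x; rewrite in_itv /= => /andP[x0 _]; rewrite derive1E.
    have [dx vx] := dF x x0.
    by rewrite deriveN // vx opprK.
have mf : measurable_fun setT f by exact: continuous_measurable_fun.
have mr D : measurable D -> measurable_fun setT (rrestr D f).
  move=> mD; apply: measurable_fun_ifT => //.
  by apply: (measurable_fun_bool true) => //=; rewrite setTI preimage_mem_true.
pose g n x := rrestr `]0, n.+1%:R]%classic f x.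
have gE n : (\int[mu]_x (g n x)%:E = (F 0 - F n.+1%:R)%R%:E)%E.
  rewrite -fin -(@integral_itv_obnd_cbnd _ 0 (BRight n.+1%:R)); last first.
    by apply/measurable_EFinP; exact: measurable_funTS.
  rewrite [RHS]integral_mkcond; apply: eq_integral => x _.
  by rewrite /g /rrestr /patch; case: ifP.
have c1 : (F 0 - F n.+1%:R)%:E @[n --> \oo] --> (\int[mu]_x (rrestr hl f x)%:E)%E.
  under eq_fun do rewrite -gE.
  have absf_int := integrable_abse intf.
  apply: (@dominated_cvg _ _ _ mu setT measurableT _ _ (abse \o (EFin \o rrestr hl f))) => //.
  - by move=> n; apply/measurable_EFinP; apply: mr; exact: measurable_itv.
  - move=> x _; apply: cvg_EFin; first by near=> n.
    rewrite /=; have [x0|x0] := ltP 0 x; last first.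
      apply: cvg_near_cst; near=> n; rewrite /= /g !rrestrF //.
        by rewrite hlE ltNge x0.
      by rewrite /= in_itv /= ltNge x0.
    apply: cvg_near_cst; near=> n; rewrite /= /g !rrestrT //; first by rewrite hlE.
    rewrite /= in_itv /= x0; apply: (@le_trans _ _ n%:R); last by rewrite ler_nat.
    by near: n; exact: nbhs_infty_ger.
  - move=> n x _; rewrite /= lee_fin /g.
    have [x0|x0] := pselect (`]0, n.+1%:R]%classic x); last first.
      by rewrite rrestrF // normr0.
    rewrite !rrestrT //; rewrite hlE.
    by move: x0; rewrite /= in_itv /= => /andP[].
have c2 : (F 0 - F n.+1%:R)%:E @[n --> \oo] --> (F 0)%:E.
  apply: cvg_EFin; first by near=> n.
  rewrite /= -[X in _ --> X]subr0; apply: cvgB; first exact: cvg_cst.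
  by move: Fy; rewrite -(@cvg_shiftS _ (fun n => F n%:R)).
by rewrite /Rintegral (cvg_unique _ c1 c2).
Unshelve. all: by end_near. Qed.

End HalfLineFTC.

Section Orbits.
Context {R : realType} {H : hilbertType R}.
Variables (C : R -> H -> H) (hC : hermitian_contraction_semigroup C).
Implicit Types (u v w z : H) (s t : R).
Local Notation S := (Cz C).

Lemma Cz_le0 t : t <= 0 -> S t = id.
Proof. by rewrite /Cz leNgt => /negbTE ->. Qed.

Lemma Cz_max t : S t = S (Num.max 0 t).
Proof. by rewrite /Order.max; case: ltP => // /Cz_le0 ->; rewrite Cz0. Qed.

Lemma Cz_lip u (e : R) : 0 < e ->
  exists2 d : R, 0 < d & forall s t, `|s - t| < d -> hn (S s u - S t u) < e.
Proof.
move=> e0; have [d d0 hd] := Cz_cont0 hC u e0; exists d => // s t.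
wlog st : s t / t <= s.
  move=> h; have [|/ltW] := leP t s; first exact: h.
  by move=> /h; rewrite distrC hn_distC.
rewrite (Cz_max s) (Cz_max t) => std.
have m0 x : 0 <= Num.max 0 x :> R by rewrite le_max lexx.
have mm : Num.max 0 t <= Num.max 0 s by rewrite ge_max le_max lexx /= le_max st orbT.
apply: le_lt_trans (Cz_unif hC _ (m0 t) mm) _; apply: hd.
rewrite subr_ge0 mm /=; apply: le_lt_trans std.
rewrite ger0_norm ?subr_ge0 // /Order.max; case: ltP => s0; case: ltP => t0; lra.
Qed.

Lemma Cz_continuous u : continuous (fun t => S t u).
Proof.
move=> t; apply/cvg_hnP/cvgrPdist_lt => e e0.
have [d d0 hd] := Cz_lip u e0; near=> s.
rewrite sub0r normrN ger0_norm ?hn_ge0 //; apply: hd.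
by rewrite distrC; near: s; apply: (@cvgr_dist_lt _ _ _ _ _ id t).
Unshelve. all: by end_near. Qed.

(** For [h < 0] the increment is factored through [C_(t + h)], which costs a
    term [C_k v - v] with [k = - h], small by strong continuity. *)
Lemma Cz_diff u v t (e : R) : generator C u v -> 0 < t -> 0 < e ->
  exists2 d : R, 0 < d & forall h, `|h| < d ->
    hn (S (t + h) u - S t u + h%:C *: S t v) <= `|h| * e.
Proof.
move=> /generatorP huv t0 e0; have e2 : 0 < e / 2 by rewrite divr_gt0.
have [d1 d10 h1] := huv _ e2; have [d2 d20 h2] := Cz_cont0 hC v e2.
exists (Num.min t (Num.min d1 d2)); first by rewrite !lt_min t0 d10.
move=> h; rewrite !lt_min => /and3P[ht hd1 hd2].
have [h0|h0|->] := ltgtP h 0; last first.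
- by rewrite addr0 subrr scale0r addr0 hn0 normr0 mul0r.
- move: hd1 hd2 ht; rewrite gtr0_norm // => hd1 hd2 ht.
  rewrite (Cz_add hC) ?(ltW t0) ?(ltW h0) // -(linZ (Cz_lin hC t)) -(linB (Cz_lin hC t)).
  rewrite -(linD (Cz_lin hC t)); apply: le_trans (Cz_le hC _ _) _.
  rewrite -hnN opprD opprB; apply: (@le_trans _ _ (h * (e / 2))).
    by apply: h1; rewrite h0.
  by rewrite ler_wpM2l ?(ltW h0) //; lra.
- move: hd1 hd2 ht; rewrite ltr0_norm //; set k := - h => hd1 hd2 ht.
  have k0 : 0 < k by rewrite oppr_gt0.
  have -> : h = - k by rewrite opprK.
  have tk : 0 <= t - k by rewrite subr_ge0 ltW.
  have St w : S t w = S (t - k) (S k w).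
    by rewrite -(Cz_add hC) ?(ltW k0) // subrK.
  have -> : S (t - k) u - S t u + (- k)%:C *: S t v =
      S (t - k) (u - S k u - k%:C *: v) + S (t - k) (k%:C *: (v - S k v)).
    rewrite -(linD (Cz_lin hC _)) scalerBr addrA subrK !(linB (Cz_lin hC _)).
    by rewrite (linZ (Cz_lin hC _)) -!St rmorphN scaleNr.
  apply: le_trans (hnD _ _) _.
  have b1 : hn (S (t - k) (u - S k u - k%:C *: v)) <= k * (e / 2).
    by apply: le_trans (Cz_le hC _ _) _; apply: h1; rewrite k0.
  have b2 : hn (S (t - k) (k%:C *: (v - S k v))) <= k * (e / 2).
    apply: le_trans (Cz_le hC _ _) _; rewrite hnZp ?(ltW k0) // ler_wpM2l ?(ltW k0) //.
    by rewrite hn_distC; apply/ltW/h2; rewrite (ltW k0).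
  by lra.
Qed.

Lemma Cz_derive u v z t : generator C u v -> 0 < t ->
  is_derive t (1 : R) (fun s => rdot (S s u) z) (- rdot (S t v) z).
Proof.
move=> huv t0.
have h : h^-1 *: (((fun s => rdot (S s u) z) \o shift t) (h *: (1 : R)) - rdot (S t u) z)
    @[h --> 0^'] --> - rdot (S t v) z.
  apply/cvgrPdist_le => e e0.
  have z1 : 0 < hn z + 1 by rewrite ltr_wpDl ?hn_ge0.
  have [d d0 hd] := Cz_diff huv t0 (divr_gt0 e0 z1).
  exists d => //= h hhd hn0'; move: hhd; rewrite /= sub0r normrN => hhd.
  rewrite /= -[h *: 1]/(h * 1) mulr1 -[_ *: _]/(_ * _).
  have hV : `|h^-1| * `|h| = 1 by rewrite -normrM mulVf // normr1.
  have E : - rdot (S t v) z - h^-1 * (rdot (S (h + t) u) z - rdot (S t u) z) =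
     - (h^-1 * rdot (S (t + h) u - S t u + h%:C *: S t v) z).
    by rewrite rdotDl rdotBl rdotZl (addrC h); field.
  rewrite E normrN normrM.
  apply: (@le_trans _ _ (`|h^-1| * (`|h| * (e / (hn z + 1)) * hn z))).
    apply: ler_wpM2l => //; apply: le_trans (abs_rdot_le _ _) _.
    by apply: ler_wpM2r; [exact: hn_ge0|exact: hd].
  rewrite mulrA mulrA hV mul1r mulrAC ler_pdivrMr // ler_wpM2l ?(ltW e0) //.
  by rewrite lerDl.
apply: DeriveDef; first by apply/cvg_ex; exists (- rdot (S t v) z).
by apply/cvg_lim => //; exact: norm_hausdorff.
Qed.

End Orbits.

(** * Translations, phases and the Fourier integral *)

Section Translation.
Context {R : realType}.
Local Notation mu := (@lebesgue_measure R).

Let shiftf (t : R) : measurableTypeR R -> measurableTypeR R := fun x => x - t.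
Let shift_mixin t := isMeasurableFun.Build _ _ _ _ (shiftf t) (measurable_shift t).
Let shift_mfun t : {mfun measurableTypeR R >-> measurableTypeR R} :=
  HB.pack (shiftf t) (shift_mixin t).

Lemma lebesgue_shift (t : R) (A : set R) : measurable A ->
  pushforward mu (shift_mfun t) A = mu A.
Proof.
move=> mA; apply/esym/lebesgue_measure_unique => //= _ [[a b]] _ <-.
rewrite /pushforward /=.
have -> : shiftf t @^-1` `]a, b]%classic = `]a + t, b + t]%classic.
  by apply/seteqP; split => x /=; rewrite !in_itv /= ltrBrDr lerBlDr.
rewrite !lebesgue_measure_itv /= !lte_fin ltrD2r; case: ifP => // _.
by rewrite -!EFinB; congr (_%:E); ring.
Qed.

Lemma ge0_integral_shift (t : R) (f : R -> \bar R) : measurable_fun setT f ->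
  (forall x, (0 <= f x)%E) -> (\int[mu]_x f (x - t)%R = \int[mu]_x f x)%E.
Proof.
move=> mf f0.
have := @ge0_integral_pushforward _ _ (measurableTypeR R) (measurableTypeR R) R
  _ (measurable_shift t) mu setT f measurableT mf (fun x _ => f0 x).
rewrite preimage_setT => <-.
apply: eq_measure_integral => [|mphi A mA AS].
  exact: (measurable_shift t).
exact: (lebesgue_shift t mA).
Qed.

Lemma Rintegral_shift (t : R) (f : R -> R) : measurable_fun setT f ->
  (\int[mu]_x f (x - t) = \int[mu]_x f x)%R.
Proof.
move=> mf; rewrite /Rintegral; congr fine.
have mF : measurable_fun setT (EFin \o f) by exact/measurable_EFinP.
rewrite integralE [RHS]integralE; congr (_ - _)%E.
  have h := @ge0_integral_shift t ((EFin \o f)^\+)%E (measurable_funepos mF)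
    (fun x => funepos_ge0 _ x).
  etransitivity; last exact: h.
  by apply: eq_integral => x _; rewrite !funeposE.
have h := @ge0_integral_shift t ((EFin \o f)^\-)%E (measurable_funeneg mF)
  (fun x => funeneg_ge0 _ x).
etransitivity; last exact: h.
  by apply: eq_integral => x _; rewrite !funenegE.
Qed.

End Translation.

Section Phases.
Context {R : realType} {H : hilbertType R}.
Implicit Types (u v : H) (a b : R).

Lemma cis0 : cis 0 = 1 :> R[i].
Proof. by rewrite /cis cos0 sin0. Qed.

Lemma cisD a b : cis (a + b) = cis a * cis b.
Proof.
rewrite /cis cosD sinD; apply/eqP; rewrite eq_complex /=.
by apply/andP; split; apply/eqP; ring.
Qed.

Lemma hn_cis a u : hn (cis a *: u) = hn u.
Proof. by rewrite hnZ normc_def /= cos2Dsin2 sqrtr1 mul1r. Qed.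

Lemma cisNK a : cis (- a) * cis a = 1.
Proof. by rewrite -cisD addNr cis0. Qed.

Lemma rdot_cisN a u v :
  rdot (cis (- a) *: u) v = cos a * rdot u v + sin a * rdot u ('i%C *: v).
Proof.
rewrite /rdot hdotZl hdotZr /cis cosN sinN.
by case: (hdot u v) => x y /=; ring.
Qed.

Lemma cvg_realZ (cs : nat -> R) (c : R) (ws : nat -> H) (w : H) :
  cs @ \oo --> c -> ws @ \oo --> w -> (cs n)%:C *: ws n @[n --> \oo] --> c%:C *: w.
Proof.
move=> hc hw.
apply: (@cvg_hn_le _ _ _ _ _ _ _ (fun n => `|cs n| * hn (ws n - w) + `|cs n - c| * hn w)).
  near=> n; have -> : (cs n)%:C *: ws n - c%:C *: w =
      (cs n)%:C *: (ws n - w) + (cs n - c)%:C *: w.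
    by rewrite scalerBr rmorphB scalerBl addrA subrK.
  by apply: le_trans (hnD _ _) _; rewrite !hnZr.
rewrite -(addr0 (0 : R)); apply: cvgD.
  rewrite -(mulr0 `|c|); apply: cvgM; first exact: cvg_norm.
  exact/cvg_hnP.
rewrite -(mul0r (hn w)); apply: cvgM; last exact: cvg_cst.
rewrite -(normr0 R) -(subrr c); apply: cvg_norm.
by apply: cvgB => //; exact: cvg_cst.
Unshelve. all: by end_near. Qed.

Lemma cvg_cis (as_ : nat -> R) (a : R) (us : nat -> H) (u : H) : as_ @ \oo --> a ->
  us @ \oo --> u -> cis (as_ n) *: us n @[n --> \oo] --> cis a *: u.
Proof.
move=> ha hu.
have E b w : cis b *: w = (cos b)%:C *: w + (sin b)%:C *: ('i%C *: w) :> H.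
  rewrite scalerA -scalerDl; congr (_ *: _); apply/eqP; rewrite eq_complex /=.
  by rewrite !(mul0r, mulr0, mulr1, subr0, addr0, add0r) !eqxx.
under eq_fun do rewrite E; rewrite E; apply: cvgD; apply: cvg_realZ.
- by apply: (cvg_comp _ (cos : R -> R) ha); exact: continuous_cos.
- exact: hu.
- by apply: (cvg_comp _ (sin : R -> R) ha); exact: continuous_sin.
- exact: cvgZr.
Qed.

Lemma sm_modulation (t : R) (f : R -> H) : strongly_measurable f ->
  strongly_measurable (modulation t f).
Proof.
apply: (sm_op (G := fun x v => cis (- (t * x)) *: v)) => x xs vs v _ hx hv.
by apply: cvg_cis => //; apply: cvgN; apply: cvgMr.
Qed.

Lemma sqint_modulation t (f : R -> H) : sqint (modulation t f) = sqint f.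
Proof. by apply: sqint_eq => x; rewrite hn_cis. Qed.

Lemma L2_modulation t (f : R -> H) : L2 f -> L2 (modulation t f).
Proof.
move=> /L2P[sf i]; apply/L2P; split; first exact: sm_modulation.
by rewrite sqint_modulation.
Qed.

Lemma sqint_shift t (f : R -> H) : strongly_measurable f ->
  sqint (fun x => f (x - t)) = sqint f.
Proof.
move=> sf; rewrite /sqint.
exact: (ge0_integral_shift t (meas_hn2 sf) (fun x => sqr_ge0 (hn (f x)))).
Qed.

Lemma L2_shift t (f : R -> H) : L2 f -> L2 (fun x => f (x - t)).
Proof.
move=> /L2P[sf i]; apply/L2P; split; first exact: sm_shift.
by rewrite sqint_shift.
Qed.

End Phases.

Section FourierShift.
Context {R : realType} {H : hilbertType R}.
Implicit Types (f : R -> H).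
Local Notation mu := (@lebesgue_measure R).

Lemma L1P f : L1fun f <->
  strongly_measurable f /\ (\int[mu]_x (hn (f x))%:E < +oo)%E.
Proof. by []. Qed.

Lemma L1_shift t f : L1fun f -> L1fun (fun x => f (x - t)).
Proof.
move=> /L1P[sf i]; apply/L1P; split; first exact: sm_shift.
have m : measurable_fun setT (EFin \o (fun x => hn (f x))).
  by apply/measurable_EFinP; exact: meas_hn.
have := ge0_integral_shift t m (fun x => hn_ge0 (f x)).
by rewrite /= => ->.
Qed.

Definition fphase (f : R -> H) (xi : R) (v : H) (x : R) : R :=
  rdot (cis (- (xi * x)) *: f x) v.

Lemma meas_fphase f xi v : strongly_measurable f -> measurable_fun setT (fphase f xi v).
Proof. by move=> sf; apply: meas_rdot; [exact: sm_modulation|exact: sm_cst]. Qed.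

Lemma integrable_fphase f xi v : L1fun f -> mu.-integrable setT (EFin \o fphase f xi v).
Proof.
move=> /L1P[sf i]; apply/integrableP; split.
  by apply/measurable_EFinP; exact: meas_fphase.
apply: (@le_lt_trans _ _ (\int[mu]_x ((hn v)%:E * (hn (f x))%:E))%E).
  apply: ge0_le_integral => //.
  - apply/measurable_EFinP; apply: measurableT_comp => //; exact: meas_fphase.
  - by apply/measurable_EFinP; apply: measurable_funM => //; exact: meas_hn.
  - move=> x _; rewrite /= lee_fin mulrC; apply: le_trans (abs_rdot_le _ _) _.
    by rewrite hn_cis.
rewrite ge0_integralZl_EFin ?hn_ge0 //.
- by rewrite lte_mul_pinfty // lee_fin hn_ge0.
- by move=> x _; rewrite lee_fin hn_ge0.
- by apply/measurable_EFinP; exact: meas_hn.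
Qed.

Lemma cintegral_fphase f xi v : cintegral (fun x => cis (- (xi * x)) * hdot (f x) v) =
  (\int[mu]_x fphase f xi v x) +i* (\int[mu]_x fphase f xi ('i%C *: v) x).
Proof.
rewrite /cintegral; congr (_ +i* _); apply: eq_Rintegral => x _ /=;
  by rewrite -hdotZl ?hdotE.
Qed.

(** Splitting the phase into cosine and sine reduces this to the translation
    invariance of real integrals. *)
Lemma cintegral_shift f xi t v : L1fun f ->
  cintegral (fun x => cis (- (xi * x)) * hdot (f (x - t)) v) =
  cis (- (xi * t)) * cintegral (fun x => cis (- (xi * x)) * hdot (f x) v).
Proof.
move=> hf; have [sf _] := (L1P f).1 hf.
rewrite (cintegral_fphase (fun x => f (x - t))) cintegral_fphase.
have E w : (\int[mu]_x fphase (fun x => f (x - t)) xi w x =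
    cos (xi * t) * \int[mu]_x fphase f xi w x +
    sin (xi * t) * \int[mu]_x fphase f xi ('i%C *: w) x)%R.
  rewrite -!RintegralZl //; try exact: integrable_fphase.
  rewrite -RintegralD //; last 2 first.
  - by have := integrableZl measurableT (cos (xi * t)) (integrable_fphase xi w hf).
  - by have := integrableZl measurableT (sin (xi * t)) (integrable_fphase xi ('i%C *: w) hf).
  pose g x := cos (xi * t) * fphase f xi w x + sin (xi * t) * fphase f xi ('i%C *: w) x.
  have mg : measurable_fun setT g.
    by apply: measurable_funD; apply: measurable_funM => //; exact: meas_fphase.
  rewrite -[RHS](Rintegral_shift t mg); apply: eq_Rintegral => x _.
  rewrite /g /fphase -rdot_cisN scalerA -cisD; congr (rdot (cis _ *: _) _); ring.
rewrite !E /cis cosN sinN; apply/eqP; rewrite eq_complex /=.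
have -> : (\int[mu]_x fphase f xi ('i%C *: ('i%C *: v)) x =
   - \int[mu]_x fphase f xi v x)%R.
  rewrite -mulN1r -RintegralZl //; last exact: integrable_fphase.
  apply: eq_Rintegral => x _; rewrite /fphase scalerA -expr2 sqr_i scaleN1r rdotNr; ring.
by apply/andP; split; apply/eqP; ring.
Qed.

Definition fourier_set f xi : set H := [set h | forall v,
  hdot h v = ((Num.sqrt (2 * pi))^-1)%:C *
             cintegral (fun x => cis (- (xi * x)) * hdot (f x) v)].

Lemma fourier_unique f xi h : fourier_set f xi h -> fourier_fun f xi = h.
Proof.
move=> hh; have : fourier_set f xi (fourier_fun f xi).
  by apply: (xgetPex 0 (P := fourier_set f xi)); exists h.
by move=> h'; apply: hdot_inj => w; rewrite hh h'.
Qed.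

(** Translation carries the solutions of the weak equation that defines
    [fourier_fun] to each other, so it also preserves their nonexistence. *)
Lemma fourier_shift f t xi : L1fun f ->
  fourier_fun (fun x => f (x - t)) xi = modulation t (fourier_fun f) xi.
Proof.
move=> hf; rewrite /modulation mulrC.
have E h : fourier_set f xi h ->
    fourier_set (fun x => f (x - t)) xi (cis (- (xi * t)) *: h).
  by move=> hh v; rewrite hdotZl hh cintegral_shift // mulrCA.
have E' h : fourier_set (fun x => f (x - t)) xi h ->
    fourier_set f xi (cis (xi * t) *: h).
  move=> hh v; rewrite hdotZl hh cintegral_shift // mulrCA; congr (_ * _).
  by rewrite mulrA (mulrC (cis _)) cisNK mul1r.
have [[h hh]|no] := pselect (exists h, fourier_set f xi h).
  by rewrite (fourier_unique hh) (fourier_unique (E _ hh)).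
have no' g : (~ exists h, fourier_set g xi h) -> fourier_fun g xi = 0.
  move=> ng; rewrite /fourier_fun; case: xgetP => // y _ hy.
  by exfalso; apply: ng; exists y.
rewrite (no' f) // no' ?scaler0 // => -[h hh].
by apply: no; exists (cis (xi * t) *: h); exact: E'.
Qed.

End FourierShift.

(** * Fourier transforms of orbits *)

Section OrbitTransform.
Context {R : realType} {H : hilbertType R}.
Variables (C : R -> H -> H) (hC : hermitian_contraction_semigroup C).
Variables (J rJ rK : H -> H).
Hypothesis hA : sqrt_calculus (generator C) J rJ rK.
Implicit Types (u v w z : H) (s t y : R).
Local Notation K := (cK J).
Local Notation P := (sqA rJ rK).
Local Notation S := (Cz C).
Local Notation mu := (@lebesgue_measure R).

Definition sgorbit w : R -> H := restr hl (fun y => S y w).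

Lemma Cz_cvg (ts : nat -> R) t (us : nat -> H) u : ts @ \oo --> t -> us @ \oo --> u ->
  S (ts n) (us n) @[n --> \oo] --> S t u.
Proof.
move=> ht hu.
have h1 : S (ts n) u @[n --> \oo] --> S t u.
  by apply: (cvg_comp _ (fun t => S t u) ht); exact: (Cz_continuous hC).
apply: (@cvg_hn_le _ _ _ _ _ _ _ (fun n => hn (us n - u) + hn (S (ts n) u - S t u))).
  near=> n; apply: le_trans (hn_triangle (S (ts n) u) _ _) _.
  by rewrite lerD2r -(linB (Cz_lin hC _)) Cz_le.
by rewrite -(addr0 (0 : R)); apply: cvgD; exact/cvg_hnP.
Unshelve. all: by end_near. Qed.

Lemma orbit_sm w : strongly_measurable (sgorbit w).
Proof.
apply: sm_restr; first exact: mhl.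
apply: (sm_op (G := fun y v => S y v)) (sm_cst w) => x xs vs v _; exact: Cz_cvg.
Qed.

(** [5 = 1 + 4], from the bounds by [|z|] and by [4 |z| / y^2]. *)
Lemma orbit_bound z y : 0 < y -> hn (S y (K (K z))) <= 5 * hn z * (oneDsqr y)^-1.
Proof.
move=> y0; have h1 := Cz_KK_le hC hA z y0.
have h2 : hn (S y (K (K z))) <= hn z.
  by apply: le_trans (Cz_le hC _ _) _; apply: le_trans (cK_le hA _) (cK_le hA _).
rewrite ler_pdivlMr; last by apply: lt_le_trans ltr01 _; exact: oneDsqr_ge1.
by rewrite /oneDsqr mulrDr mulr1 [X in _ + X]mulrC; lra.
Qed.

Lemma int_oneDsqr (c : R) : 0 <= c ->
  (\int[mu]_x (rrestr hl (fun y => c * (oneDsqr y)^-1) x)%:E < +oo)%E.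
Proof.
move=> c0.
have mo : measurable_fun setT (EFin \o (fun y : R => (oneDsqr y)^-1)).
  by apply/measurable_EFinP; apply: continuous_measurable_fun; exact: continuous_oneDsqrV.
have -> : (\int[mu]_x (rrestr hl (fun y => c * (oneDsqr y)^-1) x)%:E =
   \int[mu]_(x in hl) (c%:E * ((oneDsqr x)^-1)%:E))%E.
  rewrite [RHS]integral_mkcond; apply: eq_integral => x _.
  by rewrite /rrestr /patch; case: ifP.
have p0 (x : R) : hl x -> (0 <= ((oneDsqr x)^-1)%:E)%E.
  by move=> _; rewrite lee_fin invr_ge0 (le_trans ler01) // oneDsqr_ge1.
rewrite (@ge0_integralZl_EFin _ _ _ mu hl (@mhl R) _ p0 (measurable_funTS mo) c c0).
rewrite /hl integral_itv_obnd_cbnd; last exact: measurable_funTS.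
by rewrite integral0y_oneDsqr -EFinM ltry.
Qed.

Lemma meas_oneDsqr (c : R) :
  measurable_fun setT (EFin \o rrestr hl (fun y => c * (oneDsqr y)^-1)).
Proof.
apply/measurable_EFinP; apply: measurable_fun_ifT => //.
  by apply: (measurable_fun_bool true) => //=; rewrite setTI preimage_mem_true; exact: mhl.
by apply: measurable_funM => //; apply: continuous_measurable_fun; exact: continuous_oneDsqrV.
Qed.

Lemma orbit_L1 z : L1fun (sgorbit (K (K z))).
Proof.
apply/L1P; split; first exact: orbit_sm.
have c0 : 0 <= 5 * hn z by rewrite mulr_ge0 ?hn_ge0.
apply: le_lt_trans (int_oneDsqr c0).
apply: ge0_le_integral => //.
- by move=> x _; rewrite lee_fin hn_ge0.
- by apply/measurable_EFinP; apply: meas_hn; exact: orbit_sm.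
- exact: meas_oneDsqr.
move=> x _; rewrite lee_fin /sgorbit; have [x0|x0] := pselect (hl x).
  by rewrite restrT // rrestrT //; apply: orbit_bound; rewrite -hlE.
by rewrite restrF // rrestrF // hn0.
Qed.

Lemma orbit_L2 z : L2 (sgorbit (K (K z))).
Proof.
apply/L2P; split; first exact: orbit_sm.
apply: le_lt_trans (int_oneDsqr (sqr_ge0 (5 * hn z))).
apply: ge0_le_integral => //.
- by move=> x _; rewrite lee_fin sqr_ge0.
- exact: (meas_hn2 (orbit_sm _)).
- exact: meas_oneDsqr.
move=> x _; rewrite lee_fin /sgorbit; have [x0|x0] := pselect (hl x); last first.
  by rewrite restrF // rrestrF // hn0 expr0n.
rewrite restrT // rrestrT //; have {}x0 : 0 < x by rewrite -hlE.
have o1 : 0 <= (oneDsqr x)^-1 by rewrite invr_ge0 (le_trans ler01) // oneDsqr_ge1.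
apply: (@le_trans _ _ ((5 * hn z * (oneDsqr x)^-1) ^+ 2)).
  rewrite ler_sqr ?nnegrE ?hn_ge0 ?mulr_ge0 ?hn_ge0 //; exact: orbit_bound.
rewrite exprMn; apply: ler_wpM2l; first exact: sqr_ge0.
by rewrite expr2 ler_piMr //; exact: oneDsqrV_le1.
Qed.

Lemma orbit_cvg0 z : S n%:R (K (K z)) @[n --> \oo] --> (0 : H).
Proof.
apply: (@cvg_hn_le _ _ _ _ _ _ _ (fun n => 10 * hn z * n.+1%:R^-1)); last first.
  by rewrite -(mulr0 (10 * hn z)); apply: cvgMr; exact: cvg_harmonic.
near=> n; rewrite subr0.
have n0 : 0 < n%:R :> R by rewrite ltr0n; near: n; exact: nbhs_infty_gt.
(* [(1 + n^2)^-1 <= 2 / (n + 1)] *)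
apply: le_trans (orbit_bound z n0) _.
have -> : 10 * hn z = 5 * hn z * 2 by ring.
rewrite -(mulrA (5 * hn z) 2); apply: ler_wpM2l; first by rewrite mulr_ge0 ?hn_ge0.
have o0 : 0 < oneDsqr n%:R :> R by apply: lt_le_trans ltr01 _; exact: oneDsqr_ge1.
rewrite ler_pdivlMr ?ltr0n // mulrC ler_pdivrMr // /oneDsqr -natr1.
by have := sqr_ge0 (n%:R - 1 : R); have := sqr_ge0 (n%:R : R); nra.
Unshelve. all: by end_near. Qed.

(** Energy identity [d/dy |C_y v|^2 = - 2 |C_y A^(1/2) v|^2], integrated for
    [v = J (K (K z))], where [A^(1/2) v = P (K (K z))]. *)
Lemma orbit_energy z : sqint (sgorbit (P (K (K z)))) = (2^-1 * hn (J (K (K z))) ^+ 2)%:E.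
Proof.
set a := K (K z).
have PK u : P (K u) = K (P u) by rewrite /sqA -(cK_rK hA) (cK_rJ hA).
have Pa : P a = K (K (P z)) by rewrite /a !PK.
have L2w : L2 (sgorbit (P a)) by rewrite Pa; exact: orbit_L2.
have [sw iw] := (L2P _).1 L2w.
pose f y := hn (S y (P a)) ^+ 2.
pose F y := 2^-1 * rdot (S (2 * y) (J a)) (J a).
have E : (fun x => hn (sgorbit (P a) x) ^+ 2) = rrestr hl f.
  apply/funext => x; rewrite /sgorbit; have [x0|x0] := pselect (hl x).
    by rewrite restrT // rrestrT.
  by rewrite restrF // rrestrF // hn0 expr0n.
have intf : mu.-integrable setT (EFin \o rrestr hl f).
  rewrite -E; apply/integrableP; split; first exact: (meas_hn2 sw).
  by under eq_integral do rewrite /= ger0_norm ?sqr_ge0 //.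
have fE y : 0 < y -> f y = rdot (S (2 * y) (K a)) (J a).
  move=> y0; have y2 : y = (2 * y) / 2 by field.
  have y20 : 0 <= 2 * y by rewrite mulr_ge0 // ltW.
  rewrite /f {1}y2 (sqr_Cz hC) (Cz_sqA hC hA) // (sqA_sym hA) (sqA2 hA).
  by rewrite -(cK_sym hA) -(Cz_K hC hA).
have cF : continuous F.
  move=> y; apply: cvgMr; apply: cvg_rdot; last exact: cvg_cst.
  apply: (cvg_comp _ (fun t => S t (J a))); last exact: (Cz_continuous hC).
  by apply: cvgMr; exact: cvg_id.
have := @FTC_halfline R f F _ _ _ _ intf.
have F0 : F 0 = 2^-1 * hn (J a) ^+ 2 by rewrite /F mulr0 Cz0 rdotE.
rewrite F0 => h.
have <- : ((\int[mu]_x rrestr hl f x)%R)%:E = sqint (sgorbit (P a)).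
  rewrite /Rintegral fineK.
    by apply: eq_integral => x _; rewrite -E.
  exact: integrable_fin_num.
congr (_%:E); apply: h.
- move=> y; have -> : f = fun y => hn (S y (P a)) * hn (S y (P a)).
    by apply/funext => x; rewrite /f expr2.
  by apply: cvgM; apply: cvg_hn; exact: (Cz_continuous hC).
- move=> y y0; rewrite fE //.
  have y20 : 0 < 2 * y by rewrite mulr_gt0.
  have d1 := Cz_derive hC (J a) (@generator_J _ _ _ _ _ _ hA a) y20.
  have d2 : is_derive y (1 : R) (fun x : R => 2 * x) 2.
    have := @is_deriveZ _ _ _ (id : R -> R) 2 y 1 1 (is_derive_id y 1).
    by rewrite -[2 *: 1]/(2 * 1) mulr1.
  have d3 := @is_derive1_comp _ (fun s => rdot (S s (J a)) (J a)) (fun x : R => 2 * x) y _ _ d1 d2.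
  have d4 := @is_deriveZ _ _ _ _ (2^-1 : R) y 1 _ d3.
  apply: is_derive_eq d4 _.
  rewrite -[_ *: _]/(_ * _); by field.
- by rewrite -F0; apply: cvg_at_right_filter; exact: cF.
- have JKK : J a = K (K (J z)) by rewrite /a !(J_cK hA).
  have -> : (fun n : nat => F n%:R) =
      (fun n => 2^-1 * (hn (S n%:R (K (K (J z)))) * hn (S n%:R (K (K (J z)))))).
    apply/funext => n; rewrite /F -(sqr_Cz hC) -JKK -expr2.
    by have -> : 2 * n%:R / 2 = n%:R :> R by field.
  rewrite -(mulr0 (2^-1 : R)); apply: cvgMr.
  rewrite -(mulr0 (0 : R)) -(@hn0 R H); apply: cvgM; apply: cvg_hn; exact: orbit_cvg0.
Qed.

Lemma phase_continuous (xi : R) u v :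
  continuous (fun y => rdot (cis (- (xi * y)) *: S y u) v).
Proof.
have -> : (fun y => rdot (cis (- (xi * y)) *: S y u) v) = (fun y =>
    cos (xi * y) * rdot (S y u) v + sin (xi * y) * rdot (S y u) ('i%C *: v)).
  by apply/funext => y; rewrite rdot_cisN.
have cS w : continuous (fun y => rdot (S y u) w).
  by move=> y; apply: cvg_rdot; [exact: (Cz_continuous hC)|exact: cvg_cst].
have cx y : xi * x @[x --> y] --> xi * y by apply: cvgMr; exact: cvg_id.
move=> y; apply: cvgD; apply: cvgM; try exact: cS.
- by apply: (cvg_comp _ (cos : R -> R) (cx y)); exact: continuous_cos.
- by apply: (cvg_comp _ (sin : R -> R) (cx y)); exact: continuous_sin.
Qed.

Lemma phase_derive (xi : R) b v y : 0 < y ->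
  is_derive y (1 : R) (fun y => rdot (cis (- (xi * y)) *: S y (J b)) v)
    (- rdot (cis (- (xi * y)) *: S y (nres J xi b)) v).
Proof.
move=> y0.
pose p w x := rdot (S x (J b)) w.
have dp w : is_derive y (1 : R) (p w) (- rdot (S y (K b)) w).
  exact: (Cz_derive hC w (@generator_J _ _ _ _ _ _ hA b) y0).
have dx : is_derive y (1 : R) (fun x : R => xi * x) xi.
  have := @is_deriveZ _ _ _ (id : R -> R) xi y 1 1 (is_derive_id y 1).
  by rewrite -[xi *: 1]/(xi * 1) mulr1.
have dc : is_derive y (1 : R) (fun x => cos (xi * x)) (- sin (xi * y) * xi).
  exact: (@is_derive1_comp _ _ (fun x : R => xi * x) y _ _ (is_derive_cos _) dx).
have ds : is_derive y (1 : R) (fun x => sin (xi * x)) (cos (xi * y) * xi).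
  exact: (@is_derive1_comp _ _ (fun x : R => xi * x) y _ _ (is_derive_sin _) dx).
have d1 := is_deriveM dc (dp v).
have d2 := is_deriveM ds (dp ('i%C *: v)).
have -> : (fun y => rdot (cis (- (xi * y)) *: S y (J b)) v) =
    ((fun x => cos (xi * x)) * p v + (fun x => sin (xi * x)) * p ('i%C *: v))%R.
  by apply/funext => x; rewrite rdot_cisN.
apply: is_derive_eq (is_deriveD d1 d2) _.
rewrite !rdot_cisN nresE (linD (Cz_lin hC _)) !rdotDl !(linZ (Cz_lin hC _)) !rdotZl.
rewrite !rdotiC scalerA -expr2 sqr_i scaleN1r rdotNr /p.
rewrite -[cos _ *: _]/(_ * _) -[rdot _ v *: _]/(_ * _).
rewrite -[sin _ *: _]/(_ * _) -[rdot _ _ *: _]/(_ * _); ring.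
Qed.

(** With [w = (A + i xi) g], the integrand [e^(- i xi y) C_y w] is the derivative
    of [- e^(- i xi y) C_y g], and the integral over the half-line is [g]. *)
Lemma orbit_laplace z xi v : xi != 0 ->
  (\int[mu]_x fphase (sgorbit (K (K z))) xi v x = rdot (J (ninv J xi (K (K z)))) v)%R.
Proof.
move=> xi0; set w := K (K z); set b := ninv J xi w.
have bw : nres J xi b = w by apply: (ninvK hA).
pose f y := rdot (cis (- (xi * y)) *: S y w) v.
pose F y := rdot (cis (- (xi * y)) *: S y (J b)) v.
have E : fphase (sgorbit w) xi v = rrestr hl f.
  apply/funext => x; rewrite /fphase /sgorbit; have [x0|x0] := pselect (hl x).
    by rewrite restrT // rrestrT.
  by rewrite restrF // rrestrF // scaler0 rdot0l.
have intf : mu.-integrable setT (EFin \o rrestr hl f).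
  by rewrite -E; apply: integrable_fphase; exact: orbit_L1.
have F0 : F 0 = rdot (J b) v by rewrite /F mulr0 oppr0 cis0 scale1r Cz0.
rewrite E -F0; apply: FTC_halfline intf.
- exact: phase_continuous.
- by move=> y y0; rewrite /f -bw; exact: phase_derive.
- by apply: cvg_at_right_filter; exact: phase_continuous.
apply/cvgrPdist_le => e e0.
have CJ t : 0 <= t -> forall u, S t (J u) = J (S t u) by move=> t0 u; exact: (Cz_J hC hA).
have lim : 2 / nlow xi * hn (S n%:R w) * hn v @[n --> \oo] --> (0 : R).
  rewrite -(mul0r (hn v)); apply: cvgMl; rewrite -(mulr0 (2 / nlow xi)); apply: cvgMr.
  by rewrite -(@hn0 R H); apply: cvg_hn; exact: orbit_cvg0.
move/cvgrPdist_le : lim => /(_ _ e0); apply: filterS => n.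
rewrite !sub0r !normrN; apply: le_trans.
apply: le_trans (abs_rdot_le _ _) _; rewrite hn_cis.
rewrite ger0_norm; last first.
  by rewrite !mulr_ge0 ?hn_ge0 ?invr_ge0 ?(ltW (nlow_gt0 xi0)).
apply: ler_wpM2r; first exact: hn_ge0.
rewrite (Cz_J hC hA) // (ninv_comm hA xi0 (Cz_lin hC _) (CJ _ _)) //.
by apply: le_trans (J_le hA _) _; exact: (ninv_le hA).
Qed.

Lemma orbit_fourier z xi : xi != 0 -> fourier_fun (sgorbit (K (K z))) xi =
  ((Num.sqrt (2 * pi))^-1)%:C *: J (ninv J xi (K (K z))).
Proof.
move=> xi0; apply: fourier_unique => v.
by rewrite cintegral_fphase !orbit_laplace // -hdotE hdotZl.
Qed.

End OrbitTransform.

(** * The space of classes of square integrable functions *)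

Section NullSets.
Context {R : realType} {H : hilbertType R}.
Local Notation mu := (@lebesgue_measure R).
Implicit Types (f g : R -> H).

(** [g] is measurable because it differs from [f] at one point; this is what
    allows arbitrary operator values at [x = 0]. *)
Lemma integral_eq_off (c : R) (f g : R -> R) : measurable_fun setT f ->
  (forall x, x != c -> g x = f x) ->
  (\int[mu]_x (g x)%:E = \int[mu]_x (f x)%:E)%E.
Proof.
move=> mf gf.
have gE : g = fun x => if x \in [set c] then g c else f x.
  apply/funext => x; have [->|xc] := eqVneq x c; first by rewrite mem_set.
  by rewrite memNset ?gf //; exact/eqP.
have mg : measurable_fun setT g.
  rewrite gE; apply: measurable_fun_ifT => //.
  by apply: (measurable_fun_bool true) => //=; rewrite setTI preimage_mem_true.
apply: ae_eq_integral => //; [exact/measurable_EFinP|exact/measurable_EFinP|].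
exists [set c]; split => //; first exact: lebesgue_measure_set1.
move=> x /= hx; apply/eqP; apply: contraT => /gf e.
by exfalso; apply: hx => _; rewrite e.
Qed.

Lemma L2_eq_off (c : R) f g : strongly_measurable f -> L2 g ->
  (forall x, x != c -> f x = g x) -> L2 f.
Proof.
move=> sf /L2P[sg ig] fg; apply/L2P; split => //.
rewrite /sqint (@integral_eq_off c (fun x => hn (g x) ^+ 2)) //.
  by apply: measurable_funX; exact: meas_hn.
by move=> x /fg ->.
Qed.

End NullSets.

Section L2SpaceDensity.
Context {R : realType} {H L : hilbertType R}.
Variables (jL : (R -> H) -> L) (hL : L2space jL).
Implicit Types (f g : R -> H).

Let hj : L2map (fun _ => id) jL. Proof. by case: hL. Qed.

Lemma jL_surj (l : L) : exists2 f, L2 f & jL f = l.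
Proof.
have [_ e] := hL; have : (jL @` L2fun (fun=> id)) l by rewrite e.
by move=> [f hf <-]; exists f.
Qed.

Lemma full_density (V : set L) (W : set H) : closed_subspace V ->
  (forall u (e : R), 0 < e -> exists2 w, W w & hn (u - w) < e) ->
  (forall a b w, a < b -> W w -> V (jL (restr `]a, b]%classic (cst w)))) ->
  forall l, V l.
Proof.
move=> hV dW VW l; have [f hf <-] := jL_surj l.
have [sf _] := (L2P f).1 hf.
pose D n : set R := `[- n%:R, +oo[%classic.
have mD n : measurable (D n) by exact: measurable_itv.
have VD n : V (jL (restr (D n) f)).
  apply: (step_density hj hV dW (c := - n%:R)).
  - by move=> a b w _; exact: VW.
  - exact: L2_restr.
  - by move=> x xn; rewrite restrF // /D /= in_itv /= andbT => /(lt_le_trans xn); rewrite ltxx.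
apply: (csub_cvg hV VD); apply: (jL_dominated hj _ sf hf (c := 1)).
- by move=> n; exact: sm_restr.
- move=> n x; rewrite mul1r; have [Dx|Dx] := pselect (D n x); first by rewrite restrT.
  by rewrite restrF // hn0 hn_ge0.
move=> x; apply: cvg_near_cst; near=> n; rewrite restrT // /D /= in_itv /= andbT.
rewrite lerNl; apply: le_trans (ler_norm _) _; rewrite normrN.
by near: n; exact: nbhs_infty_ger.
Unshelve. all: by end_near. Qed.

Lemma csub_set0 : closed_subspace [set 0 : L].
Proof.
split => //.
- apply: closed_approx => l h; apply: hn_near_eq0 => e /h [_ ->].
  by rewrite subr0 => /ltW.
- by move=> a u v -> ->; rewrite scaler0 addr0.
Qed.

(** Restriction to the negative half-line is a contraction, so its kernel is
    closed. *)
Lemma csub_halfline : closed_subspace (L2halfline jL).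
Proof.
pose N : set R := `]-oo, 0[%classic.
have mN : measurable N by exact: measurable_itv.
have mNC : measurable (~` N) by exact: measurableC.
have NE x : N x <-> x < 0 by rewrite /N /= in_itv.
split.
- apply: closed_approx => l h; have [f hf fl] := jL_surj l.
  have LN := L2_restr mN hf; have LC := L2_restr mNC hf.
  have z : jL (restr N f) = 0.
    apply: hn_near_eq0 => e /h [_ [g [hg g0] <-]] lg; apply: le_trans (ltW lg).
    rewrite -fl -(jL_B hj) //.
    have LB := L2_B hf hg.
    have -> : restr N f = restr N (fun x => f x - g x).
      apply/funext => x; have [Nx|Nx] := pselect (N x); last by rewrite !restrF.
      by rewrite !restrT // (g0 x) ?subr0 //; exact/NE.
    have LR := L2_restr mN LB.
    rewrite -(@ler_pXn2r _ 2) ?nnegrE ?hn_ge0 // -lee_fin -!(sqint_fin hj) //.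
    have [s1 _] := (L2P _).1 LR; have [s2 _] := (L2P _).1 LB.
    have := @sqint_le _ _ 1 _ _ s1 s2; rewrite expr1n mul1e; apply => x.
    rewrite mul1r; have [Nx|Nx] := pselect (N x); first by rewrite restrT.
    by rewrite restrF // hn0 hn_ge0.
  exists (restr (~` N) f).
    split => // y y0; rewrite restrF // => h'; apply: h'; exact/NE.
  rewrite -fl -[LHS]add0r -z -(jL_D hj) //; congr jL; apply/funext => x.
  have [Nx|Nx] := pselect (N x).
    by rewrite restrT // restrF ?addr0 // => /(_ Nx).
  by rewrite restrF // restrT ?add0r.
- by exists (fun=> 0); [split => //; exact: L2_0|exact: (jL_0 hj)].
- move=> a _ _ [f [hf f0] <-] [g [hg g0] <-].
  exists (fun x => a *: f x + g x); last exact: (jL_lin hj).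
  split; first exact: L2_lin.
  by move=> y y0; rewrite f0 // g0 // scaler0 addr0.
Qed.

(** Translations and modulations are given on functions only; as isometries
    they descend to classes. *)
Lemma L2_operator (phi : (R -> H) -> (R -> H)) :
  (forall f, L2 f -> L2 (phi f)) ->
  (forall a f g x, phi (fun y => a *: f y + g y) x = a *: phi f x + phi g x) ->
  (forall f, L2 f -> sqint (phi f) = sqint f) ->
  exists T : L -> L, [/\ linear T, forall u, hn (T u) = hn u &
    forall f, L2 f -> T (jL f) = jL (phi f)].
Proof.
move=> pL plin pn; apply: (isometric_extension (D := L2) (j2 := jL \o phi)).
- move=> u e e0; have [f hf <-] := jL_surj u; exists f => //.
  by rewrite subrr hn0.
- move=> a f g hf hg; exists (fun y => a *: f y + g y); split.
  + exact: L2_lin.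
  + exact: (jL_lin hj).
  + rewrite /= -(jL_lin hj); [|exact: pL|exact: pL].
    by congr jL; apply/funext => x; rewrite plin.
- move=> f hf; apply/eqP; rewrite -(@eqrXn2 _ 2) ?hn_ge0 //.
  by rewrite /= !(jL_norm hj) ?pn //; exact: pL.
Qed.

End L2SpaceDensity.

(** * The realization *)

Section Realization.
Context {R : realType} {H : hilbertType R}.
Variables (C : R -> H -> H) (hC : hermitian_contraction_semigroup C).
Variables (J rJ rK : H -> H).
Hypothesis hA : sqrt_calculus (generator C) J rJ rK.
Variables (E : hilbertType R) (jE : (R -> H) -> E).
Hypothesis hE : L2completion (Qweight (generator C)) jE.
Variables (L : hilbertType R) (jL : (R -> H) -> L) (hL : L2space jL).
Implicit Types (u v w z : H) (s t y x : R) (f g : R -> H).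
Local Notation mu := (@lebesgue_measure R).
Local Notation K := (cK J).
Local Notation P := (sqA rJ rK).
Local Notation S := (Cz C).
Local Notation A := (generator C).
Local Notation L2Q := (L2fun (Qweight (generator C))).

Let hj : L2map (fun _ => id) jL. Proof. by case: hL. Qed.
Let lP : linear P := sqA_lin hA.

(** [Tfun] with value [0] at the point [x = 0], where [(A + i x)^-1] may be
    unbounded; this makes it linear in [f] and measurable. *)
Definition T0 f x : H :=
  if x == 0 then 0 else ((Num.sqrt pi)^-1)%:C *: P (ninv J x (f x)).

Lemma T0E f x : x != 0 -> T0 f x = ((Num.sqrt pi)^-1)%:C *: P (ninv J x (f x)).
Proof. by rewrite /T0 => /negbTE ->. Qed.

Lemma Tfun_T0 f x : x != 0 -> Tfun A f x = T0 f x.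
Proof. by move=> x0; rewrite T0E // /Tfun (T_val hA). Qed.

(** The pointwise identity that makes [T] isometric. *)
Lemma Q_T0 f x : x != 0 -> rdot (Qweight A x (f x)) (f x) = hn (T0 f x) ^+ 2.
Proof.
move=> x0; rewrite /Qweight rdotZl (Q_val hA) // T0E //.
rewrite hnZp ?invr_ge0 ?sqrtr_ge0 // exprMn exprVn sqr_sqrtr //.
exact: pi_ge0.
Qed.

Lemma T0_lin a f g x : T0 (fun y => a *: f y + g y) x = a *: T0 f x + T0 g x.
Proof.
have [->|x0] := eqVneq x 0; first by rewrite /T0 eqxx scaler0 addr0.
by rewrite !T0E // (ninv_lin hA x0) lP scalerDr !scalerA mulrC.
Qed.

Lemma T0_modulation t f x : T0 (modulation t f) x = modulation t (T0 f) x.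
Proof.
have [->|x0] := eqVneq x 0; first by rewrite /modulation /T0 eqxx scaler0.
rewrite /modulation !T0E // (linZ (ninv_lin hA x0)) (linZ lP) !scalerA.
by rewrite mulrC.
Qed.

Lemma sm_T0 f : strongly_measurable f -> strongly_measurable (T0 f).
Proof.
apply: (sm_op (G := fun x v => if x == 0 then 0 else
  ((Num.sqrt pi)^-1)%:C *: P (ninv J x v))) => x xs vs v x0 hx hv.
rewrite (negbTE x0).
have h : ((Num.sqrt pi)^-1)%:C *: P (ninv J (xs n) (vs n)) @[n --> \oo] -->
   ((Num.sqrt pi)^-1)%:C *: P (ninv J x v).
  apply: cvgZr; apply: (lin_cvg lP (b := 1)) => [u|].
    by rewrite mul1r (sqA_le hA).
  exact: (ninv_cvg hA).
apply: cvg_trans h; apply: near_eq_cvg.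
have ax0 : 0 < `|x| by rewrite normr_gt0.
have nx : `|xs n| @[n --> \oo] --> `|x| by exact: cvg_norm.
near=> n; have xn0 : xs n != 0.
  by rewrite -normr_gt0; near: n; exact: (cvgr_gt `|x| nx).
by rewrite (negbTE xn0).
Unshelve. all: by end_near. Qed.

Lemma sm_Tfun f : strongly_measurable f -> strongly_measurable (Tfun A f).
Proof.
move=> sf; have sT := sm_T0 sf.
have -> : Tfun A f = fun x => if x \in [set 0] then Tfun A f 0 else T0 f x.
  apply/funext => x; have [->|x0] := eqVneq x 0; first by rewrite mem_set.
  by rewrite memNset; [rewrite Tfun_T0|exact/eqP].
have [q [qs qc]] := sT.
exists (fun n x => if x \in [set 0] then Tfun A f 0 else q n x); split.
  move=> n; exact: (fmeas_comp (fun p : bool * H => if p.1 then Tfun A f 0 else p.2)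
    (fmeas_pair (fmeas_bool (@measurable_set1 R 0)) (qs n))).
by move=> x; case: ifP => _ //; exact: cvg_cst.
Qed.

Lemma int_Q f : strongly_measurable f ->
  (\int[mu]_x (complex.Re (hdot (Qweight A x (f x)) (f x)))%:E = sqint (T0 f))%E.
Proof.
move=> sf; apply: (@integral_eq_off _ 0); last by move=> x x0; rewrite -Q_T0.
by apply: measurable_funX; apply: meas_hn; exact: sm_T0.
Qed.

Lemma L2QP f : L2Q f <-> strongly_measurable f /\ L2 (T0 f).
Proof.
split=> [[sf i]|[sf /L2P[_ i]]]; split => //; last by rewrite int_Q.
by apply/L2P; split; [exact: sm_T0|rewrite -int_Q].
Qed.

Lemma L2Q_lin a f g : L2Q f -> L2Q g -> L2Q (fun x => a *: f x + g x).
Proof.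
move=> /L2QP[sf hf] /L2QP[sg hg]; apply/L2QP; split; first exact: sm_linear.
have -> : T0 (fun x => a *: f x + g x) = fun x => a *: T0 f x + T0 g x.
  by apply/funext => x; rewrite T0_lin.
exact: L2_lin.
Qed.

Lemma jE_norm f : L2Q f -> hn (jE f) ^+ 2 = fine (sqint (T0 f)).
Proof.
move=> hf; have [sf _] := (L2QP f).1 hf; have [[_ dotE] _] := hE.
rewrite -rdotE /rdot (dotE _ _ hf hf) /L2dot /cintegral /= /Rintegral.
by congr fine; exact: int_Q.
Qed.

Lemma jE_lin a f g : L2Q f -> L2Q g -> jE (fun x => a *: f x + g x) = a *: jE f + jE g.
Proof. by have [[linE _] _] := hE; exact: linE. Qed.

Lemma jE_dense (u : E) (e : R) : 0 < e -> exists2 f, L2Q f & hn (u - jE f) < e.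
Proof.
move=> e0; have [_ cE] := hE.
by have [_ [f hf <-] uf] := dense_approx cE u e0; exists f.
Qed.

Lemma T_exists : exists T : E -> L, [/\ linear T, forall u : E, hn (T u) = hn u &
  forall f, L2Q f -> T (jE f) = jL (T0 f)].
Proof.
apply: (isometric_extension (D := L2Q) (j2 := jL \o T0)); first exact: jE_dense.
- move=> a f g hf hg; exists (fun y => a *: f y + g y).
  have [_ h1] := (L2QP f).1 hf; have [_ h2] := (L2QP g).1 hg.
  split; [exact: L2Q_lin|exact: jE_lin|].
  by rewrite /= -(jL_lin hj) //; congr jL; apply/funext => x; rewrite T0_lin.
- move=> f hf; have [_ h1] := (L2QP f).1 hf.
  apply/eqP; rewrite -(@eqrXn2 _ 2) ?hn_ge0 //.
  by rewrite /= (jL_norm hj) // jE_norm.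
Qed.

Lemma L2_Tfun f : L2Q f -> L2 (Tfun A f) /\ jL (Tfun A f) = jL (T0 f).
Proof.
move=> /L2QP[sf hf].
have h : L2 (Tfun A f) by apply: (L2_eq_off (c := 0) (sm_Tfun sf) hf) => x; exact: Tfun_T0.
by split => //; apply: (jL_eq_off hj (c := 0)) => // x; exact: Tfun_T0.
Qed.

Section WithT.
Variables (T : E -> L) (lT : linear T) (iT : forall u : E, hn (T u) = hn u).
Hypothesis TE : forall f, L2Q f -> T (jE f) = jL (T0 f).

(** The function [1_]a,b] (A + i x) J a'] is mapped to [1_]a,b] A^(1/2) J a'],
    up to a constant factor, and the vectors [A^(1/2) J a'] are dense. *)
Lemma T_surj l : exists u : E, T u = l.
Proof.
have hV : closed_subspace (T @` setT) by apply: csub_image => //; exact: csub_setT.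
suff [u _ <-] : (T @` setT) l by exists u.
apply: (full_density hL (W := range P) hV).
  by move=> u e e0; have [w uw] := sqA_dense hA u e0; exists (P w) => //; exists w.
move=> a b _ ab [a' _ <-].
pose c : R[i] := (Num.sqrt pi)%:C.
pose D : set R := `]a, b]%classic.
have mD : measurable D by exact: measurable_itv.
pose f := restr D (fun x => c *: nres J x a').
have sf : strongly_measurable f.
  apply: sm_restr => //.
  apply: (sm_op (G := fun x v => c *: nres J x v)) (sm_cst a') => x xs vs v _ hx hv.
  apply: cvgZr; under eq_fun do rewrite nresE; rewrite nresE; apply: cvgD.
    by apply: (lin_cvg (cK_lin hA) (b := 1)) => // u; rewrite mul1r (cK_le hA).
  apply: cvg_realZ => //; apply: cvgZr.
  by apply: (lin_cvg (sc_J_lin hA) (b := 1)) => // u; rewrite mul1r (J_le hA).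
have LP : L2 (restr D (cst (P a'))) by exact: L2_step (ltW ab).
have T0f x : x != 0 -> T0 f x = restr D (cst (P a')) x.
  move=> x0; rewrite T0E // /f; have [Dx|Dx] := pselect (D x).
    rewrite !restrT // (linZ (ninv_lin hA x0)) (nresK hA) // (linZ lP) scalerA.
    rewrite -rmorphM /= mulVf ?scale1r // gt_eqF // sqrtr_gt0; exact: pi_gt0.
  by rewrite !restrF // (lin0 (ninv_lin hA x0)) (lin0 lP) scaler0.
have L2f : L2 (T0 f) by exact: (L2_eq_off (sm_T0 sf) LP T0f).
exists (jE f) => //; rewrite TE; last exact/L2QP.
exact: (jL_eq_off hj L2f LP T0f).
Qed.

Lemma T_extends : extends L2Q (L2fun (fun _ => id)) jE jL (Tfun A) T.
Proof.
split; first exact: isometry_continuous.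
by move=> f hf; have [h e] := L2_Tfun hf; split => //; rewrite TE.
Qed.

Lemma T_unitary : unitary T.
Proof. by split => //; [exact: isometry_hdot|exact: T_surj]. Qed.

Variable U : R -> E -> E.
Hypothesis hU : forall t, extends L2Q L2Q jE jE (modulation t) (U t).

Variables (Sh Mo : R -> L -> L).
Hypothesis lSh : forall t, linear (Sh t).
Hypothesis iSh : forall t (u : L), hn (Sh t u) = hn u.
Hypothesis ShE : forall t f, L2 f -> Sh t (jL f) = jL (fun x => f (x - t)).
Hypothesis lMo : forall t, linear (Mo t).
Hypothesis iMo : forall t (u : L), hn (Mo t u) = hn u.
Hypothesis MoE : forall t f, L2 f -> Mo t (jL f) = jL (modulation t f).

Lemma T_U t (u : E) : T (U t u) = Mo t (T u).
Proof.
have /choice[f hf] (n : nat) : exists f, L2Q f /\ hn (u - jE f) < n.+1%:R^-1.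
  have [|f hf uf] := @jE_dense u n.+1%:R^-1; first by rewrite invr_gt0.
  by exists f.
have fu : jE (f n) @[n --> \oo] --> u.
  apply: (@cvg_hn_le _ _ _ _ _ _ _ (fun n => n.+1%:R^-1)).
    by near=> n; rewrite hn_distC; apply: ltW; case: (hf n).
  exact: cvg_harmonic.
have [cU UE] := hU t.
have c1 : T (U t (jE (f n))) @[n --> \oo] --> T (U t u).
  by apply: (isometry_cvg lT iT); apply: (cvg_comp _ (U t) fu); exact: cU.
have c2 : T (U t (jE (f n))) @[n --> \oo] --> Mo t (T u).
  have -> : (fun n => T (U t (jE (f n)))) = (fun n => Mo t (T (jE (f n)))).
    apply/funext => n; have [h _] := hf n; have [hm ->] := UE _ h.
    have [_ h1] := (L2QP _).1 h.
    rewrite !TE // MoE //; congr jL; apply/funext => x; exact: T0_modulation.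
  by apply: (isometry_cvg (lMo t) (iMo t)); apply: (isometry_cvg lT iT).
exact: hcvg_unique c1 c2.
Unshelve. all: by end_near. Qed.

Variables (F Finv : L -> L).
Hypothesis hF : fourier_transform jL F.
Hypothesis hFinv : cancel F Finv /\ cancel Finv F.

Let lF : linear F. Proof. by case: hF => -[]. Qed.
Let iF (u : L) : hn (F u) = hn u.
Proof.
have [[_ dF _] _] := hF.
by apply/eqP; rewrite -(@eqrXn2 _ 2) ?hn_ge0 // -!rdotE /rdot dF.
Qed.
Let FE f : L1fun f -> L2 f -> L2 (fourier_fun f) /\ F (jL f) = jL (fourier_fun f).
Proof. by move=> h1 h2; have [_ [_]] := hF; apply. Qed.

(** The two sides differ by a bounded operator, whose kernel is closed and
    contains the steps, where the integral formula for [F] applies. *)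
Lemma F_shift t l : F (Sh t l) = Mo t (F l).
Proof.
pose D l := F (Sh t l) - Mo t (F l).
have lD : linear D.
  by move=> a u v; rewrite /D (lSh t) !lF (lMo t) scalerBr opprD addrACA.
have bD (u : L) : hn (D u) <= 2 * hn u.
  by apply: le_trans (hnB _ _) _; rewrite iF iSh iMo iF; lra.
have hV : closed_subspace (D @^-1` [set 0]) by apply: csub_preimage lD bD (@csub_set0 _ _).
suff : (D @^-1` [set 0]) l by move=> /eqP; rewrite subr_eq0 => /eqP.
apply: (full_density hL (W := setT) hV).
  by move=> u e e0; exists u => //; rewrite subrr hn0.
move=> a b w ab _; set f := restr _ _.
have L2f : L2 f by exact: L2_step (ltW ab).
have L1f : L1fun f.
  apply/L1P; split; first by case: ((L2P _).1 L2f).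
  have -> : (\int[mu]_x (hn (f x))%:E = \int[mu]_(x in `]a, b]) (hn w)%:E)%E.
    rewrite [RHS]integral_mkcond; apply: eq_integral => x _.
    by rewrite /f /restr /patch; case: ifP => _ //; rewrite hn0.
  rewrite (@integral_cst _ _ _ mu) // lte_mul_pinfty ?lee_fin ?hn_ge0 //.
  have m : (mu `]a, b]%classic < +oo)%E by rewrite mu_itv ?(ltW ab) // ltry.
  exact: m.
rewrite /= /D ShE //.
have [L2F ->] := FE L1f L2f; rewrite MoE //.
have [_ ->] := FE (L1_shift t L1f) (L2_shift t L2f).
rewrite -[X in X - _](_ : jL (modulation t (fourier_fun f)) = _) ?subrr //.
by congr jL; apply/funext => x; rewrite fourier_shift.
Qed.

Let Sop := Finv \o T.

Let lFinv : linear Finv.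
Proof.
have [FK KF] := hFinv.
by move=> a u v; rewrite -[LHS]FK -[RHS]FK lF !KF.
Qed.

Let iFinv (u : L) : hn (Finv u) = hn u.
Proof. by have [FK KF] := hFinv; rewrite -iF KF. Qed.

Lemma S_lin : linear Sop.
Proof. by move=> a u v; rewrite /Sop /= lT lFinv. Qed.

Lemma S_iso (u : E) : hn (Sop u) = hn u.
Proof. by rewrite /Sop /= iFinv iT. Qed.

Lemma S_surj l : exists u : E, Sop u = l.
Proof.
have [FK KF] := hFinv; have [u hu] := T_surj (F l).
by exists u; rewrite /Sop /= hu FK.
Qed.

Lemma S_U t (u : E) : Sop (U t u) = Sh t (Sop u).
Proof.
have [FK KF] := hFinv.
by rewrite /Sop /= T_U -[T u in LHS]KF -F_shift FK.
Qed.

(** [A^(1/2)] maps these vectors to the vectors [P (K (K z))], the orbits of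
    which are integrable. *)
Definition nice z : H := J (K (K z)).

Lemma nice_dense : dense_range nice.
Proof.
have K1 u : hn (K u) <= 1 * hn u by rewrite mul1r (cK_le hA).
have J1 u : hn (J u) <= 1 * hn u by rewrite mul1r (J_le hA).
apply: (dense_range_comp (sc_J_lin hA) J1); first exact: J_dense hA.
by apply: (dense_range_comp (cK_lin hA) K1); exact: cK_dense hA.
Qed.

Let PK u : P (K u) = K (P u). Proof. by rewrite /sqA -(cK_rK hA) (cK_rJ hA). Qed.
Let PJ u : P (J u) = J (P u). Proof. by rewrite /sqA -(J_rK hA) -(J_rJ hA). Qed.

Lemma orbit_P_L2 z : L2 (sgorbit C (P (K (K z)))).
Proof. by rewrite !PK; exact: (orbit_L2 hC hA). Qed.

(** The factor [sqrt 2] is the ratio of the normalizations [pi^(-1/2)] of [T]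
    and [(2 pi)^(-1/2)] of the Fourier transform. *)
Lemma T0_nice z x : x != 0 -> T0 (cst (nice z)) x =
  (Num.sqrt 2)%:C *: fourier_fun (sgorbit C (P (K (K z)))) x.
Proof.
move=> x0; rewrite T0E // !PK (orbit_fourier hC hA) // realZ /nice -!PK.
rewrite -(ninv_comm hA x0 (sc_J_lin hA) (fun=> erefl)) PJ (ninv_comm hA x0 lP PJ).
congr (_%:C *: _); by rewrite sqrtrM ?ler0n // invfM mulrA mulfV ?mul1r.
Qed.

Lemma cst_nice z : [/\ L2Q (cst (nice z)),
  T (jE (cst (nice z))) = (Num.sqrt 2)%:C *: F (jL (sgorbit C (P (K (K z))))) &
  sqint (T0 (cst (nice z))) = (hn (nice z) ^+ 2)%:E].
Proof.
set w := P (K (K z)).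
have L1w : L1fun (sgorbit C w) by rewrite /w !PK; exact: (orbit_L1 hC hA).
have L2w : L2 (sgorbit C w) by exact: orbit_P_L2.
have [LF eF] := FE L1w L2w.
have Lc : L2 (fun x => (Num.sqrt 2)%:C *: fourier_fun (sgorbit C w) x) by exact: L2_Z.
have sc : strongly_measurable (cst (nice z)) by exact: sm_cst.
have LT : L2 (T0 (cst (nice z))) := L2_eq_off (sm_T0 sc) Lc (@T0_nice z).
have hc : L2Q (cst (nice z)) by exact/L2QP.
have Te : T (jE (cst (nice z))) = (Num.sqrt 2)%:C *: F (jL (sgorbit C w)).
  by rewrite TE // eF -(jL_Z hj) //; exact: (jL_eq_off hj LT Lc (@T0_nice z)).
split => //; rewrite (sqint_fin hj) // -TE // Te hnZp ?sqrtr_ge0 // iF.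
rewrite exprMn sqr_sqrtr // (jL_norm hj) // (orbit_energy hC hA) /=.
by rewrite mulrA mulfV ?mul1r // pnatr_eq0.
Qed.

(** Fatou's lemma along a sequence of nice vectors tending to [v]: their norms
    in [E] are the norms in [H], which stay close to that of [v]. *)
Lemma cst_L2Q v : L2Q (cst v) /\ hn (jE (cst v)) <= hn v.
Proof.
have /choice[z hz] (n : nat) : exists z, hn (v - nice z) < n.+1%:R^-1.
  by apply: nice_dense; rewrite invr_gt0.
have zv : nice (z n) @[n --> \oo] --> v.
  apply: (@cvg_hn_le _ _ _ _ _ _ _ (fun n => n.+1%:R^-1)).
    by near=> n; rewrite hn_distC; apply: ltW.
  exact: cvg_harmonic.
have sv : strongly_measurable (cst v) by exact: sm_cst.
have T0c x : T0 (cst (nice (z n))) x @[n --> \oo] --> T0 (cst v) x.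
  have [->|x0] := eqVneq x 0; first by rewrite /T0 eqxx; exact: cvg_cst.
  under eq_fun do rewrite T0E //; rewrite T0E //.
  apply: cvgZr; apply: (lin_cvg lP (b := 1)) => [u|].
    by rewrite mul1r (sqA_le hA).
  apply: (lin_cvg (ninv_lin hA x0) _ zv) => u; exact: (ninv_le hA).
have bound (e : R) : 0 < e -> (sqint (T0 (cst v)) <= ((hn v + e) ^+ 2)%:E)%E.
  move=> e0; have [N _ hN] : \forall n \near \oo, hn (nice (z n)) <= hn v + e.
    have c : hn (nice (z n)) @[n --> \oo] --> hn v by exact: cvg_hn.
    move/cvgrPdist_le : c => /(_ _ e0); apply: filterS => n.
    by rewrite ler_norml => /andP[]; lra.
  apply: (@fatou_L2 _ _ (fun n => T0 (cst (nice (z (n + N)%N))))).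
  - by move=> n; have [/L2QP[]] := cst_nice (z (n + N)%N).
  - exact: sm_T0.
  - move=> x; have := T0c x.
    by rewrite -(@cvg_shiftn N _ (fun n => T0 (cst (nice (z n))) x)).
  - move=> n; have [_ _ ->] := cst_nice (z (n + N)%N).
    rewrite lee_fin ler_sqr ?nnegrE ?hn_ge0 ?addr_ge0 ?hn_ge0 ?(ltW e0) //.
    by apply: hN => /=; exact: leq_addl.
have hL2 : L2 (T0 (cst v)).
  apply/L2P; split; first exact: sm_T0.
  by apply: le_lt_trans (bound 1 ltr01) _; rewrite ltry.
have hv : L2Q (cst v) by exact/L2QP.
split => //; apply/ler_addgt0Pr => e e0.
have := bound e e0; rewrite (sqint_fin hj) // -TE // iT lee_fin.
by rewrite ler_sqr // nnegrE ?hn_ge0 // addr_ge0 ?hn_ge0 // ltW.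
Unshelve. all: by end_near. Qed.

Lemma S_nice t z : Sop (U t (jE (cst (nice z)))) =
  (Num.sqrt 2)%:C *: jL (fun x => sgorbit C (P (K (K z))) (x - t)).
Proof.
have [FK KF] := hFinv; have [_ e _] := cst_nice z.
rewrite S_U /Sop /= e (linZ lFinv) FK (linZ (lSh t)) ShE //.
exact: orbit_P_L2.
Qed.

(** For nice constants, [S U_t] yields an orbit started at [t > 0]. The map
    [v |-> S U_t v] is bounded, so that closedness of the target gives the
    remaining constants. *)
Lemma S_Eplus_sub (u : E) : Eplus jE U u -> L2halfline jL (Sop u).
Proof.
have hV : closed_subspace (Sop @^-1` L2halfline jL).
  apply: (csub_preimage (b := 1)); first exact: S_lin.
    by move=> v; rewrite S_iso mul1r.
  exact: csub_halfline.
move=> hu; apply: (smallest_min hV _ hu) => _ [t [v [t0 ->]]] /=.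
pose X v := Sh t (Sop (jE (cst v))).
have lX : linear X.
  move=> a v1 v2; have [h1 _] := cst_L2Q v1; have [h2 _] := cst_L2Q v2.
  by rewrite /X (jE_lin a h1 h2 : jE (cst (a *: v1 + v2)) = _) S_lin (lSh t).
have bX v' : hn (X v') <= 1 * hn v'.
  by rewrite mul1r iSh S_iso; case: (cst_L2Q v').
rewrite S_U -/(X v).
have hW : closed_subspace (X @^-1` L2halfline jL).
  by apply: (csub_preimage lX bX); exact: csub_halfline.
suff : (X @^-1` L2halfline jL) v by [].
apply: (csub_close hW) => e e0; have [z vz] := nice_dense v e0.
exists (nice z) => //=; rewrite /X -S_U S_nice.
apply: (csubZ (csub_halfline hL)); exists (fun x => sgorbit C (P (K (K z))) (x - t)) => //.
split; first by apply: L2_shift; exact: orbit_P_L2.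
move=> y y0; rewrite /sgorbit restrF // hlE.
by apply/negP; rewrite -leNgt; lra.
Qed.

(** The image of [E_+] is a closed subspace containing the orbits
    [1_(y > t) C_(y - t) w] with [w = P (K (K z))] and [t > 0]. Differences of
    two of them are pieces [1_]t,s] C_(y - t) w] of an orbit; gluing short
    pieces that all start at the same vector [w] approximates the step
    [1_]a,b] w]. *)
Lemma S_Eplus_sup f : L2 f -> (forall y, y < 0 -> f y = 0) -> (Sop @` Eplus jE U) (jL f).
Proof.
have hV : closed_subspace (Sop @` Eplus jE U).
  by apply: csub_image; [exact: S_lin|exact: S_iso|exact: csub_smallest].
have V1 t z : 0 < t ->
    (Sop @` Eplus jE U) (jL (fun x => sgorbit C (P (K (K z))) (x - t))).
  move=> t0.
  have h : (Sop @` Eplus jE U) (Sop (U t (jE (cst (nice z))))).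
    exists (U t (jE (cst (nice z)))) => //.
    by move=> V [_]; apply; exists t, (nice z).
  have q0 : Num.sqrt 2 != 0 :> R by rewrite gt_eqF // sqrtr_gt0.
  by have := csubZ hV ((Num.sqrt 2)^-1)%:C h; rewrite S_nice realZ mulVf // scale1r.
have SPKK t z : 0 <= t -> S t (P (K (K z))) = P (K (K (S t z))).
  by move=> t0; rewrite (Cz_sqA hC hA) // !(Cz_K hC hA).
(* After time [s], the orbit of [w] started at [t] coincides with the orbit of
   [C_(s - t) w] started at [s]. *)
have V2 t s z : 0 < t -> t < s -> let g := restr `]t, s]%classic (fun y => S (y - t) (P (K (K z)))) in
    L2 g /\ (Sop @` Eplus jE U) (jL g).
  move=> t0 ts g; set w := P (K (K z)).
  have -> : g = fun x => sgorbit C w (x - t) - sgorbit C (P (K (K (S (s - t) z)))) (x - s).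
    apply/funext => y; rewrite -SPKK ?subr_ge0 ?(ltW ts) // -/w /g /sgorbit.
    have [h|h] := leP y t.
      rewrite !restrF ?subrr // ?hlE /= ?in_itv /=; lra.
    have ht : hl (y - t) by rewrite hlE subr_gt0.
    rewrite (restrT _ ht); have [h'|h'] := leP y s.
      rewrite restrT; last by rewrite /= in_itv /= h.
      by rewrite restrF ?subr0 // hlE; lra.
    rewrite restrF; last by rewrite /= in_itv /= => /andP[_]; rewrite leNgt h'.
    rewrite restrT; last by rewrite hlE subr_gt0.
    rewrite -(Cz_add hC) ?subr_ge0 ?(ltW h') ?(ltW ts) //.
    have -> : y - s + (s - t) = y - t by ring.
    by rewrite subrr.
  have La : L2 (fun x => sgorbit C w (x - t)) by apply: L2_shift; exact: orbit_P_L2.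
  have Lb : L2 (fun x => sgorbit C (P (K (K (S (s - t) z)))) (x - s)).
    by apply: L2_shift; exact: orbit_P_L2.
  split; first exact: L2_B.
  by rewrite (jL_B hj) //; apply: csubB => //; apply: V1 => //; exact: lt_trans ts.
apply: (step_density hj hV (W := range (fun z => P (K (K z)))) (c := 0)).
- move=> u e e0.
  have d : dense_range (fun z => P (K (K z))).
    have K1 v : hn (K v) <= 1 * hn v by rewrite mul1r (cK_le hA).
    have P1 v : hn (P v) <= 1 * hn v by rewrite mul1r (sqA_le hA).
    apply: (dense_range_comp lP P1); first exact: sqA_dense hA.
    by apply: (dense_range_comp (cK_lin hA) K1); exact: cK_dense hA.
  by have [z uz] := d u e e0; exists (P (K (K z))) => //; exists z.
move=> a b _ a0 ab [z _ <-]; set w := P (K (K z)).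
have [w0|w0] := eqVneq (hn w) 0.
  have -> : restr `]a, b]%classic (cst w) = fun=> 0.
    by apply/funext => x; rewrite /restr; case: ifP => // _; apply: hn_eq0.
  by rewrite (jL_0 hj); exact: csub0.
have {}w0 : 0 < hn w by rewrite lt0r w0 hn_ge0.
apply: (csub_close hV) => e e0.
have Lw : L2 (restr `]a, b]%classic (cst w)) by exact: L2_step (ltW ab).
(* The pointwise error will be at most [c] times the step, which bounds the
   error in norm by [c] times the norm of the step. *)
pose c := e / (hn (jL (restr `]a, b]%classic (cst w))) + 1).
have m0 : 0 < hn (jL (restr `]a, b]%classic (cst w))) + 1 by rewrite ltr_wpDl ?hn_ge0.
have c0 : 0 < c by rewrite divr_gt0.
have [d d0 hd] := Cz_cont0 hC w (mulr_gt0 c0 w0).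
(* Number of pieces that makes their length [h] smaller than [d], the time
   during which the orbit stays within [c |w|] of [w]. *)
pose N := (Num.truncn ((b - a) / d)).+1.
pose h := (b - a) / N%:R.
have N0 : 0 < N%:R :> R by rewrite ltr0n.
have h0 : 0 < h by rewrite divr_gt0 // subr_gt0.
have hd' : h < d.
  rewrite /h ltr_pdivrMr // mulrC -ltr_pdivrMr //.
  have ba : 0 < b - a by rewrite subr_gt0.
  by have /andP[] := Num.Theory.truncn_itv (ltW (divr_gt0 ba d0)).
have key k : exists g, [/\ L2 g, (Sop @` Eplus jE U) (jL g) &
   forall x, hn (g x - restr `]a, a + k%:R * h]%classic (cst w) x) <=
     c * hn (restr `]a, a + k%:R * h]%classic (cst w) x)].
  elim: k => [|k [g [Lg Vg hg]]].
    exists (fun=> 0); split; [exact: L2_0|by rewrite (jL_0 hj); exact: csub0|].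
    move=> x; rewrite restrF ?subrr ?hn0 ?mulr0 // /= in_itv /= mul0r addr0.
    by move=> /andP[h1 h2]; move: (lt_le_trans h1 h2); rewrite ltxx.
  pose p := a + k%:R * h; pose q := a + k.+1%:R * h.
  have pq : p < q by rewrite ltrD2l ltr_pM2r // ltr_nat.
  have ap : a <= p by rewrite lerDl mulr_ge0 // ltW.
  have p0 : 0 < p by apply: lt_le_trans ap.
  have [Lr Vr] := V2 p q z p0 pq.
  set r := restr _ _ in Lr Vr.
  exists (fun x => g x + r x); split.
  + by have := L2_lin 1 Lg Lr; under eq_fun do rewrite scale1r.
  + by rewrite (jL_D hj) //; exact: csubD.
  move=> x; have := hg x; rewrite -/p -/q => hgx.
  have [x1|x1] := leP x p.
    have -> : r x = 0 by rewrite /r restrF // /= in_itv /= ltNge x1.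
    rewrite addr0; suff <- : restr `]a, p]%classic (cst w) x = restr `]a, q]%classic (cst w) x by [].
    have [xa|xa] := leP x a.
      by rewrite !restrF //= in_itv /= ltNge xa.
    by rewrite !restrT //= in_itv /= xa ?x1 // (le_trans x1 (ltW pq)).
  have xa : a < x by exact: le_lt_trans ap x1.
  move: hgx; rewrite (restrF (D := `]a, p]%classic)) ?subr0 ?hn0 ?mulr0; last first.
    by rewrite /= in_itv /= leNgt x1 andbF.
  move=> hgx; have {hgx} -> : g x = 0.
    by apply: hn_eq0; apply/eqP; rewrite eq_le hgx hn_ge0.
  rewrite add0r; have [x2|x2] := leP x q; last first.
    rewrite /r !restrF ?subrr ?hn0 ?mulr0 //= in_itv /= leNgt x2 andbF //.
  rewrite /r !restrT //= ?in_itv /= ?x1 ?x2 ?xa //.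
  apply/ltW/hd; rewrite subr_ge0 (ltW x1) /=; apply: le_lt_trans hd'.
  by move: x2; rewrite /q /p -natr1 mulrDl mul1r; lra.
have [g [Lg Vg]] := key N.
have -> : a + N%:R * h = b by rewrite /h; field; rewrite gt_eqF.
move=> hg; exists (jL g) => //.
rewrite hn_distC -(jL_B hj) //.
have LB := L2_B Lg Lw.
have [s1 _] := (L2P _).1 LB; have [s2 _] := (L2P _).1 Lw.
have := sqint_le s1 s2 hg; rewrite !(sqint_fin hj) // -EFinM lee_fin -exprMn => hh.
apply: (@le_lt_trans _ _ (c * hn (jL (restr `]a, b]%classic (cst w))))).
  have cn : 0 <= c * hn (jL (restr `]a, b]%classic (cst w))).
    by rewrite mulr_ge0 ?hn_ge0 // ltW.
  by rewrite -(@ler_pXn2r _ 2) ?nnegrE ?hn_ge0.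
rewrite /c mulrAC ltr_pdivrMr // ltr_pM2l //.
by rewrite ltrDl.
Qed.

Lemma S_outgoing : outgoing_realization (Eplus jE U) U jL (Finv \o T).
Proof.
split.
- split; [exact: S_lin|apply: isometry_hdot; [exact: S_lin|exact: S_iso]|exact: S_surj].
- apply/seteqP; split.
    by move=> _ [u hu <-]; exact: S_Eplus_sub.
  by move=> _ [f [hf f0] <-]; exact: S_Eplus_sup.
- move=> t u f hf e; rewrite -[LHS]/(Sop (U t u)) S_U.
  by rewrite -[Sop u]/((Finv \o T) u) e ShE.
Qed.

End WithT.

End Realization.

Theorem proposition4p4 (R : realType) (H : hilbertType R)
    (C : R -> H -> H) (hC : hermitian_contraction_semigroup C)
    (kerA : forall u, generator C u 0 -> u = 0)
    (E : hilbertType R) (jE : (R -> H) -> E)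
    (hE : L2completion (Qweight (generator C)) jE)
    (L : hilbertType R) (jL : (R -> H) -> L) (hL : L2space jL)
    (U : R -> E -> E)
    (hU : forall t, extends (L2fun (Qweight (generator C)))
                            (L2fun (Qweight (generator C)))
                            jE jE (modulation t) (U t))
    (F Finv : L -> L) (hF : fourier_transform jL F)
    (hFinv : cancel F Finv /\ cancel Finv F) :
  exists T : E -> L,
    [/\ extends (L2fun (Qweight (generator C))) (L2fun (fun _ => id))
                jE jL (Tfun (generator C)) T,
        unitary T
      & outgoing_realization (Eplus jE U) U jL (Finv \o T)].
Proof.
have [J [rJ [rK hA]]] := generator_calculus hC kerA.
have [T [lT iT TE]] := T_exists hA hE hL.
have exSh t : exists X : L -> L, [/\ linear X, forall u, hn (X u) = hn u &
    forall f, L2 f -> X (jL f) = jL (fun x => f (x - t))].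
  apply: (L2_operator hL (phi := fun f x => f (x - t))) => //.
    by move=> f; exact: L2_shift.
  by move=> f /L2P[sf _]; exact: sqint_shift.
have exMo t : exists X : L -> L, [/\ linear X, forall u, hn (X u) = hn u &
    forall f, L2 f -> X (jL f) = jL (modulation t f)].
  apply: (L2_operator hL (phi := modulation t)).
  - by move=> f; exact: L2_modulation.
  - by move=> a f g x; rewrite /modulation scalerDr !scalerA mulrC.
  - by move=> f _; exact: sqint_modulation.
have /choice[Sh hSh] := exSh; have /choice[Mo hMo] := exMo.
exists T; split.
- exact: (T_extends hA hL lT iT TE).
- exact: (T_unitary hA hL lT iT TE).
- have h1 t : linear (Sh t) by case: (hSh t).
  have h2 t u : hn (Sh t u) = hn u by case: (hSh t).
  have h3 t f : L2 f -> Sh t (jL f) = jL (fun x => f (x - t)) by case: (hSh t) => _ _; exact.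
  have h4 t : linear (Mo t) by case: (hMo t).
  have h5 t u : hn (Mo t u) = hn u by case: (hMo t).
  have h6 t f : L2 f -> Mo t (jL f) = jL (modulation t f) by case: (hMo t) => _ _; exact.
  by apply: (S_outgoing hC hA hE hL lT iT TE hU h1 h2 h3 h4 h5 h6 hF hFinv).
Qed.
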